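(* Suppose that Assumptions 1, 2 and 3 (stated in the context) hold, and let $\{x_k\}$ be the sequence generated by the Anderson(1)-SEG algorithm (described in the context). Then $$\min_{0\le k\le N}\mathbb{E}\left[r_\gamma(x_k)^2\right]=\mathcal{O}\left(\frac1N\right),$$ that is, there is a constant $c>0$ such that $\min_{0\le k\le N}\mathbb{E}[r_\gamma(x_k)^2]\le c/N$ for all $N\in\mathbb{N}$, $N\geq 1$.
   Context: Setting. $X\subseteq\mathbb{R}^n$ is a closed convex set, $(\Xi,\mathcal{G})$ is a measurable space, $T:\Xi\times\mathbb{R}^n\to\mathbb{R}^n$ is measurable, and $\xi:\Omega\to\Xi$ is a random variable on a probability space $(\Omega,\mathcal{F},\mathbb{P})$. Put $H(x):=\mathbb{E}[T(\xi,x)]$. ${\rm SVI}(X,H)$ is the problem of finding $x^*\in X$ with $\langle H(x^* ),x-x^*\rangle\ge 0$ for all $x\in X$; its solution set is ${\rm SOL}(X,H)$, assumed nonempty. $P_X$ is the Euclidean projection onto $X$, $\|\cdot\|$ is the Euclidean norm, and $r_t(x):=\|P_X(x-tH(x))-x\|$ for $t>0$. Assumption 1. $H$ is pseudomonotone on $X$: for all $x,y\in X$, $\langle H(x),y-x\rangle\ge 0$ implies $\langle H(y),y-x\rangle\ge 0$. Assumption 2. (i) There is a measurable $L:\Xi\to\mathbb{R}$ with $L(\xi)\ge 1$ with probability $1$, with $\|T(\xi,x)-T(\xi,y)\|\le L(\xi)\|x-y\|$ for any $x,y\in\mathbb{R}^n$, and with $\mathbb{E}[L(\xi)^{2p}]<\infty$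 for $p\ge 2$ (every $p\ge2$). (ii) There exist $\check{x}\in\mathbb{R}^n$ and a number $\bar q\ge 2$ such that $\mathbb{E}[\|T(\xi,\check{x})\|^{2\bar q}]<\infty$. Assumption 3. In the algorithm below, $\{\xi^k_j\}_{j=1}^{S_k}$ and $\{\eta^k_j\}_{j=1}^{S_k}$ are two mutually independent sets of i.i.d. samples drawn from $\xi$, and $\sum_{k=0}^\infty \frac{1}{\sqrt{S_k}}<\infty$. Samples of iteration $k$ are also independent of those of earlier iterations: writing $\xi^k=\{\xi^k_j\}_{j=1}^{S_k}$, $\eta^k=\{\eta^k_j\}_{j=1}^{S_k}$, $\mathcal{F}_k=\sigma(x_0,\xi^0,\dots,\xi^{k-1},\eta^0,\dots,\eta^{k-1})$ and $\hat{\mathcal{F}}_k=\sigma(x_0,\xi^0,\dots,\xi^{k},\eta^0,\dots,\eta^{k-1})$, $\xi^k$ is independent of $\mathcal{F}_k$ and $\eta^k$ is independent of $\hat{\mathcal{F}}_k$. Anderson(1)-SEG algorithm. Initialization: choose $x_0\in X$, $\nu\ge 0$, $\gamma\in(0,1]$, $\rho\in(0,1)$, $\mu\in(0,\frac{\sqrt3}{3})$, $\tau>\frac12$, $\theta_0=1$, a sequence of positive integers $\{S_k\}$ (sample rate), and a (sufficiently large) $M>0$. Write $H_{\xi^k}(x)=\frac1{S_k}\sum_{j=1}^{S_k}T(\xi^k_j,x)$ and $H_{\eta^k}(x)=\frac1{S_k}\sum_{j=1}^{S_k}T(\eta^k_j,x)$. For $k=0,1,2,\dots$: Step 1: generate samples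 $\{\xi^k_j\}_{j=1}^{S_k}$, $\{\eta^k_j\}_{j=1}^{S_k}$ of $\xi$. Let $t_k=\gamma$ and compute $F_{\gamma,\xi^k}=P_X(x_k-\gamma H_{\xi^k}(x_k))-x_k$. If $F_{\gamma,\xi^k}=\mathbf 0$, set $x_{k+1}=x_k$, $\theta_{k+1}=\theta_k$ (and pass to the next $k$). Otherwise go to Step 2. Step 2 (line search): compute $y_{k+0.5}=P_X(x_k-t_kH_{\xi^k}(x_k))$. If $t_k\|H_{\xi^k}(x_k)-H_{\xi^k}(y_{k+0.5})\|\le\mu\|x_k-y_{k+0.5}\|$, go to Step 3. Otherwise set $t_k=\rho t_k$ and repeat Step 2. Step 3: compute $F_{t_k,\xi^k}=y_{k+0.5}-x_k$, $y_{k+1}=P_X(x_k-t_kH_{\eta^k}(y_{k+0.5}))$ and $\tilde F_{t_k,\eta^k}=y_{k+1}-x_k$. If $\|\tilde F_{t_k,\eta^k}\|<\min\{\|F_{t_k,\xi^k}\|,\nu\theta_k^{-\tau}\}$, set $\alpha_k=\frac{\langle\tilde F_{t_k,\eta^k},\tilde F_{t_k,\eta^k}-F_{t_k,\xi^k}\rangle}{\|\tilde F_{t_k,\eta^k}-F_{t_k,\xi^k}\|^2}$. Otherwise set $\alpha_k=M+1$. Step 4: if $|\alpha_k|\le M$, set $x_{k+1}=\alpha_kx_k+(1-\alpha_k)y_{k+1}$ and $\theta_{k+1}=\theta_k+1$. Otherwise set $x_{k+1}=y_{k+1}$ and $\theta_{k+1}=\theta_k$. *)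

(* Defs.v *)
From HB Require Import structures.
From mathcomp Require Import all_boot all_order all_algebra.
From mathcomp Require Import all_classical all_reals all_analysis.

Set Implicit Arguments.
Unset Strict Implicit.
Unset Printing Implicit Defensive.

Import Order.TTheory GRing.Theory Num.Theory.
Import numFieldNormedType.Exports.

Local Open Scope classical_set_scope.
Local Open Scope ring_scope.

(* The library's norm on 'rV[R]_n is the sup norm, hence [enorm]. *)
Section euclidean.
Context {R : realType} {n : nat}.
Implicit Types (u v x y : 'rV[R]_n) (X : set 'rV[R]_n).

Definition dotv u v : R := \sum_(i < n) u 0 i * v 0 i.

Definition enorm u : R := Num.sqrt (dotv u u).

Definition is_proj X x y :=
  X y /\ forall z, X z -> enorm (x - y) <= enorm (x - z).

Definition proj X x : 'rV[R]_n := xget 0 (is_proj X x).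

End euclidean.

(* Borel sigma-algebra of R^n: the product sigma-algebra, generated by the
   coordinates, as the library does for [n.-tuple T]. *)
Definition rV_display : measure_display.
Proof. exact: default_measure_display. Qed.

Section measurable_rV.
Context {R : realType} (n : nat).

Let coor : 'I_n -> 'rV[R]_n -> R := fun i v => v 0 i.

Let rV_set0 : g_sigma_preimage coor set0.
Proof. exact: sigma_algebra0. Qed.

Let rV_setC A : g_sigma_preimage coor A -> g_sigma_preimage coor (~` A).
Proof. exact: sigma_algebraC. Qed.

Let rV_bigcup (F : _^nat) : (forall i, g_sigma_preimage coor (F i)) ->
  g_sigma_preimage coor (\bigcup_i (F i)).
Proof. exact: sigma_algebra_bigcup. Qed.

HB.instance Definition _ := @isMeasurable.Build rV_display
  'rV[R]_n (g_sigma_preimage coor) rV_set0 rV_setC rV_bigcup.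

End measurable_rV.

Section variational_inequality.
Context {R : realType} {n : nat}.
Implicit Types (X : set 'rV[R]_n) (H : 'rV[R]_n -> 'rV[R]_n) (x y : 'rV[R]_n).

Definition SOL X H : set 'rV[R]_n :=
  [set s | X s /\ forall x, X x -> 0 <= dotv (H s) (x - s)].

Definition pseudomonotone_on X H := forall x y, X x -> X y ->
  0 <= dotv (H x) (y - x) -> 0 <= dotv (H y) (y - x).

Definition residual X H (t : R) x : R := enorm (proj X (x - t *: H x) - x).

End variational_inequality.

Section probability.
Context {d d' : measure_display} {Omega : measurableType d}
  {Xi : measurableType d'} {R : realType} (P : probability Omega R).
Local Open Scope ereal_scope.

Definition expected_map n (xi : Omega -> Xi)
    (T : Xi -> 'rV[R]_n -> 'rV[R]_n) (x : 'rV[R]_n) : 'rV[R]_n :=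
  \row_i fine 'E_P[fun w => T (xi w) x ord0 i].

Definition indep_classes (F G : set (set Omega)) :=
  forall A B, F A -> G B -> P (A `&` B) = P A * P B.

(* Since some of the [B j] may be the whole space, this covers subfamilies. *)
Definition mutually_independent m (Z : 'I_m -> Omega -> Xi) :=
  forall B : 'I_m -> set Xi, (forall j, measurable (B j)) ->
    P [set w | forall j, B j (Z j w)] = \prod_(j < m) P (Z j @^-1` B j).

Definition same_law (Z Z' : Omega -> Xi) :=
  forall B, measurable B -> P (Z @^-1` B) = P (Z' @^-1` B).

Definition iid_sample (xi : Omega -> Xi) m (Z : 'I_m -> Omega -> Xi) :=
  mutually_independent Z /\ forall j, same_law (Z j) xi.

End probability.

Section filtration.
Context {d d' d'' : measure_display} {Omega : measurableType d}
  {Xi : measurableType d'} {E : measurableType d''}.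
Variables (S : nat -> nat) (x0 : Omega -> E).
Variables (xis etas : forall k, 'I_(S k) -> Omega -> Xi).

(* F_k = sigma(x_0, xi^0, .., xi^(k-1), eta^0, .., eta^(k-1)) *)
Definition sigmaF k : set (set Omega) :=
  <<s preimage_set_system setT x0 measurable `|`
      \bigcup_(i in `I_k) (g_sigma_preimage (@xis i) `|`
                           g_sigma_preimage (@etas i)) >>.

(* \hat F_k = sigma(x_0, xi^0, .., xi^k, eta^0, .., eta^(k-1)) *)
Definition sigmaFhat k : set (set Omega) :=
  <<s sigmaF k `|` g_sigma_preimage (@xis k) >>.

End filtration.

Section algorithm.
Context {R : realType} {n : nat}.
Variables (X : set 'rV[R]_n) (nu gamma rho mu tau M : R).
Implicit Types (G : 'rV[R]_n -> 'rV[R]_n) (x : 'rV[R]_n).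

Definition accept G x (t : R) : bool :=
  let y := proj X (x - t *: G x) in
  t * enorm (G x - G y) <= mu * enorm (x - y).

(* First accepted value among gamma, rho gamma, rho^2 gamma, ..; the value
   gamma when there is none is a convention: under the Lipschitz assumption the
   search stops with probability one. *)
Definition line_search G x : R :=
  if pselect (exists l, accept G x (rho ^+ l * gamma)) is left h
  then rho ^+ ex_minn h * gamma else gamma.

(* One iteration on the pair (x_k, theta_k), where [Gxi] and [Geta] stand for
   H_{xi^k} and H_{eta^k}. *)
Definition seg_step (Gxi Geta : 'rV[R]_n -> 'rV[R]_n)
    (s : 'rV[R]_n * nat) : 'rV[R]_n * nat :=
  let: (x, theta) := s in
  if proj X (x - gamma *: Gxi x) - x == 0 then (x, theta) else
  let t := line_search Gxi x in
  let yhalf := proj X (x - t *: Gxi x) in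
  let F := yhalf - x in
  let y := proj X (x - t *: Geta yhalf) in
  let Ft := y - x in
  let alpha :=
    if enorm Ft < Num.min (enorm F) (nu * theta%:R `^ (- tau))
    then dotv Ft (Ft - F) / enorm (Ft - F) ^+ 2 else M + 1 in
  if `|alpha| <= M
  then (alpha *: x + (1 - alpha) *: y, theta.+1) else (y, theta).

Definition sample_mean (Xi : Type) (T : Xi -> 'rV[R]_n -> 'rV[R]_n)
    m (z : 'I_m -> Xi) x : 'rV[R]_n :=
  m%:R^-1 *: \sum_(j < m) T (z j) x.

Fixpoint seg_state (Omega Xi : Type) (T : Xi -> 'rV[R]_n -> 'rV[R]_n)
    (S : nat -> nat) (x0 : Omega -> 'rV[R]_n)
    (xis etas : forall k, 'I_(S k) -> Omega -> Xi) (k : nat) (w : Omega) :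
    'rV[R]_n * nat :=
  if k is k'.+1 then
    seg_step (sample_mean T (fun j => xis k' j w))
             (sample_mean T (fun j => etas k' j w))
             (seg_state T x0 xis etas k' w)
  else (x0 w, 1%N).

Definition seg_iterate (Omega Xi : Type) (T : Xi -> 'rV[R]_n -> 'rV[R]_n)
    (S : nat -> nat) (x0 : Omega -> 'rV[R]_n)
    (xis etas : forall k, 'I_(S k) -> Omega -> Xi) (k : nat) (w : Omega) :
    'rV[R]_n :=
  (seg_state T x0 xis etas k w).1.

End algorithm.

(* Main.v *)
From Pilot Require Import Defs.
From HB Require Import structures.
From mathcomp Require Import all_boot all_order all_algebra.
From mathcomp Require Import ring lra.
From mathcomp Require Import all_classical all_reals all_analysis.
From mathcomp Require Import measurable_realfun.

(** Why the rate holds.  Fix a solution [xs].  For fixed samples, one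
    extragradient step decreases the squared distance to [xs] by a multiple of
    [enorm (x - h) ^+ 2], where [h] is the half point, up to the sampling errors
    of the two sampled operators at [h] ([extragradient_descent]): the solution
    enters only through [dotv (H h) (xs - h) <= 0], which pseudomonotonicity
    gives because [h] lies in [X], and [mu < sqrt 3 / 3] leaves a positive factor
    [1 - 3 * mu ^+ 2].

    An Anderson step moves along the line through the old and the new point.  Its
    weight is at most [1 / 2], so half of the decrease is kept; a negative weight
    extrapolates, possibly out of [X], at a cost of order
    [theta `^ (- (2 * tau))].  As [theta] counts these steps and [2 * tau > 1], a
    potential in [theta] pays for all of them ([theta_potential_drop]).  This
    gives a Lyapunov function, the squared distance plus the potential.

    The decrease controls the residual: projected steps scale well with the step
    size ([proj_step_scaling]), and the line search stops at a step of order
    [1 / Lh], with [Lh] the Lipschitz constant of the sampled operator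
    ([line_searchP]).  The random factor [1 / Lh ^+ 2] is bounded below by an
    affine function of [Lh ^+ 2], whose mean is known ([residual_le_step]).

    The errors are bounded in the mean by conditioning: at a point determined by
    the history, the error of a fresh sample of size [S] has second moment of
    order [1 / S] ([sample_variance], through [indep_classes_mean_le]).  The half
    point is not determined by the history, since it depends on the sample
    through the sampled value at [x] and through the step size.  The first
    dependence costs a Lipschitz constant times the error at [x]
    ([correlated_error], [sample_weighted_variance]); this product is of order
    [1 / sqrt S] only.  For the second, the step sizes form a geometric sequence
    and the errors come with their squares, so the errors at all trial points can
    be summed ([mean_trial_err]).

    Taking means, the Lyapunov function satisfies a linear recursion whose
    coefficients are of order [1 / sqrt S] and hence summable ([mean_descent]);
    a Gronwall argument bounds the sum of the mean squared residuals
    ([residual_sum_bound]), and the least of [N + 1] numbers is at most their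
    mean. *)

Set Implicit Arguments.
Unset Strict Implicit.
Unset Printing Implicit Defensive.

Import Order.TTheory GRing.Theory Num.Theory.
Import numFieldNormedType.Exports.

Local Open Scope classical_set_scope.
Local Open Scope ring_scope.

(* [proj] is also a projection of product spaces. *)
Local Notation proj := Pilot.Defs.proj.

(** * Euclidean geometry *)

Section euclidean_geometry.
Context {R : realType} {n : nat}.
Implicit Types (u v w x y z : 'rV[R]_n) (a b t : R).

Lemma dotvC u v : dotv u v = dotv v u.
Proof. by apply: eq_bigr => i _; rewrite mulrC. Qed.

Lemma dotvDl u v w : dotv (u + v) w = dotv u w + dotv v w.
Proof. by rewrite -big_split/=; apply: eq_bigr => i _; rewrite mxE mulrDl. Qed.

Lemma dotvZl a u v : dotv (a *: u) v = a * dotv u v.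
Proof. by rewrite mulr_sumr; apply: eq_bigr => i _; rewrite mxE mulrA. Qed.

Lemma dotvDr u v w : dotv u (v + w) = dotv u v + dotv u w.
Proof. by rewrite dotvC dotvDl !(dotvC u). Qed.

Lemma dotvZr a u v : dotv u (a *: v) = a * dotv u v.
Proof. by rewrite dotvC dotvZl dotvC. Qed.

Lemma dotvNl u v : dotv (- u) v = - dotv u v.
Proof. by rewrite -scaleN1r dotvZl mulN1r. Qed.

Lemma dotvNr u v : dotv u (- v) = - dotv u v.
Proof. by rewrite dotvC dotvNl dotvC. Qed.

Definition dotvE := (dotvDl, dotvDr, dotvZl, dotvZr, dotvNl, dotvNr).

Lemma dotv_ge0 u : 0 <= dotv u u.
Proof. by apply: sumr_ge0 => i _; rewrite -expr2 sqr_ge0. Qed.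

Lemma enorm_ge0 u : 0 <= enorm u.
Proof. exact: sqrtr_ge0. Qed.

Lemma enorm_sq u : enorm u ^+ 2 = dotv u u.
Proof. by rewrite sqr_sqrtr// dotv_ge0. Qed.

Lemma enorm_eq0 u : (enorm u == 0) = (u == 0).
Proof.
apply/idP/eqP => [|->]; last first.
  by rewrite /enorm /dotv big1 ?sqrtr0// => i _; rewrite mxE mul0r.
rewrite -sqrf_eq0 enorm_sq psumr_eq0; last first.
  by move=> i _; rewrite -expr2 sqr_ge0.
move=> /allP u0; apply/rowP => i; rewrite mxE; apply/eqP.
by have := u0 i (mem_index_enum _); rewrite -expr2 sqrf_eq0.
Qed.

Lemma enorm0 : enorm (0 : 'rV[R]_n) = 0.
Proof. by apply/eqP; rewrite enorm_eq0. Qed.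

Lemma cauchy_schwarz u v : dotv u v <= enorm u * enorm v.
Proof.
have [/eqP|u0] := eqVneq (enorm u) 0.
  by rewrite enorm_eq0 => /eqP ->; rewrite -(scale0r 0) dotvZl scale0r enorm0 !mul0r.
have [/eqP|v0] := eqVneq (enorm v) 0.
  by rewrite enorm_eq0 => /eqP ->; rewrite -(scale0r 0) dotvZr scale0r enorm0 mul0r mulr0.
have up : 0 < enorm u by rewrite lt_neqAle eq_sym u0 enorm_ge0.
have vp : 0 < enorm v by rewrite lt_neqAle eq_sym v0 enorm_ge0.
have := dotv_ge0 (enorm v *: u - enorm u *: v).
rewrite !dotvE -!enorm_sq (dotvC v u).
have uvp := mulr_gt0 up vp.
move: uvp; set p := enorm u; set q := enorm v; set d := dotv u v => uvp h.
rewrite -(ler_pM2l uvp); lra.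
Qed.

Lemma enormZ a u : enorm (a *: u) = `|a| * enorm u.
Proof. by rewrite /enorm dotvZl dotvZr mulrA -expr2 sqrtrM ?sqr_ge0// sqrtr_sqr. Qed.

Lemma enormN u : enorm (- u) = enorm u.
Proof. by rewrite -scaleN1r enormZ normrN1 mul1r. Qed.

Lemma enormB u v : enorm (u - v) = enorm (v - u).
Proof. by rewrite -enormN opprB. Qed.

Lemma ler_enormD u v : enorm (u + v) <= enorm u + enorm v.
Proof.
rewrite -(@ler_pXn2r _ 2) ?nnegrE ?addr_ge0 ?enorm_ge0//.
rewrite enorm_sq !dotvE (dotvC v u) -!enorm_sq.
have := cauchy_schwarz u v; lra.
Qed.

Lemma enorm_dist x y z : enorm (x - z) <= enorm (x - y) + enorm (y - z).
Proof. by rewrite (le_trans _ (ler_enormD _ _))// addrA subrK. Qed.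

Lemma ler_enormB_dist x y : enorm x <= enorm y + enorm (x - y).
Proof. by rewrite (le_trans _ (ler_enormD _ _))// addrC subrK. Qed.

Lemma ler_enorm_sum m (F : 'I_m -> 'rV[R]_n) :
  enorm (\sum_(j < m) F j) <= \sum_(j < m) enorm (F j).
Proof.
elim/big_ind2: _ => [|a p b q ap bq|//]; first by rewrite enorm0.
by apply: le_trans (ler_enormD _ _) _; exact: lerD.
Qed.

Lemma coord_le_enorm u i : `|u 0 i| <= enorm u.
Proof.
rewrite -(@ler_pXn2r _ 2) ?nnegrE ?enorm_ge0// enorm_sq real_normK ?num_real//.
rewrite /dotv (bigD1 i)//= -expr2 lerDl; apply: sumr_ge0 => j _.
by rewrite -expr2 sqr_ge0.
Qed.

Lemma enorm_sqD u v : enorm (u + v) ^+ 2 <= 2 * enorm u ^+ 2 + 2 * enorm v ^+ 2.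
Proof.
rewrite enorm_sq !dotvE (dotvC v u) -!enorm_sq.
have := dotv_ge0 (u - v); rewrite !dotvE (dotvC v u) -!enorm_sq; lra.
Qed.

Lemma enorm_continuous : continuous (enorm : 'rV[R]_n -> R).
Proof.
move=> x; apply: (@continuous_comp _ _ _ (fun u => dotv u u) Num.sqrt);
  last exact: sqrt_continuous.
have: continuous (fun u : 'rV[R]_n => dotv u u); last exact.
apply: continuous_big => [|i _ u]; first exact: add_continuous.
have cu := @coord_continuous R 1 n 0 i u.
exact: (cvgM cu cu).
Qed.

End euclidean_geometry.

#[local] Opaque dotv enorm.

(* Linear arithmetic treats inner products and norms as atoms; comparing these
   as terms is expensive, so they are first replaced by variables. *)
Ltac scalars := repeat match goal with
  | |- context [dotv ?a ?b] => generalize (dotv a b); intro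
  | |- context [enorm ?a] => generalize (enorm a); intro
  end.

(** * Projection onto a closed convex set *)

Section projection.
Context {R : realType} {n : nat} (X : set 'rV[R]_n).
Hypotheses (closedX : closed X)
  (convexX : convex_set (X : set (convex_lmodType 'rV[R]_n))) (X0 : X !=set0).
Implicit Types (x y z g : 'rV[R]_n) (s t : R).

(** Only the part of [X] no farther from [x] than some point of [X] matters; it
    is compact, and the distance to [x] attains its minimum there. *)
Lemma is_proj_exists x : exists y, is_proj X x y.
Proof.
have [z0 Xz0] := X0.
pose r := enorm (x - z0).
pose A := X `&` [set z | enorm (x - z) <= r].
have cdist : continuous (fun z => enorm (x - z)).
  move=> z; apply: (@continuous_comp _ _ _ (fun z => x - z) enorm);
    last exact: enorm_continuous.
  by apply: continuousB => /=; [exact: cst_continuous|move=> ?; exact: cvg_id].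
have cA : compact A.
  apply: bounded_closed_compact.
    exists (enorm x + r); split; first exact: num_real.
    move=> M ltM z [_ /= zr]; apply: le_trans (ltW ltM).
    have zE : enorm z <= enorm x + r.
      rewrite (le_trans (ler_enormB_dist z x))// lerD2l enormB//.
    rewrite [leLHS]/Num.norm/= mx_normrE; apply: bigmax_le => /= [|[i j] _].
      exact: le_trans (enorm_ge0 _) zE.
    by rewrite /= (ord1 i); exact: le_trans (coord_le_enorm _ _) zE.
  apply: closedI => //.
  rewrite (_ : mkset _ = (fun z => enorm (x - z)) @^-1` [set y | y <= r])//.
  by apply: closed_comp => //.
have A0 : A !=set0 by exists z0; split => //=.
have [y] := compact_EVT_min A0 cA (continuous_subspaceT cdist).
rewrite inE => -[Xy yr] ymin; exists y; split => // z Xz.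
have [zr|/ltW rz] := leP (enorm (x - z)) r; first by apply: ymin; rewrite inE.
exact: le_trans rz.
Qed.

Lemma projP x : is_proj X x (proj X x).
Proof. by rewrite /proj; have [y xy] := is_proj_exists x; apply: xgetPex; exists y. Qed.

Lemma proj_in x : X (proj X x).
Proof. by have [] := projP x. Qed.

Lemma convex_segment x y t : 0 <= t <= 1 -> X x -> X y -> X (x + t *: (y - x)).
Proof.
move=> t01 Xx Xy.
have t01' : Itv.spec (Itv.num_sem (R:=R)) (Itv.Real `[0%Z, 1%Z]) t.
  by rewrite /= /Itv.num_sem/= num_real/= in_itv/=.
have := @convexX y x (Itv.mk t01'); rewrite !inE => /(_ Xy Xx).
rewrite /conv/=; congr (X _).
apply/rowP => i; rewrite /unstable.onem !mxE; ring.
Qed.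

(** Moving from the projection a small step [t] towards [z] stays in [X], so
    the squared distance cannot decrease to first order in [t]. *)
Lemma proj_obtuse x z : X z -> dotv (x - proj X x) (z - proj X x) <= 0.
Proof.
move=> Xz; have [Xp pmin] := projP x; set p := proj X x in Xp pmin *.
set a := dotv _ _; rewrite leNgt; apply/negP => a0.
pose b := dotv (z - p) (z - p).
have b0 : 0 <= b by exact: dotv_ge0.
(* The step is at most 1 and small enough for the first-order gain to win. *)
pose t := a / (a + b).
have ab0 : 0 < a + b by rewrite ltr_wpDr.
have t0 : 0 < t by rewrite divr_gt0.
have t1 : t <= 1 by rewrite ler_pdivrMr// mul1r lerDl.
have Xt : X (p + t *: (z - p)) by apply: convex_segment => //; rewrite (ltW t0).
have := pmin _ Xt; rewrite -(@ler_pXn2r _ 2) ?nnegrE ?enorm_ge0// !enorm_sq.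
rewrite opprD addrA (dotvDl (x - p)) !(dotvDr _ (x - p)) !dotvNl !dotvNr.
rewrite !dotvZl !dotvZr (dotvC _ (x - p)) -/a -/b.
have tab : t * (a + b) = a by rewrite /t divfK// gt_eqF.
move=> h; have : t * (2 * a - t * b) <= 0 by lra.
rewrite pmulr_rle0// => h2; have := mulr_gt0 t0 a0; lra.
Qed.

Lemma proj_id x : X x -> proj X x = x.
Proof.
move=> Xx; apply/esym/eqP; rewrite -subr_eq0 -enorm_eq0 -sqrf_eq0 enorm_sq.
by rewrite eq_le dotv_ge0 andbT; exact: proj_obtuse.
Qed.

Lemma proj_nonexpansive x y : enorm (proj X x - proj X y) <= enorm (x - y).
Proof.
set p := proj X x; set q := proj X y.
have hx : dotv (x - p) (q - p) <= 0 by apply: proj_obtuse; exact: proj_in.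
have hy : dotv (y - q) (p - q) <= 0 by apply: proj_obtuse; exact: proj_in.
have [pq0|pq0] := eqVneq (enorm (p - q)) 0; first by rewrite pq0 enorm_ge0.
have pqgt : 0 < enorm (p - q) by rewrite lt_neqAle eq_sym pq0 enorm_ge0.
rewrite -(ler_pM2l pqgt) -expr2 enorm_sq mulrC.
apply: le_trans (cauchy_schwarz _ _).
move: hx hy; rewrite !dotvE (dotvC q p) (dotvC y q) (dotvC y p) (dotvC x q).
by clear; scalars; lra.
Qed.

(** Step-size comparison for the projected step.  The obtuse-angle inequalities
    at the two projected points combine to
    [(s * b - t * a) * (b - a) <= 0], where [a] and [b] are the two step
    lengths.  The point [x] may lie outside [X], as extrapolated iterates do. *)
Lemma proj_step_scaling x g s t : 0 < s -> s <= t ->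
  s * enorm (proj X (x - t *: g) - x) <= t * enorm (proj X (x - s *: g) - x).
Proof.
move=> s0 st; have t0 : 0 < t := lt_le_trans s0 st.
set p := proj X (x - s *: g); set q := proj X (x - t *: g).
have hp : dotv (x - s *: g - p) (q - p) <= 0 by apply: proj_obtuse; exact: proj_in.
have hq : dotv (x - t *: g - q) (p - q) <= 0 by apply: proj_obtuse; exact: proj_in.
pose u := p - x; pose v := q - x.
have hp' : dotv (- u - s *: g) (v - u) <= 0.
  have -> : - u - s *: g = x - s *: g - p by rewrite opprB addrAC.
  by have -> : v - u = q - p by rewrite opprB addrA subrK.
have hq' : dotv (- v - t *: g) (u - v) <= 0.
  have -> : - v - t *: g = x - t *: g - q by rewrite opprB addrAC.
  by have -> : u - v = p - q by rewrite opprB addrA subrK.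
rewrite -/u -/v; move: hp' hq'; move: (u) (v) => {p q hp hq} {}u {}v hp hq.
have h : s * dotv v (v - u) <= t * dotv u (v - u).
  move: (ler_wpM2l (ltW t0) hp) (ler_wpM2l (ltW s0) hq).
  rewrite !dotvE (dotvC v u) (dotvC g u) (dotvC g v).
  by clear; scalars; lra.
have a0 := enorm_ge0 u; have b0 := enorm_ge0 v.
have cs := cauchy_schwarz u v.
move: h; rewrite !dotvE (dotvC v u) -!enorm_sq => h.
move: cs h a0 b0; set a := enorm u; set b := enorm v; set c := dotv u v.
move=> cs h a0 b0.
have hab : (s * b - t * a) * (b - a) <= 0.
  have := ler_wpM2l (ltW (addr_gt0 s0 t0)) cs; lra.
rewrite leNgt; apply/negP => lt; move: hab; rewrite pmulr_rle0 ?subr_gt0//.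
rewrite subr_le0 => ba; have := ler_wpM2r b0 st; have := ler_wpM2l (ltW t0) ba; lra.
Qed.

End projection.

(** * The extragradient step and the line search *)

Section extragradient_step.
Context {R : realType} {n : nat} (X : set 'rV[R]_n).
Hypotheses (closedX : closed X)
  (convexX : convex_set (X : set (convex_lmodType 'rV[R]_n))).
Implicit Types (x y h g xs : 'rV[R]_n) (G H : 'rV[R]_n -> 'rV[R]_n).

Let X0 y : X y -> X !=set0. Proof. by exists y. Qed.

(** Sum of the obtuse-angle inequalities at [y], tested with [xs], and at [h],
    tested with [y]; what remains, [2 * t * dotv (g - g') (y - h)], is absorbed
    by completing a square. *)
Lemma extragradient_ineq x xs g g' t h y : X xs ->
  h = proj X (x - t *: g) -> y = proj X (x - t *: g') ->
  enorm (y - xs) ^+ 2 <= enorm (x - xs) ^+ 2 - enorm (x - h) ^+ 2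
    + t ^+ 2 * enorm (g - g') ^+ 2 + 2 * t * dotv g' (xs - h).
Proof.
move=> Xxs hE yE; have Xn := X0 Xxs.
have h1 := proj_obtuse closedX convexX Xn (x - t *: g') Xxs.
have h2 := proj_obtuse closedX convexX Xn (x - t *: g)
  (proj_in closedX Xn (x - t *: g')).
move: h1 h2; rewrite -hE -yE => {hE yE Xn}.
have -> : x - t *: g' - y = (x - h) - (y - h) - t *: g'.
  by apply/rowP => i; rewrite !mxE; ring.
have -> : xs - y = (xs - h) - (y - h) by apply/rowP => i; rewrite !mxE; ring.
have -> : x - t *: g - h = (x - h) - t *: g by rewrite addrAC.
have -> : y - xs = (y - h) - (xs - h) by apply/rowP => i; rewrite !mxE; ring.
have -> : x - xs = (x - h) - (xs - h) by apply/rowP => i; rewrite !mxE; ring.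
move: (x - h) (y - h) (xs - h) => p q r h1 h2.
have h3 := dotv_ge0 (t *: (g - g') - q).
move: h1 h2 h3; rewrite !enorm_sq !dotvE.
rewrite ?(dotvC q p) ?(dotvC r p) ?(dotvC r q) ?(dotvC g' g) ?(dotvC q g) ?(dotvC q g').
by clear; scalars; lra.
Qed.

Lemma enorm_sq3 x y z :
  enorm (x + y + z) ^+ 2 <= 3 * enorm x ^+ 2 + 3 * enorm y ^+ 2 + 3 * enorm z ^+ 2.
Proof.
have := dotv_ge0 (x - y); have := dotv_ge0 (y - z); have := dotv_ge0 (x - z).
rewrite !enorm_sq !dotvE (dotvC y x) (dotvC z x) (dotvC z y).
by clear; scalars; lra.
Qed.

(** One extragradient step with inexact operators: [G] and [G'] are sampled
    versions of [H].  Since [h] lies in [X], pseudomonotonicity makes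
    [dotv (H h) (xs - h)] nonpositive.  The test of the line search controls one
    of the three parts into which [G x - G' h] is split, hence the factor 3. *)
Lemma extragradient_descent H G G' x xs t mu : SOL X H xs ->
  pseudomonotone_on X H -> 0 <= t ->
  let h := proj X (x - t *: G x) in let y := proj X (x - t *: G' h) in
  t * enorm (G x - G h) <= mu * enorm (x - h) ->
  enorm (y - xs) ^+ 2 <=
    enorm (x - xs) ^+ 2 - (1 - 3 * mu ^+ 2) * enorm (x - h) ^+ 2
    + (3 * (t * enorm (G h - H h)) ^+ 2 + 3 * (t * enorm (G' h - H h)) ^+ 2
       + 2 * (t * enorm (G' h - H h)) * enorm (h - xs)).
Proof.
move=> [Xxs solxs] pmH t0 h y acc; have Xn := X0 Xxs.
have Xh : X h by exact: proj_in.
have hm : dotv (H h) (xs - h) <= 0.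
  by rewrite -opprB dotvNr oppr_le0; apply: pmH => //; exact: solxs.
have := @extragradient_ineq x xs (G x) (G' h) t h y Xxs erefl erefl.
move=> /le_trans; apply.
have acc2 : t ^+ 2 * enorm (G x - G h) ^+ 2 <= mu ^+ 2 * enorm (x - h) ^+ 2.
  have te0 : 0 <= t * enorm (G x - G h) by rewrite mulr_ge0 ?enorm_ge0.
  by rewrite -!exprMn ler_pXn2r// nnegrE// (le_trans te0).
have e3 : enorm (G x - G' h) ^+ 2 <= 3 * enorm (G x - G h) ^+ 2 +
    3 * enorm (G h - H h) ^+ 2 + 3 * enorm (G' h - H h) ^+ 2.
  have -> : G x - G' h = (G x - G h) + (G h - H h) + (H h - G' h).
    by apply/rowP => i; rewrite !mxE; ring.
  by rewrite (enormB (G' h)) enorm_sq3.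
have e4 : dotv (G' h) (xs - h) <= enorm (G' h - H h) * enorm (h - xs).
  rewrite -[G' h](subrK (H h)) dotvDl (subrK (H h)) -[leRHS]addr0 lerD//.
  by rewrite (enormB h); exact: cauchy_schwarz.
have e5 := ler_wpM2l (sqr_ge0 t) e3.
have e6 := ler_wpM2l t0 e4.
by move: acc2 e5 e6; clear; scalars; rewrite !exprMn; lra.
Qed.

(** An Anderson weight accepted by the algorithm is at most [1/2] because the
    extragradient residual is the shorter of the two; it may be negative, and
    then the iterate is extrapolated and may leave [X].  The extrapolation term
    is paid for by the length [enorm (y - x)] of the residual. *)
Lemma anderson_weight_le (Ft F : 'rV[R]_n) : enorm Ft < enorm F ->
  dotv Ft (Ft - F) / enorm (Ft - F) ^+ 2 <= 1 / 2.
Proof.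
move=> FtF.
have : 0 < enorm (Ft - F) ^+ 2.
  rewrite exprn_gt0// lt_neqAle enorm_ge0 eq_sym enorm_eq0 subr_eq0 andbT.
  by apply: contraTneq FtF => ->; rewrite ltxx.
move=> n0; rewrite ler_pdivrMr//.
have : dotv Ft Ft <= dotv F F.
  by rewrite -!enorm_sq ler_pXn2r ?nnegrE ?enorm_ge0 ?ltW.
rewrite enorm_sq !dotvE (dotvC F Ft).
by clear; scalars; lra.
Qed.

(** A squared distance is quadratic along a line.  For a weight outside [0, 1]
    the last term is positive: this is the price of extrapolation. *)
Lemma anderson_mix x y xs (al : R) :
  enorm (al *: x + (1 - al) *: y - xs) ^+ 2 =
  al * enorm (x - xs) ^+ 2 + (1 - al) * enorm (y - xs) ^+ 2
  - al * (1 - al) * enorm (y - x) ^+ 2.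
Proof.
have -> : al *: x + (1 - al) *: y - xs = al *: (x - xs) + (1 - al) *: (y - xs).
  by apply/rowP => i; rewrite !mxE; ring.
have -> : y - x = (y - xs) - (x - xs) by apply/rowP => i; rewrite !mxE; ring.
move: (x - xs) (y - xs) => p q.
rewrite !enorm_sq !dotvE (dotvC q p).
by clear; scalars; ring.
Qed.

End extragradient_step.

Section line_search_theory.
Context {R : realType} {n : nat} (X : set 'rV[R]_n) (gamma rho mu : R).
Hypotheses (gamma_gt0 : 0 < gamma) (gamma_le1 : gamma <= 1)
  (rho_gt0 : 0 < rho) (rho_lt1 : rho < 1) (mu_gt0 : 0 < mu) (mu_lt1 : mu < 1).
Implicit Types (x : 'rV[R]_n) (G : 'rV[R]_n -> 'rV[R]_n).

Lemma accept_small G x (Lh t : R) :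
  (forall u v, enorm (G u - G v) <= Lh * enorm (u - v)) -> 0 <= t ->
  t * Lh <= mu -> accept X mu G x t.
Proof.
move=> lipG t0 tL; rewrite /accept.
apply: le_trans (ler_wpM2l t0 (lipG _ _)) _.
by rewrite mulrA ler_wpM2r ?enorm_ge0.
Qed.

(** A rejected trial step [t] satisfies [mu < t * Lh], and the accepted one is
    [rho] times the last rejected one, so it is at least of order [1 / Lh]. *)
Lemma line_searchP G x (Lh : R) : 1 <= Lh ->
  (forall u v, enorm (G u - G v) <= Lh * enorm (u - v)) ->
  let t := line_search X gamma rho mu G x in
  [/\ accept X mu G x t, exists l, t = rho ^+ l * gamma &
      gamma * (rho * mu) <= t * Lh].
Proof.
move=> L1 lipG; rewrite /line_search.
have L0 : 0 < Lh by exact: lt_le_trans L1.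
have gp l : 0 < rho ^+ l * gamma by rewrite mulr_gt0 ?exprn_gt0.
case: pselect => [h|[]]; last first.
  have : (rho ^+ k) @[k --> \oo] --> (0 : R) by apply: cvg_expr; rewrite gtr0_norm.
  move/cvgrPdist_lt => /(_ (mu / Lh)) []; first by rewrite divr_gt0.
  move=> l _ /(_ l (leqnn l)); rewrite sub0r normrN gtr0_norm ?exprn_gt0// => hl.
  exists l; apply: (accept_small _ lipG); first exact: ltW.
  rewrite -ler_pdivlMr// (le_trans _ (ltW hl))// ler_piMr// ltW// exprn_gt0//.
case: ex_minnP => l al lmin; split => //; first by exists l.
case: l al lmin => [|l] al lmin.
  rewrite expr0 mul1r ler_pM2l// (le_trans _ L1)//.
  by rewrite mulr_ile1// ltW.
have : ~~ accept X mu G x (rho ^+ l * gamma).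
  by apply/negP => /lmin; rewrite ltnn.
have /contra/[apply] := accept_small x lipG (ltW (gp l)).
rewrite -ltNge => lt; rewrite exprS -!mulrA.
apply: le_trans (_ : rho * mu <= _).
  by rewrite ler_piMl// mulr_ge0 ?ltW.
by rewrite ler_pM2l// mulrA ltW.
Qed.

End line_search_theory.

#[local] Opaque dotv enorm Pilot.Defs.proj.

(** * Lyapunov decrease of one iteration for fixed samples *)

(** The drop of [theta `^ (- s)] when [theta] increases by one dominates the
    general term [theta `^ (- (s + 1))] of a convergent series, so a multiple of
    [theta `^ (- s)] is a potential that pays for all Anderson steps. *)
Lemma powR_drop (R : realType) (s : R) (th : nat) : 0 < s -> (0 < th)%N ->
  s * expR (- (s + 1) * ln 2) * th%:R `^ (- (s + 1)) <=
  th%:R `^ (- s) - th.+1%:R `^ (- s).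
Proof.
move=> s0 th0.
pose a : R := th%:R; pose b : R := th.+1%:R.
have a1 : 1 <= a by rewrite /a ler1n.
have a0 : 0 < a by exact: lt_le_trans a1.
have bE : b = a + 1 by rewrite /b -natr1.
have b0 : 0 < b by rewrite bE addr_gt0.
rewrite -/a -/b /powR !gt_eqF//.
have lab : expR (ln a - ln b) = 1 - expR (- ln b).
  by rewrite expRB expRN !lnK ?posrE// bE -[X in (X / _)](addrK 1 a) mulrBl divff ?mul1r// gt_eqF// -bE.
have lba : expR (- ln b) <= ln b - ln a.
  by have := expR_ge1Dx (ln a - ln b); rewrite lab; lra.
have lb2 : ln b <= ln 2 + ln a.
  by rewrite -lnM ?posrE// ler_ln ?posrE ?mulr_gt0// bE; lra.
have -> : expR (- s * ln a) = expR (- s * ln b) * expR (s * (ln b - ln a)).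
  by rewrite -expRD; congr expR; ring.
apply: (@le_trans _ _ (expR (- s * ln b) * (s * (ln b - ln a)))); last first.
  rewrite -[X in _ <= _ - X]mulr1 -mulrBr ler_pM2l ?expR_gt0//.
  by have := expR_ge1Dx (s * (ln b - ln a)); lra.
apply: (@le_trans _ _ (expR (- s * ln b) * (s * expR (- ln b)))); last first.
  by rewrite ler_pM2l ?expR_gt0// ler_pM2l.
rewrite mulrCA -expRD -mulrA -expRD ler_pM2l// ler_expR.
have := ler_wpM2l (ltW (addr_gt0 s0 ltr01)) lb2; lra.
Qed.

(** The difference of the two sides is [(M + a) * (1 + M - a)]. *)
Lemma extrapolation_coef (R : realFieldType) (M a : R) : - M <= a -> a <= 1 / 2 ->
  - (a * (1 - a)) <= M * (1 + M).
Proof.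
move=> Ma a12.
rewrite -subr_ge0 (_ : _ - _ = (M + a) * (1 + M - a)); last by ring.
by rewrite mulr_ge0//; lra.
Qed.

(** Distance bookkeeping for an accepted Anderson step.  As [1 - a] lies between
    [1 / 2] and [1 + M], at least half of the decrease of the extragradient step
    survives and the errors grow by a bounded factor. *)
Lemma anderson_combine (R : realFieldType) (a M c D Y Q N err p0 p1 res e k : R) :
  - M <= a -> a <= 1 / 2 -> 0 <= c * Q -> 0 <= err -> 0 <= N ->
  Y <= D - c * Q + err -> M * (1 + M) * N <= p0 - p1 ->
  res <= c / 2 * Q + e + k ->
  a * D + (1 - a) * Y - a * (1 - a) * N + p1 + res <=
  D + p0 + k + e + (1 + M) * err.
Proof.
move=> Ma a12 cQ err0 N0 dec pot lb.
have q2 := ler_wpM2r N0 (extrapolation_coef Ma a12).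
have a1 : 0 <= 1 - a by lra.
have dec2 := ler_wpM2l a1 dec.
have b2 : 0 <= (1 / 2 - a) * (c * Q) by rewrite mulr_ge0//; lra.
have b3 : 0 <= (M + a) * err by rewrite mulr_ge0//; lra.
lra.
Qed.

Lemma sqrrD_le2 (R : realFieldType) (u v : R) :
  (u + v) ^+ 2 <= 2 * u ^+ 2 + 2 * v ^+ 2.
Proof. by have := sqr_ge0 (u - v); lra. Qed.

(** Weighing the cross term with [w] anticipates a sampling error [e2] whose
    square is of order [1 / w ^+ 2]. *)
Lemma error_combine (R : realFieldType) (V K N t rl g e0 e1 e2 Le f q w : R) :
  0 <= K -> 0 <= N -> 0 <= t <= 1 -> 0 < g <= 1 -> 0 < w ->
  0 <= e0 -> 0 <= e2 -> 0 <= q ->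
  (t * e1) ^+ 2 <= 2 * (rl * f) ^+ 2 + 2 * (Le * e0) ^+ 2 ->
  V + K * (g * e0) ^+ 2
    + N * (3 * (t * e1) ^+ 2 + 3 * (t * e2) ^+ 2 + 2 * (t * e2) * q) <=
  V + (K + 6 * N) * (e0 ^+ 2 + (Le * e0) ^+ 2 + (rl * f) ^+ 2
    + (1 + w) * e2 ^+ 2 + w^-1 * q ^+ 2).
Proof.
move=> K0 N0 /andP[t0 t1] /andP[g0 g1] w0 e00 e20 q0 h1.
have te2 : t * e2 <= e2 by rewrite ler_piMl.
have ge0 : (g * e0) ^+ 2 <= e0 ^+ 2.
  by rewrite ler_pXn2r ?nnegrE ?mulr_ge0 ?(ltW g0)// ler_piMl.
have h2 : (t * e2) ^+ 2 <= e2 ^+ 2 by rewrite ler_pXn2r ?nnegrE ?mulr_ge0.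
have cross : 2 * (t * e2) * q <= w * e2 ^+ 2 + w^-1 * q ^+ 2.
  apply: (@le_trans _ _ (2 * e2 * q)); first by rewrite ler_wpM2r// ler_pM2l.
  rewrite -subr_ge0 (_ : _ - _ = w * (e2 - w^-1 * q) ^+ 2).
    by rewrite mulr_ge0 ?sqr_ge0// ltW.
  by field; rewrite gt_eqF.
have wi0 : 0 <= w^-1 * q ^+ 2 by rewrite mulr_ge0 ?sqr_ge0 ?invr_ge0// ltW.
have wc0 : 0 <= w * e2 ^+ 2 by rewrite mulr_ge0 ?sqr_ge0// ltW.
have h0 := sqr_ge0 e0; have h3 := sqr_ge0 (Le * e0).
have h4 := sqr_ge0 (rl * f); have h5 := sqr_ge0 e2.
move: h1 h2 cross wi0 wc0 ge0 h0 h3 h4 h5.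
move: ((t * e1) ^+ 2) ((t * e2) ^+ 2) (2 * (t * e2) * q) (w^-1 * q ^+ 2).
move: ((rl * f) ^+ 2) ((Le * e0) ^+ 2) ((g * e0) ^+ 2) (e0 ^+ 2).
rewrite (mulrDl 1 w) mul1r; move: (w * e2 ^+ 2); move: (e2 ^+ 2).
move=> c wc a5 a6 h b a1 a2 a3 a4 h1 h2 cross a40 wc0 gb b0 a60 a50 c0.
have B1 : 3 * a1 + 3 * a2 + a3 <= 6 * (b + a6 + a5 + (c + wc) + a4) by lra.
have B2 := ler_wpM2l N0 B1.
have B3 : K * h <= K * (b + a6 + a5 + (c + wc) + a4).
  by rewrite ler_wpM2l//; lra.
lra.
Qed.

Section seg_step_analysis.
Context {R : realType} {n : nat} (X : set 'rV[R]_n).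
Hypotheses (closedX : closed X)
  (convexX : convex_set (X : set (convex_lmodType 'rV[R]_n))).
Variables (nu gamma rho mu tau M : R).
Hypotheses (nu_ge0 : 0 <= nu) (gamma_gt0 : 0 < gamma) (gamma_le1 : gamma <= 1)
  (rho_gt0 : 0 < rho) (rho_lt1 : rho < 1)
  (mu_gt0 : 0 < mu) (mu2_lt : 3 * mu ^+ 2 < 1)
  (tau_gt : 1 / 2 < tau) (M_gt0 : 0 < M).
Implicit Types (x y h g xs : 'rV[R]_n) (G H : 'rV[R]_n -> 'rV[R]_n).

(** The counter increases exactly at the Anderson steps, so this potential drops
    at each of them; the leading constant makes the drop at least the cost of
    that step. *)
Definition theta_potential (th : nat) : R :=
  M * (1 + M) * nu ^+ 2 / ((2 * tau - 1) * expR (- (2 * tau) * ln 2))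
  * th%:R `^ (- (2 * tau - 1)).

Lemma theta_potential_ge0 th : 0 <= theta_potential th.
Proof.
by rewrite !mulr_ge0 ?powR_ge0 ?invr_ge0 ?sqr_ge0 ?addr_ge0 ?mulr_ge0
   ?expR_ge0 ?(ltW M_gt0) ?subr_ge0//; move: tau_gt; lra.
Qed.

Lemma theta_potential_drop th : (0 < th)%N ->
  M * (1 + M) * (nu * th%:R `^ (- tau)) ^+ 2 <=
  theta_potential th - theta_potential th.+1.
Proof.
move=> th0; rewrite /theta_potential -mulrBr.
have s0 : 0 < 2 * tau - 1 by move: tau_gt; lra.
have := powR_drop s0 th0; rewrite subrK => h.
have d0 : 0 < (2 * tau - 1) * expR (- (2 * tau) * ln 2) by rewrite mulr_gt0 ?expR_gt0.
have c0 : 0 <= M * (1 + M) * nu ^+ 2 / ((2 * tau - 1) * expR (- (2 * tau) * ln 2)).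
  by rewrite divr_ge0 ?(ltW d0)// !mulr_ge0 ?sqr_ge0 ?addr_ge0 ?(ltW M_gt0).
apply: le_trans (ler_wpM2l c0 h); rewrite [leRHS]mulrA divfK ?gt_eqF//.
rewrite exprMn mulrA ler_wpM2l//; last first.
  by rewrite -powR_mulrn ?powR_ge0// -powRrM mulNr mulrC.
by rewrite !mulr_ge0 ?sqr_ge0 ?addr_ge0 ?(ltW M_gt0).
Qed.

(** [2 / m <= 1 / Lh ^+ 2 + Lh ^+ 2 / m ^+ 2] replaces the random factor
    [1 / Lh ^+ 2] by a polynomial one, whose mean is explicit. *)
Lemma residual_le_step (Lh m Rh r q e : R) : 1 <= Lh -> 0 < m -> 0 <= Rh ->
  0 <= r -> r <= Rh + gamma * e -> 0 <= e -> 0 <= q -> rho * mu * Rh <= Lh * q ->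
  (rho * mu) ^+ 2 * (r ^+ 2 / m) <= q ^+ 2 + (rho * mu) ^+ 2 * (gamma * e) ^+ 2
    + (rho * mu) ^+ 2 * (r ^+ 2 * Lh ^+ 2 / (2 * m ^+ 2)).
Proof.
move=> L1 m0 R0 r0 rR e0 q0 Rq.
have L0 : 0 < Lh by exact: lt_le_trans L1.
have amgm : r ^+ 2 / m <= r ^+ 2 / (2 * Lh ^+ 2) + r ^+ 2 * Lh ^+ 2 / (2 * m ^+ 2).
  rewrite -subr_ge0 (_ : _ - _ = r ^+ 2 / 2 * (Lh ^-1 - Lh / m) ^+ 2).
    by rewrite mulr_ge0 ?sqr_ge0// divr_ge0 ?sqr_ge0.
  by field; rewrite (gt_eqF m0) (gt_eqF L0).
have r2 : r ^+ 2 / (2 * Lh ^+ 2) <= Rh ^+ 2 / Lh ^+ 2 + (gamma * e) ^+ 2.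
  rewrite invfM mulrA.
  have : r ^+ 2 / 2 <= Rh ^+ 2 + (gamma * e) ^+ 2.
    have : r ^+ 2 <= (Rh + gamma * e) ^+ 2.
      by rewrite ler_pXn2r// nnegrE// (le_trans r0).
    by have := sqr_ge0 (Rh - gamma * e); lra.
  move=> h; apply: le_trans (ler_wpM2r _ h) _; first by rewrite invr_ge0 sqr_ge0.
  have iL2 : (Lh ^+ 2)^-1 <= 1 by rewrite invf_le1 ?exprn_gt0// exprn_ege1.
  by rewrite mulrDl lerD2l ler_piMr ?sqr_ge0.
have Rq2 : (rho * mu) ^+ 2 * (Rh ^+ 2 / Lh ^+ 2) <= q ^+ 2.
  rewrite mulrA ler_pdivrMr ?exprn_gt0// -!exprMn (mulrC q).
  by rewrite ler_pXn2r// nnegrE !mulr_ge0// ltW.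
have c0 : 0 <= (rho * mu) ^+ 2 by exact: sqr_ge0.
have := ler_wpM2l c0 amgm; have := ler_wpM2l c0 r2.
rewrite !mulrDr; move: Rq2; lra.
Qed.

Lemma residual_ge0 H t x : 0 <= residual X H t x.
Proof. exact: enorm_ge0. Qed.

Lemma residual_perturb G H x : X !=set0 ->
  residual X H gamma x <=
  enorm (proj X (x - gamma *: G x) - x) + gamma * enorm (G x - H x).
Proof.
move=> X0; rewrite /residual.
apply: le_trans (enorm_dist _ (proj X (x - gamma *: G x)) _) _.
rewrite addrC lerD2l (le_trans (proj_nonexpansive closedX convexX X0 _ _))//.
rewrite -[gamma in leRHS]gtr0_norm// -enormZ.
by rewrite le_eqVlt; apply/orP; left; apply/eqP; congr enorm; apply/rowP => i; rewrite !mxE; ring.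
Qed.

Definition descent_rate : R := (1 - 3 * mu ^+ 2) / 2 * (rho * mu) ^+ 2.

Lemma descent_rate_gt0 : 0 < descent_rate.
Proof.
by rewrite mulr_gt0 ?exprn_gt0 ?mulr_gt0 ?subr_gt0.
Qed.

(** Lyapunov decrease of one iteration for fixed samples, in all its branches:
    stop, plain extragradient step, Anderson step. *)
Lemma seg_step_descent G G' H xs x th (m Lh t : R) h : SOL X H xs ->
  pseudomonotone_on X H -> 0 < m -> 1 <= Lh -> (0 < th)%N ->
  (forall u v, enorm (G u - G v) <= Lh * enorm (u - v)) ->
  t = line_search X gamma rho mu G x -> h = proj X (x - t *: G x) ->
  let r := residual X H gamma x in
  let s' := seg_step X nu gamma rho mu tau M G G' (x, th) in
  (enorm (s'.1 - xs) ^+ 2 + theta_potential s'.2 + descent_rate * (r ^+ 2 / m) <=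
  enorm (x - xs) ^+ 2 + theta_potential th
  + descent_rate * (r ^+ 2 * Lh ^+ 2 / (2 * m ^+ 2))
  + descent_rate * (gamma * enorm (G x - H x)) ^+ 2
  + (1 + M) * (3 * (t * enorm (G h - H h)) ^+ 2
      + 3 * (t * enorm (G' h - H h)) ^+ 2
      + 2 * (t * enorm (G' h - H h)) * enorm (h - xs)) : Prop).
Proof.
move=> solxs pmH m0 L1 th0 lipG tE hE r s'.
have X0 : X !=set0 by exists xs; case: solxs.
have mu_lt1 : mu < 1.
  rewrite -(@ltr_pXn2r _ 2) ?nnegrE ?(ltW mu_gt0)// expr1n.
  by have := sqr_ge0 mu; move: mu2_lt; lra.
have [acc [l tl] tL] := line_searchP X gamma_gt0 gamma_le1 rho_gt0 rho_lt1 mu_gt0 mu_lt1 x L1 lipG.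
rewrite -tE in acc tl tL.
have L0 : 0 < Lh by exact: lt_le_trans L1.
have t0 : 0 < t by rewrite tl mulr_gt0 ?exprn_gt0.
have tg : t <= gamma.
  by rewrite tl ler_piMl ?(ltW gamma_gt0)// exprn_ile1 ?ltW.
set err := 3 * _ + _ + _.
have err0 : 0 <= err.
  by rewrite /err !addr_ge0// !mulr_ge0 ?sqr_ge0 ?enorm_ge0// ltW.
have e0 : 0 <= (gamma * enorm (G x - H x)) ^+ 2 by exact: sqr_ge0.
have c1 : 0 < 1 - 3 * mu ^+ 2 by rewrite subr_gt0.
have k0 := descent_rate_gt0.
have lb q : 0 <= q ->
    rho * mu * enorm (proj X (x - gamma *: G x) - x) <= Lh * q ->
    descent_rate * (r ^+ 2 / m) <= (1 - 3 * mu ^+ 2) / 2 * q ^+ 2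
    + descent_rate * (gamma * enorm (G x - H x)) ^+ 2
    + descent_rate * (r ^+ 2 * Lh ^+ 2 / (2 * m ^+ 2)).
  move=> q0 hq.
  have := residual_le_step L1 m0 (enorm_ge0 _) (residual_ge0 H gamma x)
    (residual_perturb G H x X0) (enorm_ge0 _) q0 hq.
  have c20 : 0 <= (1 - 3 * mu ^+ 2) / 2 by rewrite divr_ge0// ltW.
  by move/(ler_wpM2l c20); rewrite /descent_rate -/r !mulrDr !mulrA.
rewrite /s' /seg_step.
case: ifPn => [/eqP F0 | F0] /=.
  have := lb 0 (lexx _); rewrite F0 enorm0 mulr0 mulr0 lexx => /(_ isT).
  rewrite expr0n/= mulr0 add0r => lb0.
  have : 0 <= (1 + M) * err by rewrite mulr_ge0// addr_ge0// ltW.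
  by move: lb0; lra.
rewrite -tE -hE; set y := proj X (x - t *: G' h); set al := if enorm (y - x) < _ then _ else _.
have dec := @extragradient_descent _ _ _ closedX convexX H G G' x xs t mu solxs pmH (ltW t0) acc.
rewrite /= -hE -/y -/err in dec.
have step : rho * mu * enorm (proj X (x - gamma *: G x) - x) <= Lh * enorm (x - h).
  have : t * enorm (proj X (x - gamma *: G x) - x) <= gamma * enorm (h - x).
    by rewrite hE; exact: (proj_step_scaling closedX convexX X0 x (G x) t0 tg).
  move: (proj X (x - gamma *: G x) - x) => v sc.
  have hx := enormB h x; rewrite hx in sc.
  rewrite -(ler_pM2l gamma_gt0) !mulrA.
  apply: (@le_trans _ _ (t * Lh * enorm v)).
    by rewrite ler_wpM2r ?enorm_ge0// -mulrA.
  by rewrite (mulrC t) -(mulrA Lh) (mulrC gamma) -(mulrA Lh) ler_pM2l.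
have lbh := lb _ (enorm_ge0 _) step.
case: (boolP (`|al| <= M)) => [alM|_] /=; last first.
  have := mulr_ge0 (ltW M_gt0) err0.
  have : 0 <= (1 - 3 * mu ^+ 2) / 2 * enorm (x - h) ^+ 2.
    by rewrite mulr_ge0 ?sqr_ge0// divr_ge0 ?ltW.
  by move: dec lbh; lra.
move: alM; rewrite /al; case: ifPn => [|_]; last first.
  by rewrite ger0_norm ?addr_ge0 ?(ltW M_gt0)// leNgt ltrDl ltr01.
rewrite lt_min => /andP[FtF Ftnu].
move: (anderson_weight_le FtF).
set a := _ / _ => a12; rewrite ler_norml => /andP[Ma aM].
rewrite anderson_mix.
have pot := theta_potential_drop th0.
have Ft2 : M * (1 + M) * enorm (y - x) ^+ 2 <=
    theta_potential th - theta_potential th.+1.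
  apply: le_trans pot; rewrite ler_wpM2l//.
    by rewrite mulr_ge0 ?addr_ge0 ?(ltW M_gt0).
  have yx0 := enorm_ge0 (y - x).
  by rewrite (ler_pXn2r _ yx0 (le_trans yx0 (ltW Ftnu)))//; exact: ltW.
apply: (anderson_combine Ma a12 _ err0 (sqr_ge0 _) dec Ft2 lbh).
by rewrite mulr_ge0 ?sqr_ge0// ltW.
Qed.

(** The point [h] is correlated with the sample behind [G].  It is compared
    with the point [hl] obtained from the exact operator at the same trial step,
    which depends on the sample through the integer [l] only. *)
Lemma correlated_error G H x (Lh ell : R) (l : nat) : X !=set0 ->
  0 <= Lh -> 0 <= ell ->
  (forall u v, enorm (G u - G v) <= Lh * enorm (u - v)) ->
  (forall u v, enorm (H u - H v) <= ell * enorm (u - v)) ->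
  let t := rho ^+ l * gamma in
  let h := proj X (x - t *: G x) in let hl := proj X (x - t *: H x) in
  ((t * enorm (G h - H h)) ^+ 2 <=
  2 * (rho ^+ l * enorm (G hl - H hl)) ^+ 2
  + 2 * ((Lh + ell) * enorm (G x - H x)) ^+ 2 : Prop).
Proof.
move=> X0 Lh0 ell0 lipG lipH t h hl.
have t0 : 0 <= t by rewrite mulr_ge0 ?exprn_ge0 ?ltW.
have rl0 : 0 <= rho ^+ l by rewrite exprn_ge0 ?ltW.
have tr : t <= rho ^+ l by rewrite ler_piMr.
have t1 : t <= 1 by rewrite (le_trans tr)// exprn_ile1 ?ltW.
have hhl : enorm (h - hl) <= t * enorm (G x - H x).
  apply: le_trans (proj_nonexpansive closedX convexX X0 _ _) _.
  rewrite -[t in leRHS]ger0_norm// -enormZ -enormN le_eqVlt; apply/orP; left.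
  by apply/eqP; congr enorm; apply/rowP => i; rewrite !mxE; ring.
have e1 : enorm (G h - H h) <= enorm (G hl - H hl) + (Lh + ell) * enorm (h - hl).
  have split4 (a b c d : 'rV[R]_n) : a - b = (c - d) + ((a - c) + (d - b)).
    by apply/rowP => i; rewrite !mxE; ring.
  rewrite (split4 (G h) (H h) (G hl) (H hl)).
  apply: le_trans (ler_enormD _ _) _; rewrite lerD2l.
  apply: le_trans (ler_enormD _ _) _; rewrite mulrDl lerD//.
  by rewrite enormB lipH.
have a0 := enorm_ge0 (G hl - H hl); have b0 := enorm_ge0 (G x - H x).
have le1 : t * enorm (G h - H h) <=
    rho ^+ l * enorm (G hl - H hl) + (Lh + ell) * enorm (G x - H x).
  apply: le_trans (ler_wpM2l t0 e1) _; rewrite mulrDr lerD ?ler_wpM2r//.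
  rewrite mulrCA ler_wpM2l ?addr_ge0//.
  apply: le_trans (ler_wpM2l t0 hhl) _.
  by rewrite mulrA ler_piMl// mulr_ile1.
have le2 : (t * enorm (G h - H h)) ^+ 2 <=
    (rho ^+ l * enorm (G hl - H hl) + (Lh + ell) * enorm (G x - H x)) ^+ 2.
  have l0 : 0 <= t * enorm (G h - H h) := mulr_ge0 t0 (enorm_ge0 _).
  by rewrite (ler_pXn2r _ l0 (le_trans l0 le1)).
apply: le_trans le2 _.
by rewrite sqrrD_le2.
Qed.

Definition error_const : R := descent_rate + 6 * (1 + M).

Lemma error_const_ge0 : 0 <= error_const.
Proof. by rewrite addr_ge0 ?(ltW descent_rate_gt0)// mulr_ge0// addr_ge0 ?ltW. Qed.

(** The decrease once the error at the correlated point has been replaced; the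
    integer [l] is the only trace of the random step size. *)
Lemma seg_step_bound G G' H xs x th (m Lh ell w : R) : SOL X H xs ->
  pseudomonotone_on X H -> 0 < m -> 1 <= Lh -> 0 <= ell -> 0 < w -> (0 < th)%N ->
  (forall u v, enorm (G u - G v) <= Lh * enorm (u - v)) ->
  (forall u v, enorm (H u - H v) <= ell * enorm (u - v)) ->
  let h := proj X (x - line_search X gamma rho mu G x *: G x) in
  let hl l := proj X (x - (rho ^+ l * gamma) *: H x) in
  let r := residual X H gamma x in
  let s' := seg_step X nu gamma rho mu tau M G G' (x, th) in
  exists l, enorm (s'.1 - xs) ^+ 2 + theta_potential s'.2
    + descent_rate * (r ^+ 2 / m) <=
  enorm (x - xs) ^+ 2 + theta_potential th
  + descent_rate * (r ^+ 2 * Lh ^+ 2 / (2 * m ^+ 2))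
  + error_const * (enorm (G x - H x) ^+ 2
      + ((Lh + ell) * enorm (G x - H x)) ^+ 2
      + (rho ^+ l * enorm (G (hl l) - H (hl l))) ^+ 2
      + (1 + w) * enorm (G' h - H h) ^+ 2
      + w^-1 * enorm (h - xs) ^+ 2).
Proof.
move=> solxs pmH m0 L1 ell0 w0 th0 lipG lipH h hl r s'.
have X0 : X !=set0 by exists xs; case: solxs.
have L0 : 0 < Lh by exact: lt_le_trans L1.
have mu_lt1 : mu < 1.
  rewrite -(@ltr_pXn2r _ 2) ?nnegrE ?(ltW mu_gt0)// expr1n.
  by have := sqr_ge0 mu; move: mu2_lt; lra.
have [_ [l tl] _] := line_searchP X gamma_gt0 gamma_le1 rho_gt0 rho_lt1 mu_gt0 mu_lt1 x L1 lipG.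
exists l.
have hE : h = proj X (x - (rho ^+ l * gamma) *: G x) by rewrite /h tl.
have desc := seg_step_descent G' solxs pmH m0 L1 th0 lipG (esym tl) hE.
apply: le_trans desc _.
have := correlated_error x l X0 (ltW L0) ell0 lipG lipH.
rewrite /= -hE -/(hl l) => corr.
have t0 : 0 <= rho ^+ l * gamma by rewrite mulr_ge0 ?exprn_ge0 ?ltW.
have rl0 : 0 <= rho ^+ l by rewrite exprn_ge0 ?ltW.
have t1 : rho ^+ l * gamma <= 1.
  by rewrite (le_trans (ler_piMr rl0 gamma_le1))// exprn_ile1 ?ltW.
have M0 : 0 <= 1 + M := addr_ge0 ler01 (ltW M_gt0).
have t01 : 0 <= rho ^+ l * gamma <= 1 by apply/andP.
have g01 : 0 < gamma <= 1 by apply/andP.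
exact: (error_combine _ (ltW descent_rate_gt0) M0 t01 g01 w0 (enorm_ge0 _)
  (enorm_ge0 _) (enorm_ge0 _) corr).
Qed.

Lemma seg_step_theta_gt0 G G' x th : (0 < th)%N ->
  (0 < (seg_step X nu gamma rho mu tau M G G' (x, th)).2)%N.
Proof. by move=> th0; rewrite /seg_step; case: ifP => //; case: ifP. Qed.

End seg_step_analysis.

(** * Measurability of vector-valued maps *)

Section discrete_factor.
Context {d d' : measure_display} {U : measurableType d} {E : measurableType d'}.

Lemma measurable_countable_comp (I : countType) (g : U -> I) (h : I -> E) :
  (forall i, measurable [set w | g w = i]) -> measurable_fun setT (h \o g).
Proof.
move=> mg _ B mB; rewrite setTI.
rewrite (_ : _ @^-1` B = \bigcup_i [set w | g w = i /\ B (h i)]).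
  apply: countable_bigcupT_measurable => [|i]; first exact: countableP.
  have [Bi|nBi] := pselect (B (h i)).
    by rewrite (_ : mkset _ = [set w | g w = i])//; apply/seteqP; split => w /= [].
  by rewrite (_ : mkset _ = set0)//; apply/seteqP; split => w /= [].
by apply/seteqP; split => [w/= Bw|w [i _ /= [<-]]//]; exists (g w).
Qed.

End discrete_factor.

Section measurable_vectors.
Context {R : realType} {n : nat} {d : measure_display} {U : measurableType d}.
Implicit Types (f g : U -> 'rV[R]_n).

Lemma measurable_rVP f : measurable_fun setT f <->
  forall i, measurable_fun setT (fun w => f w 0 i).
Proof.
split=> [mf i|mf].
  move=> _ B mB; rewrite setTI.
  rewrite (_ : _ @^-1` B = f @^-1` [set v | B (v 0 i)])// -[X in measurable X]setTI.
  apply: mf => //; apply: sub_sigma_algebra.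
  rewrite -bigcup_seq; exists i => //=; first by rewrite mem_index_enum.
  by exists B => //; rewrite setTI.
apply: measurability => //.
move=> _ [C GC <-]; move: GC; rewrite -bigcup_seq => -[i _ /= [B mB <-]].
by rewrite !setTI -[X in measurable X]setTI; exact: mf.
Qed.

Lemma measurable_coord f i : measurable_fun setT f ->
  measurable_fun setT (fun w => f w 0 i).
Proof. by move/measurable_rVP; exact. Qed.

Lemma measurable_addv f g : measurable_fun setT f -> measurable_fun setT g ->
  measurable_fun setT (fun w => f w + g w).
Proof.
move=> mf mg; apply/measurable_rVP => i; under eq_fun do rewrite mxE.
by apply: measurable_funD; exact: measurable_coord.
Qed.

Lemma measurable_scalev (a : U -> R) f : measurable_fun setT a ->
  measurable_fun setT f -> measurable_fun setT (fun w => a w *: f w).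
Proof.
move=> ma mf; apply/measurable_rVP => i; under eq_fun do rewrite mxE.
by apply: measurable_funM => //; exact: measurable_coord.
Qed.

Lemma measurable_subv f g : measurable_fun setT f -> measurable_fun setT g ->
  measurable_fun setT (fun w => f w - g w).
Proof.
move=> mf mg; apply/measurable_rVP => i; under eq_fun do rewrite 2!mxE.
by apply: measurable_funB; exact: measurable_coord.
Qed.

Lemma measurable_sumv m (F : 'I_m -> U -> 'rV[R]_n) :
  (forall j, measurable_fun setT (F j)) ->
  measurable_fun setT (fun w => \sum_(j < m) F j w).
Proof.
move=> mF; apply/measurable_rVP => i; under eq_fun do rewrite summxE.
by apply: measurable_sum => j; exact: measurable_coord.
Qed.

#[local] Transparent dotv enorm.

Lemma measurable_dotv f g : measurable_fun setT f -> measurable_fun setT g ->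
  measurable_fun setT (fun w => dotv (f w) (g w)).
Proof.
move=> mf mg; apply: measurable_sum => i.
by apply: measurable_funM; exact: measurable_coord.
Qed.

Lemma measurable_enorm f : measurable_fun setT f ->
  measurable_fun setT (fun w => enorm (f w)).
Proof.
move=> mf; apply: (@measurableT_comp _ _ _ _ _ _ (@Num.sqrt R)).
  by apply: continuous_measurable_fun; exact: sqrt_continuous.
exact: measurable_dotv.
Qed.

Lemma enorm_le_coord (u : 'rV[R]_n) (e : R) : 0 <= e ->
  (forall i, `|u 0 i| <= e) -> enorm u <= Num.sqrt n%:R * e.
Proof.
move=> e0 ue; rewrite -[e in leRHS]ger0_norm// -sqrtr_sqr -sqrtrM//.
rewrite ler_wsqrtr//; apply: (@le_trans _ _ (\sum_(i < n) e ^+ 2)).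
  apply: ler_sum => i _; rewrite -expr2 -real_normK ?num_real//.
  by rewrite ler_pXn2r ?nnegrE.
by rewrite sumr_const card_ord mulr_natl.
Qed.

#[local] Opaque dotv enorm.

(** A Lipschitz function on vectors is the pointwise limit of its values on
    finer and finer grids; each approximation factors through the countable
    set of grid points. *)
Lemma measurable_lipschitz (phi : 'rV[R]_n -> R) (C : R) f :
  (forall u v, `|phi u - phi v| <= C * enorm (u - v)) ->
  measurable_fun setT f -> measurable_fun setT (phi \o f).
Proof.
move=> lip mf.
pose grid (m : nat) (w : U) : 'rV[int]_n := \row_i Num.floor (m.+1%:R * f w 0 i).
pose back (m : nat) (v : 'rV[int]_n) : 'rV[R]_n := \row_i ((v 0 i)%:~R / m.+1%:R).
have C0 : 0 <= C \/ forall u v : 'rV[R]_n, enorm (u - v) = 0.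
  have [?|C0] := leP 0 C; [by left|right] => u v; apply/eqP.
  rewrite eq_le enorm_ge0 andbT -(ler_nM2l C0) mulr0.
  exact: le_trans (normr_ge0 _) (lip u v).
apply: (@measurable_fun_cvg _ _ _ _ (fun m => phi \o back m \o grid m)).
  move=> m; apply: measurable_countable_comp => v.
  rewrite (_ : mkset _ = \bigcap_(i in [set: 'I_n])
      [set w | (v 0 i)%:~R <= m.+1%:R * f w 0 i < (v 0 i + 1)%:~R]).
    apply: fin_bigcap_measurable => [|i _]; first exact: finite_finset.
    have mm : measurable_fun setT (fun w => m.+1%:R * f w 0 i).
      by apply: measurable_funM => //; exact: measurable_coord.
    have mb : measurable_fun setT (fun w => ((v 0 i)%:~R <= m.+1%:R * f w 0 i) &&
        (m.+1%:R * f w 0 i < (v 0 i + 1)%:~R)).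
      by apply: measurable_and; [exact: measurable_fun_ler|exact: measurable_fun_ltr].
    by have := mb measurableT [set true]; rewrite setTI; apply.
  apply/seteqP; split => w /= => [<- i _|h].
    by rewrite /= mxE floor_itv.
  apply/rowP => i; rewrite mxE; apply/eqP; rewrite floor_eq; exact: h.
move=> w _; apply/cvgrPdist_le => e e0 /=.
have bound m : enorm (f w - back m (grid m w)) <= Num.sqrt n%:R * m.+1%:R^-1.
  apply: enorm_le_coord; first by rewrite invr_ge0.
  move=> i; rewrite !mxE.
  have m0 : 0 < m.+1%:R :> R by [].
  have /andP[h1 h2] := floor_itv (m.+1%:R * f w 0 i).
  rewrite -[X in `|X - _|](mulKf (lt0r_neq0 m0)) [_^-1 * _]mulrC -mulrBl normrM.
  rewrite [X in _ * X]ger0_norm ?invr_ge0// ler_piMl ?invr_ge0//.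
  by rewrite ger0_norm ?subr_ge0//; move: h2; rewrite intrD lerBlDl => /ltW.
case: C0 => [C0|en0]; last first.
  by apply: nearW => m /=; apply: le_trans (lip _ _) _; rewrite en0 mulr0 ltW.
have K0 : 0 < C * Num.sqrt n%:R + 1 by rewrite ltr_wpDl ?mulr_ge0.
near=> m.
apply: le_trans (lip _ _) _; apply: le_trans (ler_wpM2l C0 (bound m)) _.
rewrite mulrA; apply: (@le_trans _ _ ((C * Num.sqrt n%:R + 1) / m.+1%:R)).
  by rewrite ler_wpM2r ?invr_ge0// lerDl.
rewrite ler_pdivrMr// [e * _]mulrC -ler_pdivrMr//.
near: m; exists (Num.truncn ((C * Num.sqrt n%:R + 1) / e)).+1 => // m /= hm.
apply: ltW; apply: lt_le_trans (truncnS_gt _) _; by rewrite ler_nat (leq_trans hm).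
Unshelve. all: by end_near. Qed.

Lemma measurable_lipschitz_vec (phi : 'rV[R]_n -> 'rV[R]_n) (C : R) f :
  (forall u v, enorm (phi u - phi v) <= C * enorm (u - v)) ->
  measurable_fun setT f -> measurable_fun setT (phi \o f).
Proof.
move=> lip mf; apply/measurable_rVP => i.
apply: (measurable_lipschitz (phi := fun u => phi u 0 i) (C := C)) => // u v.
apply: le_trans (lip u v); apply: le_trans (coord_le_enorm _ i).
by rewrite !mxE.
Qed.

End measurable_vectors.

(** * Measurability of one iteration *)

Definition first_true (a : nat -> bool) : nat :=
  if pselect (exists l, a l) is left h then ex_minn h else 0%N.

Lemma line_search_first (R : realType) (n : nat) (X : set 'rV[R]_n)
    (gamma rho mu : R) G x :
  line_search X gamma rho mu G x =
  rho ^+ first_true (fun l => accept X mu G x (rho ^+ l * gamma)) * gamma.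
Proof.
by rewrite /line_search /first_true; case: pselect => // _; rewrite expr0 mul1r.
Qed.

Section measurable_step.
Context {R : realType} {n : nat} {d : measure_display} {U : measurableType d}.

Lemma measurable_first_true (a : U -> nat -> bool) l :
  (forall l, measurable [set w | a w l]) -> measurable [set w | first_true (a w) = l].
Proof.
move=> ma.
rewrite (_ : mkset _ = ([set w | a w l] `&`
    \bigcap_(i in [set i | (i < l)%N]) ~` [set w | a w i]) `|`
    (if l == 0%N then \bigcap_i ~` [set w | a w i] else set0)).
  apply: measurableU; last case: ifP => // _.
    apply: measurableI => //.
    by apply: bigcap_measurableType => i _; exact: measurableC.
  by apply: bigcap_measurableType => i _; exact: measurableC.
apply/seteqP; split => w /=.
  rewrite /first_true; case: pselect => [h|h].
    case: ex_minnP => m am mmin <-; left; split => // i /= im ai.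
    by have := mmin _ ai; rewrite leqNgt im.
  by move=> <-; right; rewrite eqxx => i _ ai; apply: h; exists i.
case=> [[al lmin]|].
  rewrite /first_true; case: pselect => [h|[]]; last by exists l.
  case: ex_minnP => m am mmin; apply/eqP; rewrite eqn_leq mmin// leqNgt.
  by apply/negP => ml; exact: (lmin m).
case: eqP => // -> h; rewrite /first_true; case: pselect => // -[i ai].
by have := h i I ai.
Qed.

(** Random operators are evaluated at random points only; this form of
    measurability composes without a sigma-algebra on operators. *)
Definition jointly_measurable (G : U -> 'rV[R]_n -> 'rV[R]_n) :=
  forall u : U -> 'rV[R]_n, measurable_fun setT u ->
    measurable_fun setT (fun w => G w (u w)).

Lemma jointly_measurable_sample_mean d' (Xi : measurableType d')
    (T : Xi -> 'rV[R]_n -> 'rV[R]_n) m (z : 'I_m -> U -> Xi) :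
  measurable_fun [set: Xi * 'rV[R]_n] (fun p => T p.1 p.2) ->
  (forall j, measurable_fun setT (z j)) ->
  jointly_measurable (fun w => sample_mean T (fun j => z j w)).
Proof.
move=> mT mz u mu; apply: measurable_scalev => //; apply: measurable_sumv => j.
exact: (measurableT_comp mT (measurable_fun_pair (mz j) mu)).
Qed.

Lemma measurable_inv_ge0 (f : U -> R) : (forall w, 0 <= f w) ->
  measurable_fun setT f -> measurable_fun setT (fun w => (f w)^-1).
Proof.
move=> f0 mf; under eq_fun do rewrite -powR_inv1//.
have mp := @measurable_powR R (-1).
exact: (measurableT_comp mp mf).
Qed.

Variable X : set 'rV[R]_n.
Hypotheses (closedX : closed X)
  (convexX : convex_set (X : set (convex_lmodType 'rV[R]_n))) (X0 : X !=set0).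

Lemma measurable_proj (f : U -> 'rV[R]_n) : measurable_fun setT f ->
  measurable_fun setT (fun w => proj X (f w)).
Proof.
apply: (measurable_lipschitz_vec (C := 1)) => u v.
by rewrite mul1r; exact: proj_nonexpansive.
Qed.

Lemma measurable_residual (H : 'rV[R]_n -> 'rV[R]_n) (C t : R) (x : U -> 'rV[R]_n) :
  (forall u v, enorm (H u - H v) <= C * enorm (u - v)) ->
  measurable_fun setT x -> measurable_fun setT (fun w => residual X H t (x w)).
Proof.
move=> lipH mx; apply/measurable_enorm/measurable_subv => //.
apply/measurable_proj/measurable_subv => //; apply: measurable_scalev => //.
exact: (measurable_lipschitz_vec lipH mx).
Qed.

Variables (nu gamma rho mu tau M : R).

Lemma measurable_proj_step G (x : U -> 'rV[R]_n) (t : U -> R) : jointly_measurable G ->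
  measurable_fun setT x -> measurable_fun setT t ->
  forall u : U -> 'rV[R]_n, measurable_fun setT u ->
  measurable_fun setT (fun w => proj X (x w - t w *: G w (u w))).
Proof.
move=> mG mx mt u mu'; apply/measurable_proj/measurable_subv => //.
by apply: measurable_scalev => //; exact: mG.
Qed.

(** The step size factors through the index of the first accepted trial. *)
Lemma measurable_line_search G (x : U -> 'rV[R]_n) : jointly_measurable G -> measurable_fun setT x ->
  measurable_fun setT (fun w => line_search X gamma rho mu (G w) (x w)).
Proof.
move=> mG mx; under eq_fun do rewrite line_search_first.
apply: (measurable_countable_comp (fun l => rho ^+ l * gamma)) => l.
apply: measurable_first_true => {}l.
have mt : measurable_fun setT (fun _ : U => rho ^+ l * gamma) by [].
have my := measurable_proj_step mG mx mt mx.
have macc : measurable_fun setT (fun w => accept X mu (G w) (x w) (rho ^+ l * gamma)).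
  apply: measurable_fun_ler; apply: measurable_funM => //; apply: measurable_enorm.
    by apply: measurable_subv; exact: mG.
  exact: measurable_subv.
by have := macc measurableT [set true]; rewrite setTI; apply.
Qed.

Lemma measurable_half_point G (x : U -> 'rV[R]_n) : jointly_measurable G -> measurable_fun setT x ->
  measurable_fun setT
    (fun w => proj X (x w - line_search X gamma rho mu (G w) (x w) *: G w (x w))).
Proof.
move=> mG mx; apply: measurable_proj_step => //; exact: measurable_line_search.
Qed.

Lemma measurable_seg_step G G' (s : U -> 'rV[R]_n * nat) :
  jointly_measurable G -> jointly_measurable G' -> measurable_fun setT s ->
  measurable_fun setT (fun w => seg_step X nu gamma rho mu tau M (G w) (G' w) (s w)).
Proof.
move=> mG mG' /measurable_fun_pairP[mx mth].
pose x w := (s w).1; pose th w := (s w).2.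
rewrite (_ : (fun w => _) = fun w =>
    seg_step X nu gamma rho mu tau M (G w) (G' w) (x w, th w)); last first.
  by apply/funext => w; rewrite -surjective_pairing.
have {}mx : measurable_fun setT x by [].
have {}mth : measurable_fun setT th by [].
rewrite /seg_step; clearbody x th.
pose t w := line_search X gamma rho mu (G w) (x w).
have mt : measurable_fun setT t by exact: measurable_line_search.
pose h w := proj X (x w - t w *: G w (x w)).
have mh : measurable_fun setT h by exact: measurable_half_point.
pose y w := proj X (x w - t w *: G' w (h w)).
have my : measurable_fun setT y by exact: measurable_proj_step.
have mF : measurable_fun setT (fun w => h w - x w) by exact: measurable_subv.
have mFt : measurable_fun setT (fun w => y w - x w) by exact: measurable_subv.
have mD : measurable_fun setT (fun w => y w - x w - (h w - x w)).
  exact: measurable_subv.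
have mxth : measurable_fun setT (fun w => (x w, th w)) by exact: measurable_fun_pair.
pose al w := if enorm (y w - x w) < Num.min (enorm (h w - x w)) (nu * (th w)%:R `^ (- tau))
  then dotv (y w - x w) (y w - x w - (h w - x w)) / enorm (y w - x w - (h w - x w)) ^+ 2
  else M + 1.
have mal : measurable_fun setT al.
  apply: measurable_fun_ifT => //.
    apply: measurable_fun_ltr; first exact: measurable_enorm.
    apply: measurable_minr; first exact: measurable_enorm.
    by apply: measurable_funM => //; exact: (measurableT_comp (f := fun k : nat => k%:R `^ (- tau))).
  apply: measurable_funM; first exact: measurable_dotv.
  apply: measurable_inv_ge0 => [w|]; first exact: sqr_ge0.
  by apply: measurable_funX; exact: measurable_enorm.
have mth1 : measurable_fun setT (fun w => (th w).+1).
  exact: (measurableT_comp (f := S)).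
apply: (@measurable_fun_ifT _ _ _ _ _ _ (fun w => proj X (x w - gamma *: G w (x w)) - x w == 0)) => //.
  under eq_fun do rewrite -enorm_eq0.
  apply: measurable_fun_eqr => //; apply: measurable_enorm.
  apply: (measurable_subv _ mx).
  by apply: (measurable_proj_step mG mx _ mx); exact: measurable_cst.
apply: (@measurable_fun_ifT _ _ _ _ (fun w => (al w *: x w + (1 - al w) *: y w, (th w).+1)) _ (fun w => `|al w| <= M)).
- by apply: measurable_fun_ler => //; exact: measurableT_comp.
- apply: measurable_fun_pair => //; apply: measurable_addv; apply: measurable_scalev => //.
  exact: measurable_funB.
- exact: measurable_fun_pair.
Qed.

Lemma measurable_seg_state d' (Xi : measurableType d')
    (T : Xi -> 'rV[R]_n -> 'rV[R]_n) (S : nat -> nat) (x0 : U -> 'rV[R]_n)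
    (xis etas : forall k, 'I_(S k) -> U -> Xi) k :
  measurable_fun [set: Xi * 'rV[R]_n] (fun p => T p.1 p.2) ->
  measurable_fun setT x0 ->
  (forall i j, (i < k)%N -> measurable_fun setT (@xis i j)) ->
  (forall i j, (i < k)%N -> measurable_fun setT (@etas i j)) ->
  measurable_fun setT (seg_state X nu gamma rho mu tau M T x0 xis etas k).
Proof.
move=> mT mx0; elim: k => [|k ih] mxi meta; first exact: measurable_fun_pair.
apply: measurable_seg_step.
- by apply: jointly_measurable_sample_mean => // j; exact: mxi.
- by apply: jointly_measurable_sample_mean => // j; exact: meta.
- by apply: ih => i j ik; [exact: mxi (ltnW _)|exact: meta (ltnW _)].
Qed.

End measurable_step.

(** * Independence and equality in law *)

Section independence.
Local Open Scope ereal_scope.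
Context {d : measure_display} {Omega : measurableType d} {R : realType}
  (P : probability Omega R).

Definition independent_rv {d1 d2} {E1 : measurableType d1} {E2 : measurableType d2}
    (U : Omega -> E1) (V : Omega -> E2) :=
  forall A B, measurable A -> measurable B ->
    P (U @^-1` A `&` V @^-1` B) = P (U @^-1` A) * P (V @^-1` B).

(** Conditioning on [U] in the only form needed: when [V] is independent of [U],
    the law of the pair is a product measure, so by Tonelli a bound on the mean
    of [g u V] for each frozen value [u] integrates to a bound for [g U V]. *)
Lemma indep_integral_le {d1 d2} {E1 : measurableType d1} {E2 : measurableType d2}
    (U : Omega -> E1) (V : Omega -> E2) (g : E1 * E2 -> \bar R) (h : E1 -> \bar R) :
  measurable_fun setT U -> measurable_fun setT V -> independent_rv U V ->
  measurable_fun setT g -> (forall p, 0 <= g p) ->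
  measurable_fun setT h -> (forall u, 0 <= h u) ->
  (forall u, \int[P]_w g (u, V w) <= h u) ->
  \int[P]_w g (U w, V w) <= \int[P]_w h (U w).
Proof.
move=> mU mV indep mg g0 mh h0 gh.
have mUV : measurable_fun setT (fun w => (U w, V w)) by exact: measurable_fun_pair.
pose pU : {RV P >-> E1} := HB.pack U (isMeasurableFun.Build _ _ _ _ _ mU).
pose pV : {RV P >-> E2} := HB.pack V (isMeasurableFun.Build _ _ _ _ _ mV).
pose pUV : {RV P >-> (E1 * E2)%type} :=
  HB.pack (fun w => (U w, V w)) (isMeasurableFun.Build _ _ _ _ _ mUV).
have -> : \int[P]_w g (U w, V w) = \int[distribution P pUV]_p g p.
  by rewrite (ge0_integral_distribution pUV).
have -> : \int[P]_w h (U w) = \int[distribution P pU]_u h u.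
  by rewrite (ge0_integral_distribution pU).
rewrite (@eq_measure_integral _ _ _ setT (distribution P pU \x distribution P pV)).
  rewrite fubini_tonelli1//; apply: ge0_le_integral => //.
  - by move=> u _; apply: integral_ge0.
  - exact: measurable_fun_fubini_tonelli_F.
  - move=> u _; rewrite /fubini_F ge0_integral_distribution//; first exact: gh.
    exact: measurable_fun_pair2.
move=> A mA _; apply/esym/product_measure_unique => // B C mB mC.
Qed.

Context {d' : measure_display} {Xi : measurableType d'}.

Lemma ge0_same_law_integral (Z Z' : Omega -> Xi) (f : Xi -> \bar R) :
  measurable_fun setT Z -> measurable_fun setT Z' -> same_law P Z Z' ->
  measurable_fun setT f -> (forall z, 0 <= f z) ->
  \int[P]_w f (Z w) = \int[P]_w f (Z' w).
Proof.
move=> mZ mZ' ZZ' mf f0.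
pose pZ : {RV P >-> Xi} := HB.pack Z (isMeasurableFun.Build _ _ _ _ _ mZ).
pose pZ' : {RV P >-> Xi} := HB.pack Z' (isMeasurableFun.Build _ _ _ _ _ mZ').
transitivity (\int[distribution P pZ]_z f z).
  by rewrite (ge0_integral_distribution pZ).
transitivity (\int[distribution P pZ']_z f z); last first.
  by rewrite (ge0_integral_distribution pZ').
by apply: eq_measure_integral => A mA _; exact: ZZ'.
Qed.

(** Splitting into positive and negative parts transfers the integral without
    any integrability. *)
Lemma same_law_integral (Z Z' : Omega -> Xi) (f : Xi -> \bar R) :
  measurable_fun setT Z -> measurable_fun setT Z' -> same_law P Z Z' ->
  measurable_fun setT f -> \int[P]_w f (Z w) = \int[P]_w f (Z' w).
Proof.
move=> mZ mZ' ZZ' mf; rewrite integralE [RHS]integralE.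
rewrite -[fun w => f (Z w)]/(f \o Z) -[fun w => f (Z' w)]/(f \o Z').
rewrite (funepos_comp f Z) (funepos_comp f Z') (funeneg_comp f Z) (funeneg_comp f Z').
congr (_ - _).
  exact: (@ge0_same_law_integral Z Z' (f ^\+) mZ mZ' ZZ'
    (measurable_funepos mf) (funepos_ge0 f)).
exact: (@ge0_same_law_integral Z Z' (f ^\-) mZ mZ' ZZ'
  (measurable_funeneg mf) (funeneg_ge0 f)).
Qed.

Lemma same_law_ae (xi : {RV P >-> Xi}) (Z : Omega -> Xi) (Q : Xi -> Prop) :
  same_law P Z xi -> {ae distribution P xi, forall z, Q z} ->
  measurable_fun setT Z -> {ae P, forall w, Q (Z w)}.
Proof.
move=> Zxi [A [mA A0 QA]] mZ; exists (Z @^-1` A); split.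
- by rewrite -[X in measurable X]setTI; exact: mZ.
- by rewrite Zxi.
- by move=> w nQ; exact: QA.
Qed.

Lemma mutually_independent_pair m (Z : 'I_m -> Omega -> Xi) i j : i != j ->
  mutually_independent P Z -> independent_rv (Z i) (Z j).
Proof.
move=> ij indZ A B mA mB.
(* Unconstrained coordinates contribute a factor 1. *)
pose C k := if k == i then A else if k == j then B else setT.
have /indZ : forall k, measurable (C k) by move=> k; rewrite /C; do 2 case: ifP => //.
rewrite (bigD1 i)//= (bigD1 j) 1?eq_sym//= big1 => [|k /andP[/negPf ki /negPf kj]]; last first.
  by rewrite /C ki kj preimage_setT probability_setT.
rewrite mule1 {2 3}/C eqxx eq_sym (negPf ij) eqxx => <-.
congr (P _); apply/seteqP; split => w /=.
  by move=> [Aw Bw] k; rewrite /C; case: eqP => [->//|_]; case: eqP => [->|].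
move=> h; split; first by have := h i; rewrite /C eqxx.
by have := h j; rewrite /C eq_sym (negPf ij) eqxx.
Qed.

End independence.

(** * Second moments and the variance of a sample mean *)

Section second_moments.
Local Open Scope ereal_scope.
Context {d : measure_display} {Omega : measurableType d} {R : realType}
  (P : probability Omega R).
Implicit Types (a b : Omega -> R).

Lemma integrable_mul_sq a b : measurable_fun setT a -> measurable_fun setT b ->
  \int[P]_w ((a w ^+ 2)%:E) < +oo -> \int[P]_w ((b w ^+ 2)%:E) < +oo ->
  P.-integrable setT (fun w => (a w * b w)%:E).
Proof.
move=> ma mb a2 b2.
have sq (c : Omega -> R) : measurable_fun setT c -> \int[P]_w ((c w ^+ 2)%:E) < +oo ->
    P.-integrable setT (fun w => (c w ^+ 2)%:E).
  move=> mc c2; apply/integrableP; split.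
    by apply/measurable_EFinP; exact: measurable_funX.
  by under eq_integral do rewrite gee0_abs ?lee_fin ?sqr_ge0//.
apply: (le_integrable measurableT _ _ (integrableD measurableT (sq a ma a2) (sq b mb b2))).
  by apply/measurable_EFinP; exact: measurable_funM.
move=> w _ /=; rewrite lee_fin normrM (ger0_norm (addr_ge0 _ _)) ?sqr_ge0//.
rewrite -(real_normK (num_real (a w))) -(real_normK (num_real (b w))).
have := sqr_ge0 (`|a w| - `|b w|)%R; have := sqr_ge0 `|a w|%R; have := sqr_ge0 `|b w|%R.
by move: `|a w|%R `|b w|%R => p q; lra.
Qed.

Lemma integrable_sq a : measurable_fun setT a ->
  \int[P]_w ((a w ^+ 2)%:E) < +oo -> P.-integrable setT (fun w => (a w)%:E).
Proof.
move=> ma a2; have m1 : measurable_fun setT (fun _ : Omega => 1%R : R) by [].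
have i1 : \int[P]_w (((1 : R) ^+ 2)%:E) < +oo.
  by rewrite expr1n integral_cst//= probability_setT mule1 ltry.
have := integrable_mul_sq ma m1 a2 i1.
by congr (P.-integrable _ _); apply/funext => w; rewrite mulr1.
Qed.

Lemma integral_shift_sq a (s : R) : measurable_fun setT a ->
  \int[P]_w ((a w ^+ 2)%:E) < +oo -> \int[P]_w (a w)%:E = 0 ->
  \int[P]_w (((s + a w) ^+ 2)%:E) = (s ^+ 2)%:E + \int[P]_w ((a w ^+ 2)%:E).
Proof.
move=> ma a2 a0.
have ia2 := integrable_mul_sq ma ma a2 a2; have ia := integrable_sq ma a2.
have is2 : P.-integrable setT (fun _ : Omega => (s ^+ 2)%:E).
  by apply/integrableP; split => //; rewrite integral_cst//= probability_setT mule1 ltry.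
have isa : P.-integrable setT (fun w => (2 * s)%:E * (a w)%:E).
  exact: integrableZl.
transitivity (\int[P]_w ((s ^+ 2)%:E + (2 * s)%:E * (a w)%:E + (a w * a w)%:E)).
  by apply: eq_integral => w _; rewrite -EFinM -!EFinD; congr EFin; ring.
rewrite integralD//=; last exact: integrableD.
rewrite integralD//= integralZl//= a0 mule0 adde0.
by rewrite integral_cst//= probability_setT mule1.
Qed.

(** Conditioning on [U] bounds the mean of [(psi U + psi V) ^+ 2] by the sum of
    the two second moments, because [psi V] is centred; expanding the square
    leaves the cross term.  Only nonnegative functions are integrated over the
    product space. *)
Lemma integral_mul_indep_le0 {d'} {Xi : measurableType d'} (U V : Omega -> Xi)
    (psi : Xi -> R) :
  measurable_fun setT U -> measurable_fun setT V -> independent_rv P U V ->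
  measurable_fun setT psi -> \int[P]_w ((psi (U w) ^+ 2)%:E) < +oo ->
  \int[P]_w ((psi (V w) ^+ 2)%:E) < +oo -> \int[P]_w (psi (V w))%:E = 0 ->
  \int[P]_w ((psi (U w) * psi (V w))%:E) <= 0.
Proof.
move=> mU mV indep mpsi U2 V2 V0.
have mpU : measurable_fun setT (psi \o U) by exact: measurableT_comp.
have mpV : measurable_fun setT (psi \o V) by exact: measurableT_comp.
have V20 : 0 <= \int[P]_w ((psi (V w) ^+ 2)%:E).
  by apply: integral_ge0 => w _; rewrite lee_fin sqr_ge0.
have ub : \int[P]_w (((psi (U w) + psi (V w)) ^+ 2)%:E) <=
    \int[P]_w ((psi (U w) ^+ 2)%:E + \int[P]_w' ((psi (V w') ^+ 2)%:E)).
  apply: (@indep_integral_le _ _ _ P _ _ _ _ U V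
    (fun p => ((psi p.1 + psi p.2) ^+ 2)%:E)
    (fun u => (psi u ^+ 2)%:E + \int[P]_w' ((psi (V w') ^+ 2)%:E))) => //.
  - apply/measurable_EFinP; apply: measurable_funX; apply: measurable_funD.
      exact: (measurableT_comp mpsi measurable_fst).
    exact: (measurableT_comp mpsi measurable_snd).
  - by move=> p; rewrite lee_fin sqr_ge0.
  - apply: emeasurable_funD => //.
    by apply/measurable_EFinP; exact: measurable_funX.
  - by move=> u; rewrite adde_ge0// lee_fin sqr_ge0.
  - by move=> u /=; rewrite integral_shift_sq.
have iUV := integrable_mul_sq mpU mpV U2 V2.
have iUU := integrable_mul_sq mpU mpU U2 U2.
have iVV := integrable_mul_sq mpV mpV V2 V2.
have V2fin : \int[P]_w ((psi (V w) ^+ 2)%:E) \is a fin_num by rewrite ge0_fin_numE.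
have U2fin : \int[P]_w ((psi (U w) ^+ 2)%:E) \is a fin_num.
  by rewrite ge0_fin_numE// integral_ge0// => w _; rewrite lee_fin sqr_ge0.
have lhs : \int[P]_w (((psi (U w) + psi (V w)) ^+ 2)%:E) =
    \int[P]_w ((psi (U w) ^+ 2)%:E) + \int[P]_w ((psi (V w) ^+ 2)%:E)
    + 2%:E * \int[P]_w ((psi (U w) * psi (V w))%:E).
  transitivity (\int[P]_w ((psi (U w) * psi (U w))%:E + (psi (V w) * psi (V w))%:E
      + 2%:E * (psi (U w) * psi (V w))%:E)).
    by apply: eq_integral => w _; rewrite -EFinM -!EFinD; congr EFin; ring.
  rewrite integralD//=; [|exact: integrableD|exact: integrableZl].
  by rewrite integralD//= integralZl.
have rhs : \int[P]_w ((psi (U w) ^+ 2)%:E + \int[P]_w' ((psi (V w') ^+ 2)%:E)) =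
    \int[P]_w ((psi (U w) ^+ 2)%:E) + \int[P]_w ((psi (V w) ^+ 2)%:E).
  rewrite ge0_integralD//=.
  - by rewrite integral_cst//= probability_setT mule1.
  - by move=> w _; rewrite lee_fin sqr_ge0.
  - by apply/measurable_EFinP; exact: measurable_funX.
have UVfin : \int[P]_w ((psi (U w) ^+ 2)%:E) + \int[P]_w ((psi (V w) ^+ 2)%:E)
    \is a fin_num by rewrite fin_numD U2fin V2fin.
move: ub; rewrite lhs rhs. rewrite -[leRHS]adde0 leeD2lE//.
by rewrite pmule_rle0// lte_fin.
Qed.

Context {d' : measure_display} {Xi : measurableType d'} (xi : {RV P >-> Xi}).
Variables (m : nat) (Z : 'I_m -> {RV P >-> Xi}).
Hypotheses (m_gt0 : (0 < m)%N) (iidZ : iid_sample P xi (fun j => Z j : Omega -> Xi)).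

Let mZ j : measurable_fun setT (Z j : Omega -> Xi).
Proof. exact: measurable_funPT. Qed.

Let mxi : measurable_fun setT (xi : Omega -> Xi).
Proof. exact: measurable_funPT. Qed.

Lemma sample_mean_ge0_integral (f : Xi -> R) : measurable_fun setT f ->
  (forall z, 0 <= f z)%R -> \int[P]_w (f (xi w))%:E < +oo ->
  \int[P]_w ((m%:R^-1 * \sum_(j < m) f (Z j w))%:E) = \int[P]_w (f (xi w))%:E.
Proof.
move=> mf f0 foo.
have m0 : (m%:R : R) != 0%R by rewrite pnatr_eq0 -lt0n.
transitivity (\int[P]_w ((m%:R^-1)%:E * \sum_(j < m) (f (Z j w))%:E)).
  by apply: eq_integral => w _; rewrite EFinM sumEFin.
have mfZ j : measurable_fun setT (fun w => (f (Z j w))%:E).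
  by apply/measurable_EFinP; exact: measurableT_comp.
rewrite ge0_integralZl//=; last 2 first.
- by apply: emeasurable_sum => j; exact: mfZ.
- by move=> w _; apply: sume_ge0 => j _; rewrite lee_fin.
rewrite ge0_integral_sum//=; last by move=> j w _; rewrite lee_fin.
rewrite (eq_bigr (fun _ => \int[P]_w (f (xi w))%:E)); last first.
  move=> j _; apply: (@ge0_same_law_integral _ _ _ P _ _ _ _ (EFin \o f)) => //.
  - by case: iidZ.
  - exact/measurable_EFinP.
have fin : \int[P]_w (f (xi w))%:E \is a fin_num.
  by rewrite ge0_fin_numE// integral_ge0// => w _; rewrite lee_fin.
by rewrite -(fineK fin) sumEFin sumr_const card_ord -EFinM -[X in (_ * X)%R]mulr_natl mulrA mulVf// mul1r.
Qed.

(** Bienayme's argument: the cross terms of the square of a centred sum of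
    pairwise independent variables are nonpositive in the mean. *)
Lemma sample_mean_variance (phi : Xi -> R) : measurable_fun setT phi ->
  \int[P]_w ((phi (xi w) ^+ 2)%:E) < +oo ->
  let c := fine (\int[P]_w (phi (xi w))%:E) in
  ((c ^+ 2)%:E <= \int[P]_w ((phi (xi w) ^+ 2)%:E) /\
  \int[P]_w (((m%:R^-1 * \sum_(j < m) phi (Z j w) - c) ^+ 2)%:E) <=
    (m%:R^-1)%:E * \int[P]_w ((phi (xi w) ^+ 2)%:E)).
Proof.
move=> mphi phi2 c; pose psi z := (phi z - c)%R.
have mpxi : measurable_fun setT (fun w => phi (xi w)) by exact: measurableT_comp.
have mpsi : measurable_fun setT psi by exact: measurable_funB.
have iphi := integrable_sq mpxi phi2.
have ic (k : R) : P.-integrable setT (fun _ : Omega => k%:E).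
  apply/integrableP; split => //.
  by rewrite integral_cst//= probability_setT mule1 ltry.
have psi0 : \int[P]_w (psi (xi w))%:E = 0.
  under eq_integral do rewrite EFinB.
  rewrite integralB//= integral_cst//= probability_setT mule1.
  by rewrite fineK ?subee// integrable_fin_num.
have psi2oo : \int[P]_w ((psi (xi w) ^+ 2)%:E) < +oo.
  apply: (@le_lt_trans _ _ (\int[P]_w (2%:E * (phi (xi w) ^+ 2)%:E + (2 * c ^+ 2)%:E))).
    apply: ge0_le_integral => //=.
    - by move=> w _; rewrite lee_fin sqr_ge0.
    - by apply/measurable_EFinP/measurable_funX; exact: measurableT_comp.
    - apply: emeasurable_funD => //; apply: emeasurable_funM => //.
      by apply/measurable_EFinP/measurable_funX.
    - move=> w _; rewrite -EFinM -EFinD lee_fin /psi.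
      by have := sqr_ge0 (phi (xi w) + c)%R; move: (phi (xi w)) => p; lra.
  rewrite ge0_integralD//=; last 3 first.
  - by move=> w _; rewrite -EFinM lee_fin mulr_ge0 ?sqr_ge0.
  - by apply: emeasurable_funM => //; apply/measurable_EFinP/measurable_funX.
  - by move=> w _; rewrite lee_fin mulr_ge0 ?sqr_ge0.
  rewrite integral_cst//= probability_setT mule1 ge0_integralZl//=; last 2 first.
  - by apply/measurable_EFinP/measurable_funX.
  - by move=> w _; rewrite lee_fin sqr_ge0.
  by rewrite lte_add_pinfty ?ltry// lte_mul_pinfty// lee_fin.
have mpsixi : measurable_fun setT (fun w => psi (xi w)) by exact: measurableT_comp.
have decomp : \int[P]_w ((phi (xi w) ^+ 2)%:E) =
    (c ^+ 2)%:E + \int[P]_w ((psi (xi w) ^+ 2)%:E).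
  rewrite -integral_shift_sq//; apply: eq_integral => w _.
  by rewrite /psi addrC subrK.
have psi20 : 0 <= \int[P]_w ((psi (xi w) ^+ 2)%:E).
  by apply: integral_ge0 => w _; rewrite lee_fin sqr_ge0.
split; first by rewrite decomp leeDl.
have m0 : (m%:R : R) != 0%R by rewrite pnatr_eq0 -lt0n.
have law j : same_law P (Z j) xi by case: iidZ.
have psiZ2 j : \int[P]_w ((psi (Z j w) ^+ 2)%:E) = \int[P]_w ((psi (xi w) ^+ 2)%:E).
  apply: (@ge0_same_law_integral _ _ _ P _ _ _ _ (fun z => (psi z ^+ 2)%:E)) => //.
  - by apply/measurable_EFinP/measurable_funX.
  - by move=> z; rewrite lee_fin sqr_ge0.
have psiZ0 j : \int[P]_w (psi (Z j w))%:E = 0.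
  rewrite -psi0; apply: (@same_law_integral _ _ _ P _ _ _ _ (EFin \o psi)) => //.
  exact/measurable_EFinP.
have psiZoo j : \int[P]_w ((psi (Z j w) ^+ 2)%:E) < +oo by rewrite psiZ2.
have mpsiZ j : measurable_fun setT (fun w => psi (Z j w)) by exact: measurableT_comp.
have iij i j := integrable_mul_sq (mpsiZ i) (mpsiZ j) (psiZoo i) (psiZoo j).
apply: (@le_trans _ _ ((m%:R^-1)%:E * \int[P]_w ((psi (xi w) ^+ 2)%:E))); last first.
  by rewrite lee_pmul2l ?lte_fin ?invr_gt0 ?ltr0n// decomp leeDr// lee_fin sqr_ge0.
have -> : \int[P]_w (((m%:R^-1 * \sum_(j < m) phi (Z j w) - c) ^+ 2)%:E) =
    ((m%:R^-1) ^+ 2)%:E *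
    \sum_(i < m) \sum_(j < m) \int[P]_w ((psi (Z i w) * psi (Z j w))%:E).
  transitivity (\int[P]_w (((m%:R^-1) ^+ 2)%:E *
      \sum_(i < m) \sum_(j < m) (psi (Z i w) * psi (Z j w))%:E)).
    apply: eq_integral => w _.
    rewrite (eq_bigr (fun i => (\sum_(j < m) psi (Z i w) * psi (Z j w))%:E)); last first.
      by move=> i _; rewrite sumEFin.
    rewrite sumEFin -EFinM; congr EFin.
    rewrite (_ : (_ - c = m%:R^-1 * \sum_(j < m) psi (Z j w))%R); last first.
      rewrite /psi sumrB sumr_const card_ord mulrBr; congr (_ - _)%R.
      by rewrite -[X in (_ * X)%R]mulr_natl mulrA mulVf ?mul1r.
    rewrite exprMn; congr (_ * _)%R; rewrite expr2 mulr_suml.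
    by apply: eq_bigr => i _; rewrite mulr_sumr.
  rewrite integralZl//=; last first.
    by apply: integrable_sum => // i _; apply: integrable_sum => // j _; exact: iij.
  congr (_ * _); rewrite integral_sum//=; last first.
    by move=> i; apply: integrable_sum => // j _; exact: iij.
  by apply: eq_bigr => i _; rewrite integral_sum//= => j; exact: iij.
apply: (@le_trans _ _ (((m%:R^-1) ^+ 2)%:E *
    \sum_(i < m) \sum_(j < m) (if i == j then \int[P]_w ((psi (xi w) ^+ 2)%:E) else 0))).
  apply: lee_wpmul2l; first by rewrite lee_fin sqr_ge0.
  apply: lee_sum => i _; apply: lee_sum => j _; case: eqP => [->|/eqP ij].
    by rewrite -(psiZ2 j).
  apply: (integral_mul_indep_le0 (mZ i) (mZ j)) => //.
  exact: (@mutually_independent_pair _ _ _ P _ _ m (fun j => Z j : Omega -> Xi) i j ij (proj1 iidZ)).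
rewrite (eq_bigr (fun _ => \int[P]_w ((psi (xi w) ^+ 2)%:E))); last first.
  by move=> i _; rewrite -big_mkcond/= (big_pred1 i)// => j; rewrite eq_sym.
have fin : \int[P]_w ((psi (xi w) ^+ 2)%:E) \is a fin_num by rewrite ge0_fin_numE.
rewrite -(fineK fin) sumEFin sumr_const card_ord -!EFinM lee_fin.
by rewrite expr2 -[X in (_ * X)%R]mulr_natl -mulrA (mulrA _ m%:R) mulVf// mul1r.
Qed.

End second_moments.

(** * Power means and finite moments *)

(** The deviations from the mean have nonnegative squares. *)
Lemma sqr_mean_le (R : realFieldType) m (a : 'I_m -> R) : (0 < m)%N ->
  (m%:R^-1 * \sum_(j < m) a j) ^+ 2 <= m%:R^-1 * \sum_(j < m) a j ^+ 2.
Proof.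
move=> m0; set s := _ * _.
have mp : 0 < m%:R :> R by rewrite ltr0n.
have sE : \sum_(j < m) a j = m%:R * s by rewrite /s mulrA mulfV ?mul1r// gt_eqF.
have : 0 <= \sum_(j < m) (a j - s) ^+ 2 by apply: sumr_ge0 => j _; exact: sqr_ge0.
have -> : \sum_(j < m) (a j - s) ^+ 2 =
    \sum_(j < m) a j ^+ 2 - 2 * s * \sum_(j < m) a j + m%:R * s ^+ 2.
  transitivity (\sum_(j < m) (a j ^+ 2 - 2 * s * a j + s ^+ 2)).
    by apply: eq_bigr => j _; ring.
  rewrite big_split sumrB/= -mulr_sumr sumr_const card_ord -[X in _ + X = _]mulr_natl.
  by [].
rewrite sE => h; rewrite -(ler_pM2l mp) [leRHS]mulrA mulfV ?gt_eqF// mul1r.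
by rewrite -subr_ge0; apply: le_trans h _; rewrite le_eqVlt; apply/orP; left; apply/eqP; ring.
Qed.

Lemma mean_ge0 (R : realFieldType) m (a : 'I_m -> R) :
  (forall j, 0 <= a j) -> 0 <= m%:R^-1 * \sum_(j < m) a j.
Proof. by move=> a0; rewrite mulr_ge0 ?invr_ge0// sumr_ge0. Qed.

Lemma ler_mean (R : realFieldType) m (a b : 'I_m -> R) :
  (forall j, a j <= b j) ->
  m%:R^-1 * \sum_(j < m) a j <= m%:R^-1 * \sum_(j < m) b j.
Proof. by move=> ab; rewrite ler_wpM2l ?invr_ge0// ler_sum. Qed.

Lemma pow4_mean_le (R : realFieldType) m (a : 'I_m -> R) : (0 < m)%N ->
  (m%:R^-1 * \sum_(j < m) a j) ^+ 4 <= m%:R^-1 * \sum_(j < m) a j ^+ 4.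
Proof.
move=> m0; rewrite (exprM _ 2 2); apply: (@le_trans _ _ ((m%:R^-1 * \sum_(j < m) a j ^+ 2) ^+ 2)).
  rewrite ler_pXn2r ?nnegrE ?sqr_ge0 ?sqr_mean_le//.
  by apply: mean_ge0 => j; exact: sqr_ge0.
apply: le_trans (sqr_mean_le _ m0) _.
by under eq_bigr do rewrite -exprM.
Qed.

Lemma pow8_mean_le (R : realFieldType) m (a : 'I_m -> R) : (0 < m)%N ->
  (m%:R^-1 * \sum_(j < m) a j) ^+ 8 <= m%:R^-1 * \sum_(j < m) a j ^+ 8.
Proof.
move=> m0; rewrite (exprM _ 4 2); apply: (@le_trans _ _ ((m%:R^-1 * \sum_(j < m) a j ^+ 4) ^+ 2)).
  have x40 (x : R) : 0 <= x ^+ 4 by rewrite (exprM _ 2 2) sqr_ge0.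
  by rewrite ler_pXn2r ?nnegrE ?x40 ?pow4_mean_le// mean_ge0.
apply: le_trans (sqr_mean_le _ m0) _.
by under eq_bigr do rewrite -exprM.
Qed.

Lemma pow4D_le (R : realFieldType) (a b : R) : (a + b) ^+ 4 <= 8 * a ^+ 4 + 8 * b ^+ 4.
Proof.
rewrite !(exprM _ 2 2).
apply: (@le_trans _ _ ((2 * a ^+ 2 + 2 * b ^+ 2) ^+ 2)).
  by rewrite ler_pXn2r ?sqrrD_le2// nnegrE ?sqr_ge0// addr_ge0// mulr_ge0 ?sqr_ge0.
by apply: le_trans (sqrrD_le2 _ _) _; lra.
Qed.

Lemma pow8D_le (R : realFieldType) (a b : R) : (a + b) ^+ 8 <= 128 * a ^+ 8 + 128 * b ^+ 8.
Proof.
have x40 (x : R) : 0 <= x ^+ 4 by rewrite (exprM _ 2 2) sqr_ge0.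
rewrite !(exprM _ 4 2).
apply: (@le_trans _ _ ((8 * a ^+ 4 + 8 * b ^+ 4) ^+ 2)).
  by rewrite ler_pXn2r ?pow4D_le// nnegrE// addr_ge0// mulr_ge0.
by apply: le_trans (sqrrD_le2 _ _) _; lra.
Qed.

(** The square of a sampling error is of order [1 / w ^+ 2]; here it is
    multiplied by a factor without uniform bound, and half of the rate is traded
    for higher moments of that factor. *)
Lemma split_rate (R : realFieldType) (w e W A D : R) :
  0 < w -> 0 <= e -> 0 <= W -> 0 <= A -> 0 <= D -> e <= A * D ->
  (W * e) ^+ 2 <= 2^-1 * (w * e ^+ 2) + 4^-1 * (w^-1 * D ^+ 2 * (W ^+ 8 + A ^+ 4)).
Proof.
move=> w0 e0 W0 A0 D0 eAD.
have wi : 0 < w^-1 by rewrite invr_gt0.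
have h1 : (W * e) ^+ 2 <= 2^-1 * (w * e ^+ 2) + 2^-1 * (w^-1 * (W ^+ 4 * e ^+ 2)).
  rewrite -subr_ge0 (_ : _ - _ = 2^-1 * (w * (e - w^-1 * W ^+ 2 * e) ^+ 2)).
    by rewrite mulr_ge0// mulr_ge0 ?sqr_ge0// ltW.
  by field; rewrite gt_eqF.
apply: le_trans h1 _; rewrite lerD2l.
have e2 : e ^+ 2 <= A ^+ 2 * D ^+ 2.
  by rewrite -exprMn ler_pXn2r// nnegrE mulr_ge0.
have W4 : 0 <= W ^+ 4 by rewrite exprn_ge0.
have h2 := ler_wpM2l W4 e2.
have h3 : W ^+ 4 * A ^+ 2 <= 2^-1 * (W ^+ 8 + A ^+ 4).
  rewrite -subr_ge0 (_ : _ - _ = 2^-1 * (W ^+ 4 - A ^+ 2) ^+ 2).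
    by rewrite mulr_ge0 ?sqr_ge0.
  by field.
have h4 := ler_wpM2r (sqr_ge0 D) h3.
have h5 : W ^+ 4 * e ^+ 2 <= 2^-1 * (D ^+ 2 * (W ^+ 8 + A ^+ 4)).
  apply: le_trans h2 _; rewrite mulrA; apply: le_trans h4 _.
  by rewrite -mulrA [(_ + _) * _]mulrC.
have h6 := ler_wpM2l (ltW wi) h5.
have h7 : 0 <= 2^-1 :> R by [].
apply: le_trans (ler_wpM2l h7 h6) _.
by rewrite le_eqVlt; apply/orP; left; apply/eqP; field; rewrite gt_eqF.
Qed.

Section moments.
Context {d : measure_display} {Omega : measurableType d} {R : realType}
  (P : probability Omega R).

Lemma finite_mean_le (f g : Omega -> R) : measurable_fun setT f ->
  measurable_fun setT g -> (forall w, 0 <= f w) -> (forall w, 0 <= g w) ->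
  {ae P, forall w, f w <= g w} ->
  (\int[P]_w (g w)%:E < +oo)%E -> (\int[P]_w (f w)%:E < +oo)%E.
Proof.
move=> mf mg f0 g0 fg; apply: le_lt_trans.
apply: ae_ge0_le_integral => //; try exact/measurable_EFinP.
- by move=> w _; rewrite lee_fin.
- by move=> w _; rewrite lee_fin.
- by apply: filterS fg => w fgw _; rewrite lee_fin.
Qed.

Lemma finite_mean_cst (c : R) : (\int[P]_w (c%:E) < +oo)%E.
Proof. by rewrite integral_cst//= probability_setT mule1 ltry. Qed.

Lemma finite_mean_lin (a b : R) (f g : Omega -> R) : measurable_fun setT f ->
  measurable_fun setT g -> 0 <= a -> 0 <= b ->
  (forall w, 0 <= f w) -> (forall w, 0 <= g w) ->
  (\int[P]_w (f w)%:E < +oo)%E -> (\int[P]_w (g w)%:E < +oo)%E ->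
  (\int[P]_w ((a * f w + b * g w)%:E) < +oo)%E.
Proof.
move=> mf mg a0 b0 f0 g0 foo goo.
under eq_integral do rewrite EFinD !EFinM.
have m1 : measurable_fun setT (fun w => (f w)%:E) by exact/measurable_EFinP.
have m2 : measurable_fun setT (fun w => (g w)%:E) by exact/measurable_EFinP.
rewrite ge0_integralD//=; first last.
- by apply: emeasurable_funM.
- by move=> w _; rewrite -EFinM lee_fin mulr_ge0.
- by apply: emeasurable_funM.
- by move=> w _; rewrite -EFinM lee_fin mulr_ge0.
rewrite !ge0_integralZl//=; try by move=> w _; rewrite lee_fin.
by rewrite lte_add_pinfty// lte_mul_pinfty// lee_fin.
Qed.

End moments.

(** * Sampling errors of the operator *)

Section sampling.
Context {d d' : measure_display} {Omega : measurableType d} {Xi : measurableType d'}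
  {R : realType} {n : nat} (P : probability Omega R).
Variables (T : Xi -> 'rV[R]_n -> 'rV[R]_n) (xi : {RV P >-> Xi}) (L : Xi -> R)
  (xcheck xs : 'rV[R]_n) (qbar : R).
Hypotheses
  (measT : measurable_fun [set: Xi * 'rV[R]_n] (fun p => T p.1 p.2))
  (measL : measurable_fun setT L)
  (L_ge1 : {ae P, forall w, 1 <= L (xi w)})
  (lipT : {ae distribution P xi, forall z, forall x y : 'rV[R]_n,
     enorm (T z x - T z y) <= L z * enorm (x - y)})
  (momL : forall p : R, 2 <= p ->
     ('E_P[fun w => (L (xi w) `^ (2 * p))%R] < +oo)%E)
  (qbar_ge2 : 2 <= qbar)
  (momT : ('E_P[fun w => (enorm (T (xi w) xcheck) `^ (2 * qbar))%R] < +oo)%E).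
Implicit Types (u v : 'rV[R]_n).

Let H := expected_map P xi T.

Let mxi : measurable_fun setT (xi : Omega -> Xi).
Proof. exact: measurable_funPT. Qed.

Lemma measurable_T_at u : measurable_fun setT (fun z => T z u).
Proof.
have mp : measurable_fun setT (fun z : Xi => (z, u)) by exact: measurable_fun_pair.
exact: (measurableT_comp measT mp).
Qed.

Let mTxi u : measurable_fun setT (fun w => T (xi w) u).
Proof. exact: (measurableT_comp (measurable_T_at u) mxi). Qed.

Let mLxi : measurable_fun setT (fun w => L (xi w)).
Proof. exact: measurableT_comp. Qed.

Definition lipschitz_draw z :=
  1 <= L z /\ forall x y, enorm (T z x - T z y) <= L z * enorm (x - y).

Lemma lipschitz_draw_ae : {ae distribution P xi, forall z, lipschitz_draw z}.
Proof.
have L1 : {ae distribution P xi, forall z, 1 <= L z}.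
  have mA : measurable (~` [set z | 1 <= L z]).
    apply: measurableC.
    have m1 : measurable_fun setT (fun z => 1 <= L z).
      by apply: measurable_fun_ler => //; exact: measurable_cst.
    by have := m1 measurableT [set true]; rewrite setTI; apply.
  exists (~` [set z | 1 <= L z]); split => //.
  have [A [mA' A0 LA]] := L_ge1.
  pose B := ~` [set z | 1 <= L z].
  have : (P (xi @^-1` B) <= P A)%E.
    by apply: le_measure => //; rewrite inE// -[X in measurable X]setTI; exact: mxi.
  by rewrite A0 => h; apply/eqP; rewrite eq_le measure_ge0 andbT.
by apply: filterS2 L1 lipT => z; split.
Qed.

Lemma lipschitz_draw_ae_law (Z : Omega -> Xi) : measurable_fun setT Z ->
  same_law P Z xi -> {ae P, forall w, lipschitz_draw (Z w)}.
Proof. by move=> mZ Zxi; exact: (same_law_ae Zxi lipschitz_draw_ae mZ). Qed.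

Let good_xi : {ae P, forall w, lipschitz_draw (xi w)}.
Proof. exact: lipschitz_draw_ae_law. Qed.

(** Dominates [T z u] by a factor that is affine in the distance from [u] to the
    solution [xs] and whose fourth moment is finite. *)
Definition envelope z := enorm (T z xcheck) + `|L z| * (enorm (xs - xcheck) + 1).

Lemma envelope_ge0 z : 0 <= envelope z.
Proof. by rewrite addr_ge0 ?mulr_ge0 ?addr_ge0 ?enorm_ge0. Qed.

Lemma envelopeP z u : lipschitz_draw z ->
  enorm (T z u) <= envelope z * (1 + enorm (u - xs)).
Proof.
move=> [L1 lip].
have L0 : 0 <= L z by exact: le_trans L1.
apply: le_trans (ler_enormB_dist _ (T z xcheck)) _.
apply: le_trans (_ : enorm (T z xcheck) + L z * (enorm (u - xs) + enorm (xs - xcheck)) <= _).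
  by rewrite lerD2l (le_trans (lip _ _))// ler_wpM2l// enorm_dist.
rewrite /envelope ger0_norm//.
have a0 := enorm_ge0 (T z xcheck); have b0 := enorm_ge0 (u - xs).
have c0 := enorm_ge0 (xs - xcheck).
move: (enorm (T z xcheck)) (enorm (u - xs)) (enorm (xs - xcheck)) a0 b0 c0 => a b c a0 b0 c0.
rewrite -subr_ge0 (_ : _ - _ = a * b + L z * (c * b) + L z); last by ring.
by rewrite !addr_ge0 ?mulr_ge0.
Qed.

Lemma measurable_envelope : measurable_fun setT envelope.
Proof.
apply: measurable_funD; first by apply: measurable_enorm; exact: measurable_T_at.
by apply: measurable_funM => //; exact: measurableT_comp.
Qed.

Let even_ge0 (x : R) k : 0 <= x ^+ (2 * k).
Proof. by rewrite mulnC exprM sqr_ge0. Qed.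

Lemma moment8_L : (\int[P]_w ((`|L (xi w)| ^+ 8)%:E) < +oo)%E.
Proof.
have := @momL 4; rewrite unlock => /(_ _); rewrite ler_nat => /(_ isT).
apply: finite_mean_le => //.
- by apply: measurable_funX; exact: measurableT_comp.
- by apply: (measurableT_comp (@measurable_powR R _)).
- by move=> w; rewrite powR_ge0.
- apply: filterS good_xi => w [L1 _].
  have L0 : 0 <= L (xi w) by exact: le_trans L1.
  by rewrite ger0_norm// -powR_mulrn// -natrM.
Qed.

Lemma moment4_T : (\int[P]_w ((enorm (T (xi w) xcheck) ^+ 4)%:E) < +oo)%E.
Proof.
have mt : measurable_fun setT (fun w => enorm (T (xi w) xcheck)).
  by apply: measurable_enorm; exact: mTxi.
have mp : measurable_fun setT (fun w => enorm (T (xi w) xcheck) `^ (2 * qbar)).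
  exact: (measurableT_comp (@measurable_powR R _) mt).
have := momT; rewrite unlock => mom.
have := @finite_mean_lin _ _ _ P 1 1 (fun _ => 1) _ (measurable_cst _) mp ler01 ler01
  (fun _ => ler01) (fun w => powR_ge0 _ _) (finite_mean_cst P 1) mom.
apply: finite_mean_le => //.
- exact: measurable_funX.
- by apply: measurable_funD => //; exact: measurable_funM.
- by move=> w; rewrite (even_ge0 _ 2).
- by move=> w; rewrite !mul1r addr_ge0 ?powR_ge0.
- apply: aeW => w; rewrite !mul1r.
  have := enorm_ge0 (T (xi w) xcheck); move: (enorm _) => a a0.
  have [a1|/ltW a1] := leP a 1.
    by rewrite (@le_trans _ _ 1) ?exprn_ile1// lerDl powR_ge0.
  rewrite -powR_mulrn// (@le_trans _ _ (a `^ (2 * qbar)))//; last by rewrite lerDr.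
  by apply: ler_powR => //; move: qbar_ge2; lra.
Qed.

Lemma moment4_envelope : (\int[P]_w ((envelope (xi w) ^+ 4)%:E) < +oo)%E.
Proof.
have mE : measurable_fun setT (fun w => envelope (xi w)).
  exact: (measurableT_comp measurable_envelope mxi).
have ma : measurable_fun setT (fun w => `|L (xi w)|) by exact: measurableT_comp.
have mt : measurable_fun setT (fun w => enorm (T (xi w) xcheck)).
  by apply: measurable_enorm; exact: mTxi.
have x40 (x : R) : 0 <= x ^+ 4 by exact: (even_ge0 _ 2).
have x80 (x : R) : 0 <= x ^+ 8 by exact: (even_ge0 _ 4).
pose k := 8 * (enorm (xs - xcheck) + 1) ^+ 4.
have k0 : 0 <= k by rewrite mulr_ge0.
have m0 : 0 <= 8 :> R by [].
have f1 := @finite_mean_lin _ _ _ P k k (fun _ => 1) (fun w => `|L (xi w)| ^+ 8)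
  (measurable_cst _) (measurable_funX 8 ma) k0 k0 (fun _ => ler01)
  (fun w => x80 _) (finite_mean_cst P 1) moment8_L.
have mk : measurable_fun setT (fun w : Omega => k * 1 + k * `|L (xi w)| ^+ 8).
  by apply: measurable_funD => //; apply: measurable_funM => //; exact: measurable_funX.
have k1 w : 0 <= k * 1 + k * `|L (xi w)| ^+ 8.
  by apply: addr_ge0; apply: mulr_ge0 => //; exact: x80.
have := @finite_mean_lin _ _ _ P 8 1 (fun w => enorm (T (xi w) xcheck) ^+ 4) _
  (measurable_funX 4 mt) mk m0 ler01 (fun w => x40 _) k1 moment4_T f1.
apply: finite_mean_le => //.
- exact: measurable_funX.
- by apply: measurable_funD => //; apply: measurable_funM => //; exact: measurable_funX.
- by move=> w; apply: addr_ge0; apply: mulr_ge0 => //; exact: x40.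
- apply: aeW => w; apply: le_trans (pow4D_le _ _) _.
  rewrite lerD2l mul1r mulr1 exprMn /k [_ ^+ 4 * _]mulrC mulrA -[X in _ <= X + _]mulr1 -mulrDr.
  rewrite ler_wpM2l//.
  have := normr_ge0 (L (xi w)); move: `|L (xi w)| => a a0.
  have [a1|/ltW a1] := leP a 1; first by rewrite (@le_trans _ _ 1) ?exprn_ile1// lerDl.
  rewrite (@le_trans _ _ (a ^+ 8))//; last by rewrite lerDr.
  by rewrite ler_weXn2l.
Qed.

Lemma moment2_of_4 (f : Omega -> R) : measurable_fun setT f ->
  (\int[P]_w ((f w ^+ 4)%:E) < +oo)%E -> (\int[P]_w ((f w ^+ 2)%:E) < +oo)%E.
Proof.
move=> mf f4.
have x40 (x : R) : 0 <= x ^+ 4 by exact: (even_ge0 _ 2).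
have := @finite_mean_lin _ _ _ P 1 1 (fun _ => 1) (fun w => f w ^+ 4)
  (measurable_cst _) (measurable_funX 4 mf) ler01 ler01 (fun _ => ler01)
  (fun w => x40 _) (finite_mean_cst P 1) f4.
apply: finite_mean_le => //.
- exact: measurable_funX.
- by apply: measurable_funD => //; apply: measurable_funM => //; exact: measurable_funX.
- by move=> w; rewrite sqr_ge0.
- by move=> w; rewrite !mul1r addr_ge0.
- apply: aeW => w; rewrite !mul1r (exprM _ 2 2).
  by have := sqr_ge0 (f w ^+ 2 - 1); have := sqr_ge0 (f w); lra.
Qed.

Lemma moment2_envelope : (\int[P]_w ((envelope (xi w) ^+ 2)%:E) < +oo)%E.
Proof.
apply: moment2_of_4 moment4_envelope.
exact: (measurableT_comp measurable_envelope mxi).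
Qed.

Definition envelope_m2 : R := fine (\int[P]_w ((envelope (xi w) ^+ 2)%:E)).
Definition lip_m2 : R := fine (\int[P]_w ((L (xi w) ^+ 2)%:E)).

Lemma envelope_m2E : (\int[P]_w ((envelope (xi w) ^+ 2)%:E))%E = envelope_m2%:E.
Proof.
rewrite fineK// ge0_fin_numE ?moment2_envelope// integral_ge0// => w _.
by rewrite lee_fin sqr_ge0.
Qed.

Lemma envelope_m2_ge0 : 0 <= envelope_m2.
Proof. by apply: fine_ge0; apply: integral_ge0 => w _; rewrite lee_fin sqr_ge0. Qed.

Lemma moment2_L : (\int[P]_w ((L (xi w) ^+ 2)%:E) < +oo)%E.
Proof.
apply: moment2_of_4 => //.
have x40 (x : R) : 0 <= x ^+ 4 by exact: (even_ge0 _ 2).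
have x80 (x : R) : 0 <= x ^+ 8 by exact: (even_ge0 _ 4).
have ma : measurable_fun setT (fun w => `|L (xi w)|) by exact: measurableT_comp.
have := @finite_mean_lin _ _ _ P 1 1 (fun _ => 1) (fun w => `|L (xi w)| ^+ 8)
  (measurable_cst _) (measurable_funX 8 ma) ler01 ler01 (fun _ => ler01)
  (fun w => x80 _) (finite_mean_cst P 1) moment8_L.
apply: finite_mean_le => //.
- exact: measurable_funX.
- by apply: measurable_funD => //; apply: measurable_funM => //; exact: measurable_funX.
- apply: aeW => w; rewrite !mul1r -normrX ger0_norm//.
  by rewrite (exprM _ 4 2); have := sqr_ge0 (L (xi w) ^+ 4 - 1); have := x40 (L (xi w)); lra.
Qed.

Lemma lip_m2E : (\int[P]_w ((L (xi w) ^+ 2)%:E))%E = lip_m2%:E.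
Proof.
rewrite fineK// ge0_fin_numE ?moment2_L// integral_ge0// => w _.
by rewrite lee_fin sqr_ge0.
Qed.

Lemma lip_m2_ge1 : 1 <= lip_m2.
Proof.
rewrite -lee_fin -lip_m2E.
have -> : 1%:E = (\int[P]_w (cst 1%:E w))%E.
  by rewrite integral_cst//= probability_setT mule1.
apply: ae_ge0_le_integral => //.
- by move=> w _; rewrite lee_fin sqr_ge0.
- by apply/measurable_EFinP; exact: measurable_funX.
- by apply: filterS good_xi => w [L1 _] _; rewrite lee_fin exprn_ege1.
Qed.

Let T_sq_le u : (\int[P]_w ((enorm (T (xi w) u) ^+ 2)%:E) <=
  (envelope_m2 * (1 + enorm (u - xs)) ^+ 2)%:E)%E.
Proof.
rewrite mulrC EFinM -envelope_m2E -ge0_integralZl//=; last 3 first.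
- apply/measurable_EFinP/measurable_funX.
  exact: (measurableT_comp measurable_envelope mxi).
- by move=> w _; rewrite lee_fin sqr_ge0.
- by rewrite lee_fin sqr_ge0.
apply: ae_ge0_le_integral => //.
- by move=> w _; rewrite lee_fin sqr_ge0.
- by apply/measurable_EFinP/measurable_funX/measurable_enorm/mTxi.
- by move=> w _; rewrite -EFinM lee_fin mulr_ge0 ?sqr_ge0.
- apply: emeasurable_funM => //; apply/measurable_EFinP/measurable_funX.
  exact: (measurableT_comp measurable_envelope mxi).
- apply: filterS good_xi => w /envelopeP h _; rewrite -EFinM lee_fin -exprMn mulrC.
  have t0 := enorm_ge0 (T (xi w) u); have {}h := h u.
  by rewrite (ler_pXn2r _ t0 (le_trans t0 h)).
Qed.

Let coord_sq_lty (f : Omega -> 'rV[R]_n) i : measurable_fun setT f ->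
  (\int[P]_w ((enorm (f w) ^+ 2)%:E) < +oo)%E ->
  (\int[P]_w ((f w 0%R i ^+ 2)%:E) < +oo)%E.
Proof.
move=> mf; apply: finite_mean_le.
- by apply: measurable_funX; exact: measurable_coord.
- by apply: measurable_funX; exact: measurable_enorm.
- by move=> w; rewrite sqr_ge0.
- by move=> w; rewrite sqr_ge0.
- apply: aeW => w; rewrite -real_normK ?num_real//.
  by rewrite ler_pXn2r ?nnegrE ?enorm_ge0// coord_le_enorm.
Qed.

Let T_sq_lty u : (\int[P]_w ((enorm (T (xi w) u) ^+ 2)%:E) < +oo)%E.
Proof. by apply: le_lt_trans (T_sq_le u) _; rewrite ltry. Qed.

Lemma enorm_sq_sum u : enorm u ^+ 2 = \sum_(i < n) u 0 i ^+ 2.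
Proof. by rewrite enorm_sq; apply: eq_bigr => i _; rewrite expr2. Qed.

Let integral_enorm_sq (f : Omega -> 'rV[R]_n) : measurable_fun setT f ->
  (\int[P]_w ((enorm (f w) ^+ 2)%:E) = \sum_(i < n) \int[P]_w ((f w 0%R i ^+ 2)%:E))%E.
Proof.
move=> mf; rewrite -ge0_integral_sum//=.
- by apply: eq_integral => w _; rewrite enorm_sq_sum sumEFin.
- by move=> i; apply/measurable_EFinP/measurable_funX; exact: measurable_coord.
- by move=> i w _; rewrite lee_fin sqr_ge0.
Qed.

Lemma expected_map_coord u i : H u 0 i = fine (\int[P]_w (T (xi w) u 0%R i)%:E)%E.
Proof. by rewrite mxE unlock (ord1 ord0). Qed.

Let mean_sq_le (f : Omega -> 'rV[R]_n) (c : 'rV[R]_n) : measurable_fun setT f ->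
  (\int[P]_w ((enorm (f w) ^+ 2)%:E) < +oo)%E ->
  (forall i, c 0 i = fine (\int[P]_w (f w 0%R i)%:E)%E) ->
  ((enorm c ^+ 2)%:E <= \int[P]_w ((enorm (f w) ^+ 2)%:E))%E.
Proof.
move=> mf f2 cE; rewrite integral_enorm_sq// enorm_sq_sum -sumEFin.
apply: lee_sum => i _; rewrite cE.
have mfi : measurable_fun setT (fun w => f w 0 i) by exact: measurable_coord.
have fi2 := coord_sq_lty i mf f2.
set s := fine _.
have ifi := integrable_sq mfi fi2.
have ics : P.-integrable setT (fun _ : Omega => s%:E).
  by apply/integrableP; split => //; rewrite finite_mean_cst.
have ma : measurable_fun setT (fun w => f w 0 i - s) by exact: measurable_funB.
have a0 : (\int[P]_w (f w 0%R i - s)%:E = 0)%E.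
  under eq_integral do rewrite EFinB.
  rewrite integralB//= integral_cst//= probability_setT mule1 /s.
  by rewrite fineK ?subee// integrable_fin_num.
have a2 : (\int[P]_w (((f w 0%R i - s) ^+ 2)%:E) < +oo)%E.
  have := @finite_mean_lin _ _ _ P 2 2 (fun w => f w 0 i ^+ 2) (fun _ => s ^+ 2)
    (measurable_funX 2 mfi) (measurable_cst _) (ler0n _ 2) (ler0n _ 2)
    (fun w => sqr_ge0 _) (fun w => sqr_ge0 _) fi2 (finite_mean_cst P _).
  apply: finite_mean_le => //.
  - exact: measurable_funX.
  - by apply: measurable_funD => //; apply: measurable_funM => //; exact: measurable_funX.
  - by move=> w; rewrite sqr_ge0.
  - by move=> w; apply: addr_ge0; apply: mulr_ge0 => //; exact: sqr_ge0.
  - apply: aeW => w; apply: le_trans (sqrrD_le2 _ _) _; by rewrite sqrrN.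
have := @integral_shift_sq _ _ _ P _ s ma a2 a0.
under eq_integral do rewrite addrC subrK.
by move=> ->; rewrite leeDl// integral_ge0// => w _; rewrite lee_fin sqr_ge0.
Qed.

Lemma expected_map_growth u :
  enorm (H u) <= Num.sqrt envelope_m2 * (1 + enorm (u - xs)).
Proof.
have := le_trans (mean_sq_le (mTxi u) (T_sq_lty u) (expected_map_coord u)) (T_sq_le u).
rewrite lee_fin => h.
have d0 : 0 <= 1 + enorm (u - xs) by rewrite addr_ge0 ?enorm_ge0.
rewrite -(@ler_pXn2r _ 2) ?nnegrE ?mulr_ge0 ?sqrtr_ge0 ?enorm_ge0//.
by rewrite exprMn (sqr_sqrtr envelope_m2_ge0).
Qed.

Lemma expected_map_lipschitz u v :
  enorm (H u - H v) <= Num.sqrt lip_m2 * enorm (u - v).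
Proof.
have mTuv : measurable_fun setT (fun w => T (xi w) u - T (xi w) v).
  by apply: measurable_subv; exact: mTxi.
have le : (\int[P]_w ((enorm (T (xi w) u - T (xi w) v) ^+ 2)%:E) <=
    (lip_m2 * enorm (u - v) ^+ 2)%:E)%E.
  rewrite mulrC EFinM -lip_m2E -ge0_integralZl//=; last 3 first.
  - by apply/measurable_EFinP/measurable_funX.
  - by move=> w _; rewrite lee_fin sqr_ge0.
  - by rewrite lee_fin sqr_ge0.
  apply: ae_ge0_le_integral => //.
  - by move=> w _; rewrite lee_fin sqr_ge0.
  - by apply/measurable_EFinP/measurable_funX/measurable_enorm.
  - by move=> w _; rewrite -EFinM lee_fin mulr_ge0 ?sqr_ge0.
  - by apply: emeasurable_funM => //; apply/measurable_EFinP/measurable_funX.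
  - apply: filterS good_xi => w [L1 lip] _; rewrite -EFinM lee_fin -exprMn mulrC.
    have L0 : 0 <= L (xi w) by exact: le_trans L1.
    have t0 := enorm_ge0 (T (xi w) u - T (xi w) v); have {}lip := lip u v.
    by rewrite (ler_pXn2r _ t0 (le_trans t0 lip)).
have lt : (\int[P]_w ((enorm (T (xi w) u - T (xi w) v) ^+ 2)%:E) < +oo)%E.
  by apply: le_lt_trans le _; rewrite ltry.
have cE i : (H u - H v) 0 i = fine (\int[P]_w ((T (xi w) u - T (xi w) v) 0%R i)%:E)%E.
  have iT x : P.-integrable setT (fun w => (T (xi w) x 0 i)%:E).
    apply: integrable_sq; first exact: measurable_coord.
    exact: coord_sq_lty.
  rewrite mxE [X in _ + X]mxE !expected_map_coord.
  rewrite -fineB ?integrable_fin_num// -integralB//.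
  by congr fine; apply: eq_integral => w _; rewrite !mxE.
have := le_trans (mean_sq_le mTuv lt cE) le; rewrite lee_fin => h.
have m0 : 0 <= lip_m2 by exact: le_trans lip_m2_ge1.
rewrite -(@ler_pXn2r _ 2) ?nnegrE ?mulr_ge0 ?sqrtr_ge0 ?enorm_ge0//.
by rewrite exprMn (sqr_sqrtr m0).
Qed.

(** The moments left over when the rate of the sampling error is split: the
    eighth one of the Lipschitz factor and the fourth one of the envelope. *)
Definition factor_moment : R := fine (\int[P]_w
  (((`|L (xi w)| + Num.sqrt lip_m2) ^+ 8
    + (envelope (xi w) + Num.sqrt envelope_m2) ^+ 4)%:E))%E.

Let factor z := (`|L z| + Num.sqrt lip_m2) ^+ 8
    + (envelope z + Num.sqrt envelope_m2) ^+ 4.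

Let factor_ge0 z : 0 <= factor z.
Proof. by rewrite addr_ge0 ?(even_ge0 _ 4) ?(even_ge0 _ 2). Qed.

Let measurable_factor : measurable_fun setT factor.
Proof.
apply: measurable_funD; apply: measurable_funX; apply: measurable_funD => //.
  exact: measurableT_comp.
exact: measurable_envelope.
Qed.

Let factor_lty : (\int[P]_w (factor (xi w))%:E < +oo)%E.
Proof.
have x40 (x : R) : 0 <= x ^+ 4 by exact: (even_ge0 _ 2).
have x80 (x : R) : 0 <= x ^+ 8 by exact: (even_ge0 _ 4).
have ma : measurable_fun setT (fun w => `|L (xi w)|) by exact: measurableT_comp.
have mE : measurable_fun setT (fun w => envelope (xi w)).
  exact: (measurableT_comp measurable_envelope mxi).
set l := Num.sqrt lip_m2; set s := Num.sqrt envelope_m2.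
have m128 : 0 <= 128 :> R by [].
have m8 : 0 <= 8 :> R by [].
have f1 := @finite_mean_lin _ _ _ P 128 128 (fun w => `|L (xi w)| ^+ 8) (fun _ => l ^+ 8)
  (measurable_funX 8 ma) (measurable_cst _) m128 m128 (fun w => x80 _) (fun w => x80 _)
  moment8_L (finite_mean_cst P _).
have f2 := @finite_mean_lin _ _ _ P 8 8 (fun w => envelope (xi w) ^+ 4) (fun _ => s ^+ 4)
  (measurable_funX 4 mE) (measurable_cst _) m8 m8 (fun w => x40 _) (fun w => x40 _)
  moment4_envelope (finite_mean_cst P _).
have mf1 : measurable_fun setT (fun w => 128 * `|L (xi w)| ^+ 8 + 128 * l ^+ 8).
  by apply: measurable_funD => //; apply: measurable_funM => //; exact: measurable_funX.
have mf2 : measurable_fun setT (fun w => 8 * envelope (xi w) ^+ 4 + 8 * s ^+ 4).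
  by apply: measurable_funD => //; apply: measurable_funM => //; exact: measurable_funX.
have f10 w : 0 <= 128 * `|L (xi w)| ^+ 8 + 128 * l ^+ 8 by apply: addr_ge0; apply: mulr_ge0 => //; exact: x80.
have f20 w : 0 <= 8 * envelope (xi w) ^+ 4 + 8 * s ^+ 4 by apply: addr_ge0; apply: mulr_ge0 => //; exact: x40.
have := @finite_mean_lin _ _ _ P 1 1 _ _ mf1 mf2 ler01 ler01 f10 f20 f1 f2.
apply: finite_mean_le => //.
- exact: (measurableT_comp measurable_factor mxi).
- by apply: measurable_funD; apply: measurable_funM.
- by move=> w; rewrite !mul1r addr_ge0.
- apply: aeW => w; rewrite !mul1r /factor.
  by rewrite lerD ?pow8D_le ?pow4D_le.
Qed.

Let factor_momentE : (\int[P]_w (factor (xi w))%:E)%E = factor_moment%:E.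
Proof.
rewrite fineK// ge0_fin_numE ?factor_lty// integral_ge0// => w _.
by rewrite lee_fin; exact: factor_ge0.
Qed.

Lemma factor_moment_ge0 : 0 <= factor_moment.
Proof. by apply: fine_ge0; apply: integral_ge0 => w _; rewrite lee_fin; exact: factor_ge0. Qed.

Definition noise_const : R := 2 * envelope_m2 + factor_moment.

Lemma noise_const_ge0 : 0 <= noise_const.
Proof. by rewrite addr_ge0 ?mulr_ge0 ?envelope_m2_ge0 ?factor_moment_ge0. Qed.

Section one_sample.
Variables (m : nat) (Z : 'I_m -> {RV P >-> Xi}).
Hypotheses (m_gt0 : (0 < m)%N) (iidZ : iid_sample P xi (fun j => Z j : Omega -> Xi)).

Let mZ j : measurable_fun setT (Z j : Omega -> Xi).
Proof. exact: measurable_funPT. Qed.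

Let smean w := sample_mean T (fun j => Z j w).

(** The Lipschitz constant of the sampled operator. *)
Definition lip_mean w : R := m%:R^-1 * \sum_(j < m) L (Z j w).

Lemma measurable_lip_mean : measurable_fun setT lip_mean.
Proof.
apply: measurable_funM => //; apply: measurable_sum => j.
exact: (measurableT_comp measL (mZ j)).
Qed.

Lemma sample_lipschitz_draw_ae : {ae P, forall w, forall j, lipschitz_draw (Z j w)}.
Proof.
have aej j : {ae P, forall w, lipschitz_draw (Z j w)}.
  by apply: lipschitz_draw_ae_law => //; case: iidZ.
by apply: filter_forall => j; exact: aej.
Qed.

Lemma lip_mean_ge1 w : (forall j, lipschitz_draw (Z j w)) -> 1 <= lip_mean w.
Proof.
move=> gw; have mp : 0 < m%:R :> R by rewrite ltr0n.
rewrite /lip_mean mulrC ler_pdivlMr// mul1r -[in leLHS](card_ord m) -sumr_const.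
by apply: ler_sum => j _; case: (gw j).
Qed.

Lemma sample_mean_lipschitz w u v : (forall j, lipschitz_draw (Z j w)) ->
  enorm (smean w u - smean w v) <= lip_mean w * enorm (u - v).
Proof.
move=> gw; rewrite /smean /sample_mean -scalerBr enormZ ger0_norm ?invr_ge0//.
rewrite /lip_mean -mulrA ler_wpM2l ?invr_ge0// -sumrB mulr_suml.
apply: le_trans (ler_enorm_sum _) _; apply: ler_sum => j _.
by case: (gw j).
Qed.

Lemma lip_mean_sq_le : (\int[P]_w ((lip_mean w ^+ 2)%:E) <= lip_m2%:E)%E.
Proof.
rewrite -lip_m2E -(sample_mean_ge0_integral m_gt0 iidZ (f := fun z => L z ^+ 2))//; last 3 first.
- exact: measurable_funX.
- by move=> z; rewrite sqr_ge0.
- exact: moment2_L.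
apply: ge0_le_integral => //.
- by move=> w _; rewrite lee_fin sqr_ge0.
- by apply/measurable_EFinP/measurable_funX; exact: measurable_lip_mean.
- apply/measurable_EFinP; apply: measurable_funM => //; apply: measurable_sum => j.
  by apply: measurable_funX; exact: (measurableT_comp measL (mZ j)).
- by move=> w _; rewrite lee_fin; exact: sqr_mean_le.
Qed.

Let msm u : measurable_fun setT (fun w => smean w u - H u).
Proof.
apply: measurable_subv => //.
by apply: (jointly_measurable_sample_mean measT mZ) => //; exact: measurable_cst.
Qed.

Let variance_raw u : (\int[P]_w ((enorm (smean w u - H u) ^+ 2)%:E) <=
  (m%:R^-1 * (envelope_m2 * (1 + enorm (u - xs)) ^+ 2))%:E)%E.
Proof.
rewrite integral_enorm_sq; last exact: msm.
apply: (@le_trans _ _ ((m%:R^-1)%:E * \int[P]_w ((enorm (T (xi w) u) ^+ 2)%:E))%E); last first.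
  by rewrite EFinM lee_pmul2l ?T_sq_le// lte_fin invr_gt0 ltr0n.
rewrite integral_enorm_sq; last exact: mTxi.
rewrite ge0_sume_distrr; last first.
  by move=> i _; apply: integral_ge0 => w _; rewrite lee_fin sqr_ge0.
apply: lee_sum => i _.
have mphi : measurable_fun setT (fun z => T z u 0 i).
  by apply: measurable_coord; exact: measurable_T_at.
have [_] := sample_mean_variance m_gt0 iidZ mphi (coord_sq_lty i (mTxi u) (T_sq_lty u)).
rewrite -expected_map_coord; apply: le_trans.
rewrite le_eqVlt; apply/orP; left; apply/eqP.
apply: eq_integral => w _; congr ((_ ^+ 2)%:E).
by rewrite /smean /sample_mean mxE [X in _ + X]mxE mxE summxE.
Qed.

Let dist_sq_le u : (1 + enorm (u - xs)) ^+ 2 <= 2 * (1 + enorm (u - xs) ^+ 2).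
Proof. by apply: le_trans (sqrrD_le2 _ _) _; rewrite expr1n mulrDr. Qed.

Lemma sample_variance u : (\int[P]_w ((enorm (smean w u - H u) ^+ 2)%:E) <=
  (noise_const / m%:R * (1 + enorm (u - xs) ^+ 2))%:E)%E.
Proof.
apply: le_trans (variance_raw u) _; rewrite lee_fin.
rewrite [noise_const / _]mulrC -mulrA ler_wpM2l ?invr_ge0//.
apply: le_trans (ler_wpM2l envelope_m2_ge0 (dist_sq_le u)) _.
rewrite mulrA ler_wpM2r ?addr_ge0 ?sqr_ge0// mulrC /noise_const lerDl.
exact: factor_moment_ge0.
Qed.

(** The sampled Lipschitz constant and the sampling error are dependent, and the
    former is unbounded.  Half of the rate is given up to decouple them, which
    is where the sum of [1 / Num.sqrt (Sk k)] comes from. *)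
Lemma sample_weighted_variance u :
  (\int[P]_w ((((lip_mean w + Num.sqrt lip_m2) * enorm (smean w u - H u)) ^+ 2)%:E) <=
  (noise_const / Num.sqrt m%:R * (1 + enorm (u - xs) ^+ 2))%:E)%E.
Proof.
set l := Num.sqrt lip_m2; set s := Num.sqrt envelope_m2.
set D := 1 + enorm (u - xs).
have D0 : 0 <= D by rewrite addr_ge0 ?enorm_ge0.
pose sm : R := Num.sqrt m%:R.
have sm0 : 0 < sm by rewrite sqrtr_gt0 ltr0n.
pose qmean w := m%:R^-1 * \sum_(j < m) factor (Z j w).
have qm0 w : 0 <= qmean w by apply: mean_ge0.
have mq : measurable_fun setT qmean.
  apply: measurable_funM => //; apply: measurable_sum => j.
  exact: (measurableT_comp measurable_factor (mZ j)).
have qE : (\int[P]_w (qmean w)%:E)%E = factor_moment%:E.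
  by rewrite -factor_momentE -(sample_mean_ge0_integral m_gt0 iidZ).
have me : measurable_fun setT (fun w => enorm (smean w u - H u)).
  exact: measurable_enorm.
pose c1 : R := 2^-1 * sm; pose c2 : R := 4^-1 * (sm^-1 * D ^+ 2).
have c10 : 0 <= c1 by rewrite mulr_ge0// ltW.
have c20 : 0 <= c2 by rewrite mulr_ge0// mulr_ge0 ?sqr_ge0// invr_ge0 ltW.
apply: (@le_trans _ _ (\int[P]_w
    ((c1 * enorm (smean w u - H u) ^+ 2)%:E + (c2 * qmean w)%:E))%E).
  apply: ae_ge0_le_integral => //.
  - by move=> w _; rewrite lee_fin sqr_ge0.
  - apply/measurable_EFinP/measurable_funX; apply: measurable_funM => //.
    by apply: measurable_funD => //; exact: measurable_lip_mean.
  - move=> w _; rewrite -EFinD lee_fin; apply: addr_ge0; apply: mulr_ge0 => //; exact: sqr_ge0.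
  - apply: emeasurable_funD; apply/measurable_EFinP; apply: measurable_funM => //.
    exact: measurable_funX.
  apply: filterS sample_lipschitz_draw_ae => w gw _; rewrite -EFinD lee_fin.
  have L1 := lip_mean_ge1 gw.
  pose A := m%:R^-1 * \sum_(j < m) (envelope (Z j w) + s).
  pose W := m%:R^-1 * \sum_(j < m) (`|L (Z j w)| + l).
  have mean_cst (c : R) : m%:R^-1 * \sum_(j < m) c = c.
    by rewrite sumr_const card_ord -[X in _ * X]mulr_natl mulrA mulVf ?mul1r// pnatr_eq0 -lt0n.
  have l0 : 0 <= l by exact: sqrtr_ge0.
  have s0 : 0 <= s by exact: sqrtr_ge0.
  have A0 : 0 <= A by apply: mean_ge0 => j; rewrite addr_ge0 ?envelope_ge0.
  have W0 : 0 <= W by apply: mean_ge0 => j; rewrite addr_ge0.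
  have LW : lip_mean w + l <= W.
    rewrite /W big_split/= mulrDr mean_cst lerD2r.
    by apply: ler_mean => j; exact: ler_norm.
  have eA : enorm (smean w u - H u) <= A * D.
    apply: le_trans (ler_enormD _ _) _; rewrite enormN.
    have -> : A = m%:R^-1 * \sum_(j < m) envelope (Z j w) + s.
      by rewrite /A big_split/= mulrDr mean_cst.
    rewrite mulrDl lerD//; last exact: expected_map_growth.
    rewrite /smean /sample_mean enormZ ger0_norm ?invr_ge0// -mulrA ler_wpM2l ?invr_ge0//.
    apply: le_trans (ler_enorm_sum _) _; rewrite mulr_suml; apply: ler_sum => j _.
    exact: envelopeP.
  have e0 := enorm_ge0 (smean w u - H u).
  have Ll0 : 0 <= lip_mean w + l by rewrite addr_ge0// (le_trans ler01).
  apply: (@le_trans _ _ ((W * enorm (smean w u - H u)) ^+ 2)).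
    rewrite (ler_pXn2r _ (mulr_ge0 Ll0 e0) (mulr_ge0 W0 e0))//.
    exact: ler_wpM2r e0 _ _ LW.
  apply: le_trans (split_rate sm0 e0 W0 A0 D0 eA) _.
  apply: lerD; first by rewrite mulrA.
  rewrite [leLHS]mulrA; apply: ler_wpM2l => //.
  rewrite /qmean /factor big_split/= mulrDr lerD ?pow8_mean_le ?pow4_mean_le//.
rewrite ge0_integralD//=; last 4 first.
- by move=> w _; rewrite lee_fin mulr_ge0 ?sqr_ge0.
- by apply/measurable_EFinP; apply: measurable_funM => //; exact: measurable_funX.
- by move=> w _; rewrite lee_fin mulr_ge0.
- by apply/measurable_EFinP; apply: measurable_funM.
under eq_integral do rewrite EFinM.
rewrite ge0_integralZl//=; last 2 first.
- by apply/measurable_EFinP; exact: measurable_funX.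
- by move=> w _; rewrite lee_fin sqr_ge0.
under [X in (_ + X <= _)%E]eq_integral do rewrite EFinM.
rewrite ge0_integralZl//=; last 2 first.
- by apply/measurable_EFinP.
- by move=> w _; rewrite lee_fin.
rewrite qE.
apply: (@le_trans _ _ (c1%:E * (m%:R^-1 * (envelope_m2 * D ^+ 2))%:E
    + c2%:E * factor_moment%:E)%E).
  by rewrite leeD2r// lee_wpmul2l ?lee_fin// variance_raw.
rewrite -!EFinM -EFinD lee_fin /c1 /c2 -/sm.
have mE : m%:R = sm ^+ 2 by rewrite sqr_sqrtr// ler0n.
have D2 := dist_sq_le u; rewrite -/D in D2.
have b0 := envelope_m2_ge0; have f0 := factor_moment_ge0.
move: b0 f0; rewrite mE /noise_const.
move: envelope_m2 factor_moment => b f b0 f0.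
have -> : 2^-1 * sm * ((sm ^+ 2)^-1 * (b * D ^+ 2)) + 4^-1 * (sm^-1 * D ^+ 2) * f =
    sm^-1 * ((2^-1 * b + 4^-1 * f) * D ^+ 2) by field; rewrite gt_eqF.
rewrite [(_ + _) / sm]mulrC -[leRHS]mulrA ler_wpM2l ?invr_ge0 ?(ltW sm0)//.
have bf0 : 0 <= 2^-1 * b + 4^-1 * f by rewrite addr_ge0 ?mulr_ge0.
apply: le_trans (ler_wpM2l bf0 D2) _.
rewrite mulrA ler_wpM2r ?addr_ge0 ?sqr_ge0//.
by lra.
Qed.

End one_sample.

End sampling.

(** * Recursions and bounds in the mean *)

(** Discrete Gronwall inequality: [u] stays below a constant, by comparison with
    the product of the factors [1 + b k <= expR (b k)], and then the inequality
    telescopes. *)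
Lemma gronwall_sum (R : realType) (u s b : nat -> R) (B : R) :
  (forall k, 0 <= u k) -> (forall k, 0 <= s k) -> (forall k, 0 <= b k) ->
  (forall k, u k.+1 + s k <= (1 + b k) * u k + b k) ->
  (forall N, \sum_(k < N) b k <= B) ->
  forall N, \sum_(k < N) s k <= u 0 + (u 0 + 1) * expR B * B.
Proof.
move=> u0 s0 b0 rec bB N.
have u00 : 0 <= u 0 + 1 by rewrite addr_ge0.
have grow k : u k + 1 <= (u 0 + 1) * expR (\sum_(i < k) b i).
  elim: k => [|k ih]; first by rewrite big_ord0 expR0 mulr1.
  rewrite big_ord_recr/= expRD mulrA.
  have uk0 : 0 <= u k + 1 by rewrite addr_ge0.
  apply: (@le_trans _ _ ((u k + 1) * (1 + b k))).
    by have := rec k; have := s0 k; lra.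
  apply: (@le_trans _ _ ((u k + 1) * expR (b k))).
    by rewrite ler_wpM2l// expR_ge1Dx.
  by rewrite ler_wpM2r ?expR_ge0.
pose K := (u 0 + 1) * expR B.
have K0 : 0 <= K by rewrite mulr_ge0 ?expR_ge0.
have growK k : u k + 1 <= K.
  by apply: le_trans (grow k) _; rewrite ler_wpM2l// ler_expR.
have sumle : \sum_(k < N) s k + u N <= u 0 + K * \sum_(k < N) b k.
  elim: N => [|N ih]; first by rewrite !big_ord0 add0r mulr0 addr0.
  rewrite !big_ord_recr/= mulrDr.
  have := rec N; have := ler_wpM2r (b0 N) (growK N); move: ih; lra.
have := ler_wpM2l K0 (bB N); have := u0 N; rewrite -/K; move: sumle; lra.
Qed.

Section mean_bounds.
Local Open Scope ereal_scope.
Context {d : measure_display} {Omega : measurableType d} {R : realType}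
  (P : probability Omega R).
Implicit Types (f g : Omega -> \bar R) (a b c : R).

(** Bounds on nonnegative functions with values in the extended reals, so that an
    infinite series of errors can be handled before it is known to be finite. *)
Definition mean_le f a := [/\ measurable_fun setT f, forall w, 0 <= f w
  & \int[P]_w f w <= a%:E].

Lemma mean_leD f g a b : mean_le f a -> mean_le g b ->
  mean_le (fun w => f w + g w) (a + b)%R.
Proof.
move=> [mf f0 fa] [mg g0 gb]; split.
- exact: emeasurable_funD.
- by move=> w; rewrite adde_ge0.
- by rewrite ge0_integralD// EFinD leeD.
Qed.

Lemma mean_leZ c f a : (0 <= c)%R -> mean_le f a ->
  mean_le (fun w => c%:E * f w) (c * a)%R.
Proof.
move=> c0 [mf f0 fa]; split.
- exact: emeasurable_funM.
- by move=> w; rewrite mule_ge0.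
- by rewrite ge0_integralZl// EFinM lee_wpmul2l// lee_fin.
Qed.

Lemma mean_le_mono f a b : (a <= b)%R -> mean_le f a -> mean_le f b.
Proof. by move=> ab [mf f0 fa]; split => //; rewrite (le_trans fa)// lee_fin. Qed.

Lemma mean_le_ae f g a : measurable_fun setT f -> (forall w, 0 <= f w) ->
  {ae P, forall w, f w <= g w} -> mean_le g a -> mean_le f a.
Proof.
move=> mf f0 fg [mg g0 ga]; split => //; apply: le_trans ga.
by apply: ae_ge0_le_integral => //; apply: filterS fg => w.
Qed.

Lemma mean_le_fine f a : mean_le f a ->
  \int[P]_w f w = (fine (\int[P]_w f w))%:E.
Proof.
move=> [_ f0 fa]; rewrite fineK// ge0_fin_numE; last exact: integral_ge0.
by apply: le_lt_trans fa _; rewrite ltry.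
Qed.

Lemma mean_le_fineI f a : mean_le f a -> mean_le f (fine (\int[P]_w f w)).
Proof. by move=> hf; have e := mean_le_fine hf; case: hf => mf f0 _; split; rewrite -?e. Qed.

Lemma mean_le_cst a : (0 <= a)%R -> mean_le (fun _ => a%:E) a.
Proof.
by move=> a0; split => //; rewrite integral_cst//= probability_setT mule1.
Qed.

Lemma geometric_nneseries_le (a c : R) : (0 <= c)%R -> (0 <= a < 1)%R ->
  \sum_(l <oo) (a ^+ l * c)%:E <= (c / (1 - a))%:E.
Proof.
move=> c0 /andP[a0 a1].
apply: lime_le.
  by apply: is_cvg_nneseries => l _ _; rewrite lee_fin mulr_ge0// exprn_ge0.
apply: nearW => N; rewrite sumEFin lee_fin ler_pdivlMr ?subr_gt0//.
rewrite -mulr_suml mulrAC ler_piMl//.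
rewrite [leLHS](_ : _ = 1 - a ^+ N)%R; first by rewrite gerBl exprn_ge0.
elim: N => [|N ih]; first by rewrite big_nil mul0r expr0 subrr.
by rewrite big_nat_recr//= mulrDl ih exprS; ring.
Qed.

Lemma nneseries_term_le (u : nat -> \bar R) l : (forall i, 0 <= u i) ->
  u l <= \sum_(i <oo) u i.
Proof.
move=> u0; apply: le_trans (nneseries_lim_ge l.+1 _) => //.
by rewrite big_nat_recr//= leeDr// sume_ge0.
Qed.

End mean_bounds.

Section sub_sigma_algebras.
Local Open Scope ereal_scope.
Context {d : measure_display} {Omega : measurableType d} {R : realType}
  (P : probability Omega R).

(** The diagonal form of conditioning: one outcome plays both roles, read once
    through the conditioning algebra and once through the independent one. *)
Lemma indep_classes_mean_le (g1 g2 : set (set Omega)) (g : Omega -> Omega -> \bar R)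
    (h : Omega -> \bar R) (a : R) :
  g1 `<=` measurable -> g2 `<=` measurable ->
  indep_classes P <<s g2 >> <<s g1 >> ->
  measurable_fun [set: g_sigma_algebraType g1 * g_sigma_algebraType g2]
    (fun p => g p.1 p.2) ->
  (forall w w', 0 <= g w w') ->
  measurable_fun [set: g_sigma_algebraType g1] h ->
  (forall w, \int[P]_w' g w w' <= h w) ->
  mean_le P h a -> mean_le P (fun w => g w w) a.
Proof.
move=> m1 m2 indep mg g0 mh gh [mh' h0 ha].
have mid (g' : set (set Omega)) : g' `<=` measurable ->
    measurable_fun setT (id : Omega -> g_sigma_algebraType g').
  move=> mg' _ B mB; rewrite setTI preimage_id.
  exact: (smallest_sub (@sigma_algebra_measurable _ Omega) mg').
split.
- have mp : measurable_fun [set: Omega]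
      (fun w => (w, w) : g_sigma_algebraType g1 * g_sigma_algebraType g2).
    by apply: measurable_fun_pair; exact: mid.
  exact: (measurableT_comp mg mp).
- by [].
- apply: le_trans ha.
  apply: (@indep_integral_le _ _ _ P _ _ _ _
    (id : Omega -> g_sigma_algebraType g1) (id : Omega -> g_sigma_algebraType g2)
    (fun p => g p.1 p.2) h (mid _ m1) (mid _ m2)) => //.
  by move=> A B mA mB; rewrite !preimage_id setIC muleC; exact: indep.
Qed.

End sub_sigma_algebras.

(** * The histories of the algorithm *)

Section history.
Context {d d' d'' : measure_display} {Omega : measurableType d}
  {Xi : measurableType d'} {E : measurableType d''}.
Variables (S : nat -> nat) (x0 : Omega -> E)
  (xis etas : forall k, 'I_(S k) -> Omega -> Xi).

(** The histories are kept as generating families: such a family turns the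
    outcomes into a measurable space, on which being measurable means being
    determined by the history. *)
Definition history_gen k : set (set Omega) :=
  preimage_set_system setT x0 measurable `|`
  \bigcup_(i in `I_k) (g_sigma_preimage (@xis i) `|` g_sigma_preimage (@etas i)).

Definition history_hat_gen k : set (set Omega) :=
  sigmaF x0 xis etas k `|` g_sigma_preimage (@xis k).

Definition sample_gen m (Z : 'I_m -> Omega -> Xi) : set (set Omega) :=
  \big[setU/set0]_(j < m) preimage_set_system setT (Z j) measurable.

Lemma sample_gen_measurable m (Z : 'I_m -> Omega -> Xi) j :
  measurable_fun [set: g_sigma_algebraType (sample_gen Z)] (Z j).
Proof.
move=> _ B mB; rewrite setTI; apply: sub_sigma_algebra.
rewrite /sample_gen -bigcup_seq; exists j => //=; first by rewrite mem_index_enum.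
by exists B => //; rewrite setTI.
Qed.

Lemma sub_g_sigma_preimage m (Z : 'I_m -> Omega -> Xi) j B : measurable B ->
  g_sigma_preimage Z (Z j @^-1` B).
Proof.
by move=> mB; have := @sample_gen_measurable m Z j measurableT B mB; rewrite setTI.
Qed.

Lemma sample_gen_sub m (Z : 'I_m -> Omega -> Xi) :
  (forall j, measurable_fun setT (Z j)) -> sample_gen Z `<=` measurable.
Proof.
move=> mZ A; rewrite /sample_gen -bigcup_seq => -[j _ /= [B mB <-]].
exact: mZ.
Qed.

Lemma g_sigma_preimage_sub m (Z : 'I_m -> Omega -> Xi) :
  (forall j, measurable_fun setT (Z j)) -> g_sigma_preimage Z `<=` measurable.
Proof.
move=> mZ; apply: smallest_sub; first exact: sigma_algebra_measurable.
exact: sample_gen_sub.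
Qed.

Hypotheses (mx0 : measurable_fun setT x0)
  (mxis : forall i j, measurable_fun setT (@xis i j))
  (metas : forall i j, measurable_fun setT (@etas i j)).

Lemma history_gen_sub k : history_gen k `<=` measurable.
Proof.
move=> A [[B mB <-]|[i _ [|]]]; first exact: mx0.
  exact: g_sigma_preimage_sub (@mxis i) _.
exact: g_sigma_preimage_sub (@metas i) _.
Qed.

Lemma sigmaF_sub k : sigmaF x0 xis etas k `<=` measurable.
Proof.
apply: smallest_sub; [exact: sigma_algebra_measurable|exact: history_gen_sub].
Qed.

Lemma history_hat_gen_sub k : history_hat_gen k `<=` measurable.
Proof.
by move=> A [|]; [exact: sigmaF_sub|exact: g_sigma_preimage_sub (@mxis k) _].
Qed.

Lemma history_x0 k : measurable_fun [set: g_sigma_algebraType (history_gen k)] x0.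
Proof.
move=> _ B mB; rewrite setTI; apply: sub_sigma_algebra; left.
by exists B => //; rewrite setTI.
Qed.

Lemma history_xis k i j : (i < k)%N ->
  measurable_fun [set: g_sigma_algebraType (history_gen k)] (@xis i j).
Proof.
move=> ik _ B mB; rewrite setTI; apply: sub_sigma_algebra; right.
by exists i => //; left; exact: sub_g_sigma_preimage.
Qed.

Lemma history_etas k i j : (i < k)%N ->
  measurable_fun [set: g_sigma_algebraType (history_gen k)] (@etas i j).
Proof.
move=> ik _ B mB; rewrite setTI; apply: sub_sigma_algebra; right.
by exists i => //; right; exact: sub_g_sigma_preimage.
Qed.

Lemma history_hat_measurable k d3 (F : measurableType d3) (f : Omega -> F) :
  measurable_fun [set: g_sigma_algebraType (history_gen k)] f ->
  measurable_fun [set: g_sigma_algebraType (history_hat_gen k)] f.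
Proof.
move=> mf _ B mB; rewrite setTI; apply: sub_sigma_algebra; left.
by have := mf measurableT B mB; rewrite setTI.
Qed.

Lemma history_hat_xis k j :
  measurable_fun [set: g_sigma_algebraType (history_hat_gen k)] (@xis k j).
Proof.
move=> _ B mB; rewrite setTI; apply: sub_sigma_algebra; right.
exact: sub_g_sigma_preimage.
Qed.

End history.

(** * Descent in the mean *)

(** Sampling errors at rate [1 / s ^+ 2] and [1 / s], collected at the common
    rate [1 / s]. *)
Lemma collect_rates (R : realFieldType) (K Kt h q s : R) :
  0 <= K -> 0 <= Kt -> 0 <= h -> 0 <= q -> 1 <= s ->
  K / s ^+ 2 * (1 + q) + K / s * (1 + q) + Kt / s ^+ 2 * (1 + q)
    + (1 + s) * (K / s ^+ 2 * (1 + h * (1 + q))) + s^-1 * (h * (1 + q)) <=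
  (K + K + Kt + 2 * K * (1 + h) + h) / s * (1 + q).
Proof.
move=> K0 Kt0 h0 q0 s1.
have s0 : 0 < s by exact: lt_le_trans s1.
have si0 : 0 < s^-1 by rewrite invr_gt0.
have si1 : s^-1 <= 1 by rewrite invf_le1.
have s2 : (s ^+ 2)^-1 = s^-1 * s^-1 by rewrite expr2 invfM.
have sle : s^-1 * s^-1 <= s^-1 by rewrite ler_piMl// ltW.
have q1 : 0 <= 1 + q by rewrite addr_ge0.
have e1 : K / s ^+ 2 * (1 + q) <= K / s * (1 + q).
  by rewrite s2 ler_wpM2r// ler_wpM2l.
have e3 : Kt / s ^+ 2 * (1 + q) <= Kt / s * (1 + q).
  by rewrite s2 ler_wpM2r// ler_wpM2l.
have e4 : (1 + s) * (K / s ^+ 2 * (1 + h * (1 + q))) <=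
    2 * K * (1 + h) / s * (1 + q).
  rewrite [leLHS](_ : _ = K * ((1 + s) / s ^+ 2) * (1 + h * (1 + q))); last by ring.
  rewrite [leRHS](_ : _ = K * (2 / s) * ((1 + h) * (1 + q))); last by ring.
  have f1 : (1 + s) / s ^+ 2 <= 2 / s.
    rewrite s2 mulrDl (mulrA s) divff ?gt_eqF// !mul1r.
    by move: sle; move: (s^-1 * s^-1) (s^-1) => a b; lra.
  have f2 : 1 + h * (1 + q) <= (1 + h) * (1 + q).
    by rewrite mulrDl mul1r lerD2r lerDl.
  apply: ler_pM => //.
  - by rewrite mulr_ge0// divr_ge0 ?sqr_ge0// addr_ge0// ltW.
  - by rewrite addr_ge0// mulr_ge0.
  - by rewrite ler_wpM2l.
have -> : (K + K + Kt + 2 * K * (1 + h) + h) / s * (1 + q) =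
    K / s * (1 + q) + K / s * (1 + q) + Kt / s * (1 + q)
    + 2 * K * (1 + h) / s * (1 + q) + s^-1 * (h * (1 + q)) by ring.
by rewrite lerD2r lerD// lerD// lerD2r.
Qed.

Lemma recursion_step (R : realFieldType) (a' a b c : R) :
  a' <= a + b * (1 + a) - c -> a' + c <= (1 + b) * a + b.
Proof. by rewrite lerBrDr mulrDr mulr1 mulrDl mul1r addrA (addrAC a). Qed.

Section convergence.
Context {R : realType} {n : nat} {d d' : measure_display}
  {Omega : measurableType d} {Xi : measurableType d'} (P : probability Omega R).
Variables (X : set 'rV[R]_n) (T : Xi -> 'rV[R]_n -> 'rV[R]_n) (xi : {RV P >-> Xi})
  (L : Xi -> R) (xcheck xs : 'rV[R]_n) (qbar nu gamma rho mu tau M : R)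
  (x0 : {RV P >-> 'rV[R]_n}) (Sk : nat -> nat)
  (xis etas : forall k, 'I_(Sk k) -> {RV P >-> Xi}).
Arguments xis : clear implicits.
Arguments etas : clear implicits.
Hypotheses (closedX : closed X)
  (convexX : convex_set (X : set (convex_lmodType 'rV[R]_n)))
  (measT : measurable_fun [set: Xi * 'rV[R]_n] (fun p => T p.1 p.2))
  (solxs : SOL X (expected_map P xi T) xs)
  (pseudoH : pseudomonotone_on X (expected_map P xi T))
  (measL : measurable_fun setT L)
  (L_ge1 : {ae P, forall w, 1 <= L (xi w)})
  (lipT : {ae distribution P xi, forall z, forall x y : 'rV[R]_n,
     enorm (T z x - T z y) <= L z * enorm (x - y)})
  (momL : forall p : R, 2 <= p ->
     ('E_P[fun w => (L (xi w) `^ (2 * p))%R] < +oo)%E)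
  (qbar_ge2 : 2 <= qbar)
  (momT : ('E_P[fun w => (enorm (T (xi w) xcheck) `^ (2 * qbar))%R] < +oo)%E)
  (nu_ge0 : 0 <= nu) (gamma_gt0 : 0 < gamma) (gamma_le1 : gamma <= 1)
  (rho_gt0 : 0 < rho) (rho_lt1 : rho < 1)
  (mu_gt0 : 0 < mu) (mu2_lt : 3 * mu ^+ 2 < 1)
  (tau_gt : 1 / 2 < tau) (M_gt0 : 0 < M)
  (momx0 : ('E_P[fun w => (enorm (x0 w) ^+ 2)%R] < +oo)%E)
  (Sk_gt0 : forall k, (0 < Sk k)%N)
  (iid_xis : forall k, iid_sample P xi (fun j => xis k j : Omega -> Xi))
  (iid_etas : forall k, iid_sample P xi (fun j => etas k j : Omega -> Xi))
  (indep_xis_F : forall k, indep_classes P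
     (g_sigma_preimage (fun j => xis k j : Omega -> Xi))
     (sigmaF x0 xis etas k))
  (indep_etas_Fhat : forall k, indep_classes P
     (g_sigma_preimage (fun j => etas k j : Omega -> Xi))
     (sigmaFhat x0 xis etas k)).

Let H := expected_map P xi T.
Let fxis k (j : 'I_(Sk k)) : Omega -> Xi := xis k j.
Let fetas k (j : 'I_(Sk k)) : Omega -> Xi := etas k j.
Let state := seg_state X nu gamma rho mu tau M T x0 fxis fetas.
Let x k w := (state k w).1.
Let theta k w := (state k w).2.
Let Gxi k w := sample_mean T (fun j => @fxis k j w).
Let Geta k w := sample_mean T (fun j => @fetas k j w).
Let half k w := proj X (x k w -
  line_search X gamma rho mu (Gxi k w) (x k w) *: Gxi k w (x k w)).
Let trial l u := proj X (u - (rho ^+ l * gamma) *: H u).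
Let Lbar k w := lip_mean L (xis k) w.
Let m := lip_m2 xi L.
Let ell := Num.sqrt m.
Let sg := Num.sqrt (envelope_m2 T xi L xcheck xs).
Let K := noise_const T xi L xcheck xs.
Let V k w := enorm (x k w - xs) ^+ 2 + theta_potential nu tau M (theta k w).
Let r k w := residual X H gamma (x k w).
Let kap := descent_rate rho mu.
Let C0 := error_const rho mu M.

Let trial_const := 1 + 2 * (1 + sg) ^+ 2.
Let half_const := 4 * (1 + sg) ^+ 2 + 2 * K.
Let step_const := K + K + K * trial_const / (1 - rho ^+ 2)
  + 2 * K * (1 + half_const) + half_const.

Let X0 : X !=set0. Proof. by exists xs; case: solxs. Qed.

Let mx0 : measurable_fun setT (x0 : Omega -> 'rV[R]_n).
Proof. exact: measurable_funPT. Qed.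

Let mxis i j : measurable_fun setT (@fxis i j).
Proof. exact: measurable_funPT. Qed.

Let metas i j : measurable_fun setT (@fetas i j).
Proof. exact: measurable_funPT. Qed.

Let lipH u v : enorm (H u - H v) <= ell * enorm (u - v).
Proof. exact: (expected_map_lipschitz xs measT measL L_ge1 lipT momL qbar_ge2 momT). Qed.

Let growH u : enorm (H u) <= sg * (1 + enorm (u - xs)).
Proof. exact: (expected_map_growth xs measT measL L_ge1 lipT momL qbar_ge2 momT). Qed.

Let var_xis k := sample_variance xs measT measL L_ge1 lipT momL qbar_ge2 momT
  (Sk_gt0 k) (iid_xis k).

Let var_etas k := sample_variance xs measT measL L_ge1 lipT momL qbar_ge2 momT
  (Sk_gt0 k) (iid_etas k).

Let wvar_xis k := sample_weighted_variance xs measT measL L_ge1 lipT momL qbar_ge2 momT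
  (Sk_gt0 k) (iid_xis k).

Let m_ge1 : 1 <= m. Proof. exact: (lip_m2_ge1 measL L_ge1 lipT momL). Qed.

Let K_ge0 : 0 <= K. Proof. exact: noise_const_ge0. Qed.

Let theta_gt0 k w : (0 < theta k w)%N.
Proof.
rewrite /theta /state; elim: k => [//|k ih] /=.
by move: ih; case: (seg_state _ _ _ _ _ _ _ _ _ _ _ k w) => u th; exact: seg_step_theta_gt0.
Qed.

Lemma measurable_state (dU : measure_display) (U : measurableType dU) (f : U -> Omega) k :
  measurable_fun setT ((x0 : Omega -> 'rV[R]_n) \o f) ->
  (forall i j, (i < k)%N -> measurable_fun setT (@fxis i j \o f)) ->
  (forall i j, (i < k)%N -> measurable_fun setT (@fetas i j \o f)) ->
  measurable_fun setT (x k \o f) /\ measurable_fun setT (theta k \o f).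
Proof.
move=> mf0 mfx mfe.
have := @measurable_seg_state _ _ _ U X closedX convexX X0 nu gamma rho mu tau M
  _ Xi T Sk (x0 \o f) (fun i j => @fxis i j \o f) (fun i j => @fetas i j \o f) k
  measT mf0 mfx mfe.
have -> : seg_state X nu gamma rho mu tau M T (x0 \o f)
    (fun i j => @fxis i j \o f) (fun i j => @fetas i j \o f) k = state k \o f.
  apply/funext => w; rewrite /state /=.
  by elim: k {mfx mfe} => [//|k ih] /=; rewrite ih.
by move=> /measurable_fun_pairP.
Qed.

Let F k := g_sigma_algebraType (history_gen (x0 : Omega -> 'rV[R]_n) fxis fetas k).
Let Fhat k := g_sigma_algebraType (history_hat_gen (x0 : Omega -> 'rV[R]_n) fxis fetas k).

Let mxF k : measurable_fun [set: F k] (x k).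
Proof.
have [] := @measurable_state _ (F k) id k => //.
- exact: history_x0.
- by move=> i j ik; exact: history_xis.
- by move=> i j ik; exact: history_etas.
Qed.

Let mx k : measurable_fun [set: Omega] (x k).
Proof. by have [] := @measurable_state _ Omega id k. Qed.

Let mtheta k : measurable_fun [set: Omega] (theta k).
Proof. by have [] := @measurable_state _ Omega id k. Qed.

Let mhalfF k : measurable_fun [set: Fhat k] (half k).
Proof.
apply: measurable_half_point => //.
  apply: jointly_measurable_sample_mean => // j.
  exact: history_hat_xis.
exact: history_hat_measurable.
Qed.

Let mG k : jointly_measurable (Gxi k).
Proof. exact: jointly_measurable_sample_mean. Qed.

Let mhalf k : measurable_fun [set: Omega] (half k).
Proof. exact: measurable_half_point. Qed.

Let mH dU (U : measurableType dU) (u : U -> 'rV[R]_n) :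
  measurable_fun setT u -> measurable_fun setT (fun w => H (u w)).
Proof. exact: (measurable_lipschitz_vec lipH). Qed.

Let msq (dU : measure_display) (U : measurableType dU) (u : U -> 'rV[R]_n) :
  measurable_fun setT u -> measurable_fun setT (fun w => (enorm (u w) ^+ 2)%:E).
Proof. by move=> mu'; apply/measurable_EFinP/measurable_funX; exact: measurable_enorm. Qed.

Let mdist k : measurable_fun setT (fun w => (enorm (x k w - xs) ^+ 2)%:E).
Proof. by apply: msq; apply: measurable_subv => //; exact: measurable_cst. Qed.

Let mrow (dU : measure_display) (U : measurableType dU) (u : U -> 'rV[R]_n) (c : R) :
  measurable_fun setT u ->
  measurable_fun setT (fun w => (c * (1 + enorm (u w - xs) ^+ 2))%:E).
Proof.
move=> mu'; apply/measurable_EFinP; apply: measurable_funM => //.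
apply: measurable_funD => //; apply: measurable_funX; apply: measurable_enorm.
by apply: measurable_subv => //; exact: measurable_cst.
Qed.

Let mean_row (u : Omega -> 'rV[R]_n) (c q : R) : measurable_fun setT u -> 0 <= c ->
  mean_le P (fun w => (enorm (u w - xs) ^+ 2)%:E) q ->
  mean_le P (fun w => (c * (1 + enorm (u w - xs) ^+ 2))%:E) (c * (1 + q)).
Proof.
move=> mu' c0 hq.
have := mean_leZ c0 (mean_leD (mean_le_cst P ler01) hq).
apply: mean_le_ae; first exact: mrow.
  by move=> w; rewrite lee_fin mulr_ge0// addr_ge0 ?sqr_ge0.
by apply: aeW => w; rewrite -EFinD -EFinM.
Qed.

Let mV i : measurable_fun [set: Omega] (fun w => (V i w)%:E).
Proof.
apply/measurable_EFinP; apply: measurable_funD.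
  by apply: measurable_funX; apply: measurable_enorm; apply: measurable_subv.
exact: (measurableT_comp (f := theta_potential nu tau M)).
Qed.

Let V_ge0 i w : (0 <= (V i w)%:E)%E.
Proof. by rewrite lee_fin addr_ge0 ?sqr_ge0// theta_potential_ge0. Qed.

Let kap_gt0 : 0 < kap. Proof. exact: descent_rate_gt0. Qed.

Let m_gt0 : 0 < m. Proof. exact: lt_le_trans m_ge1. Qed.

Let trial_const_ge0 : 0 <= trial_const.
Proof. by rewrite addr_ge0// mulr_ge0// sqr_ge0. Qed.

Let half_const_ge0 : 0 <= half_const.
Proof. by apply: addr_ge0; apply: mulr_ge0 => //; exact: sqr_ge0. Qed.

Let rho2_lt1 : rho ^+ 2 < 1.
Proof. by rewrite exprn_ilt1 ?ltW. Qed.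

Let C0_ge0 : 0 <= C0. Proof. exact: error_const_ge0. Qed.

Let step_const_ge0 : 0 <= step_const.
Proof.
have ? : 0 <= 1 - rho ^+ 2 by rewrite subr_ge0 ltW.
have ? : 0 <= 1 + half_const by rewrite addr_ge0.
have ? : 0 <= K * trial_const / (1 - rho ^+ 2) by rewrite divr_ge0 ?mulr_ge0.
have ? : 0 <= 2 * K by exact: mulr_ge0.
have ? : 0 <= 2 * K * (1 + half_const) by exact: mulr_ge0.
rewrite /step_const; apply: addr_ge0 => //; apply: addr_ge0 => //.
by apply: addr_ge0 => //; exact: addr_ge0.
Qed.

Section one_step.
Variables (k : nat) (q : R).
Hypothesis meanD : mean_le P (fun w => (enorm (x k w - xs) ^+ 2)%:E) q.

Let S : R := (Sk k)%:R.
Let S_ge1 : 1 <= S. Proof. by rewrite ler1n. Qed.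

Let q_ge0 : 0 <= q.
Proof.
have [_ q0 qI] := meanD; rewrite -lee_fin; apply: le_trans qI.
by apply: integral_ge0.
Qed.

Let err w u := Gxi k w u - H u.
Let S2 := g_sigma_algebraType (sample_gen (@fxis k)).

Let merr (u : F k -> 'rV[R]_n) : measurable_fun setT u ->
  measurable_fun [set: F k * S2] (fun p => err p.2 (u p.1)).
Proof.
move=> mu'.
have mu1 : measurable_fun [set: F k * S2] (fun p => u p.1).
  exact: (measurableT_comp mu' measurable_fst).
apply: measurable_subv; last exact: mH.
apply: (@jointly_measurable_sample_mean _ _ _ _ _ _ _ _
  (fun j (p : F k * S2) => @fxis k j p.2)) mu1 => // j.
exact: (measurableT_comp (@sample_gen_measurable _ _ _ _ _ (@fxis k) j) measurable_snd).
Qed.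

(** The history is read at [w] and the first sample at an independent [w']. *)
Let freeze (g : Omega -> Omega -> \bar R) (h : Omega -> \bar R) a :
  measurable_fun [set: F k * S2] (fun p => g p.1 p.2) ->
  (forall w w', 0 <= g w w')%E -> measurable_fun [set: F k] h ->
  (forall w, \int[P]_w' g w w' <= h w)%E ->
  mean_le P h a -> mean_le P (fun w => g w w) a.
Proof.
apply: indep_classes_mean_le.
- exact: history_gen_sub.
- exact: sample_gen_sub.
- exact: indep_xis_F.
Qed.

(** A point determined by the history behaves like a constant with respect to the
    fresh sample. *)
Let mean_err_frozen (u : Omega -> 'rV[R]_n) a :
  measurable_fun [set: F k] u -> measurable_fun [set: Omega] u ->
  mean_le P (fun w => (enorm (u w - xs) ^+ 2)%:E) a ->
  mean_le P (fun w => (enorm (err w (u w)) ^+ 2)%:E) (K / S * (1 + a)).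
Proof.
move=> muF mu' hu.
apply: (freeze (g := fun w w' => (enorm (err w' (u w)) ^+ 2)%:E)
  (h := fun w => (K / S * (1 + enorm (u w - xs) ^+ 2))%:E)).
- by apply: msq; exact: merr.
- by move=> w w'; rewrite lee_fin sqr_ge0.
- exact: mrow.
- by move=> w; exact: var_xis.
- by apply: mean_row => //; rewrite divr_ge0.
Qed.

Let mean_err : mean_le P (fun w => (enorm (err w (x k w)) ^+ 2)%:E) (K / S * (1 + q)).
Proof. exact: mean_err_frozen. Qed.

Let mean_weighted_err :
  mean_le P (fun w => (((Lbar k w + ell) * enorm (err w (x k w))) ^+ 2)%:E)
    (K / Num.sqrt S * (1 + q)).
Proof.
apply: (freeze (g := fun w w' => (((Lbar k w' + ell) * enorm (err w' (x k w))) ^+ 2)%:E)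
  (h := fun w => (K / Num.sqrt S * (1 + enorm (x k w - xs) ^+ 2))%:E)).
- apply/measurable_EFinP/measurable_funX; apply: measurable_funM; last first.
    by apply: measurable_enorm; exact: merr.
  apply: measurable_funD => //; apply: measurable_funM => //; apply: measurable_sum => j.
  apply: (measurableT_comp measL).
  exact: (measurableT_comp (@sample_gen_measurable _ _ _ _ _ (@fxis k) j) measurable_snd).
- by move=> w w'; rewrite lee_fin sqr_ge0.
- exact: mrow.
- by move=> w; exact: wvar_xis.
- by apply: mean_row => //; rewrite divr_ge0// sqrtr_ge0.
Qed.

Let trial_dist l u :
  1 + enorm (trial l u - xs) ^+ 2 <= trial_const * (1 + enorm (u - xs) ^+ 2).
Proof.
have tl0 : 0 <= rho ^+ l by rewrite exprn_ge0 ?ltW.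
have t0 : 0 <= rho ^+ l * gamma := mulr_ge0 tl0 (ltW gamma_gt0).
have t1 : rho ^+ l * gamma <= 1.
  by rewrite (le_trans (ler_piMr tl0 gamma_le1))// exprn_ile1 ?ltW.
have D0 := enorm_ge0 (u - xs).
have h : enorm (trial l u - xs) <= (1 + sg) * (1 + enorm (u - xs)).
  have [Xxs _] := solxs.
  rewrite /trial -{1}(proj_id closedX convexX X0 Xxs).
  apply: le_trans (proj_nonexpansive closedX convexX X0 _ _) _.
  rewrite addrAC; apply: le_trans (ler_enormD _ _) _; rewrite enormN enormZ ger0_norm//.
  rewrite mulrDl mul1r lerD ?lerDr//.
  apply: le_trans (growH u); rewrite ler_piMl ?enorm_ge0//.
have h2 : enorm (trial l u - xs) ^+ 2 <= ((1 + sg) * (1 + enorm (u - xs))) ^+ 2.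
  have e0 := enorm_ge0 (trial l u - xs).
  by rewrite (ler_pXn2r _ e0 (le_trans e0 h)).
have h3 := sqrrD_le2 1 (enorm (u - xs)).
have h4 := ler_wpM2l (sqr_ge0 (1 + sg)) h3.
rewrite exprMn in h2; rewrite /trial_const mulrDl mul1r.
move: h2 h4 (sqr_ge0 (enorm (u - xs))); rewrite expr1n.
move: (enorm _ ^+ 2) (enorm _ ^+ 2) ((1 + sg) ^+ 2) ((1 + enorm _) ^+ 2) => a b c e'.
by lra.
Qed.

Let trial_sum w w' : \bar R :=
  (\sum_(l <oo) ((rho ^+ l * enorm (err w' (trial l (x k w)))) ^+ 2)%:E)%E.

(** Every trial point, as opposed to the accepted one, is determined by the
    history.  The squared step sizes are summable over all trials, so the error
    at the accepted trial is bounded by the sum of the errors at all of them. *)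
Let mean_trial_err : mean_le P (fun w => trial_sum w w)
  (K * trial_const / (1 - rho ^+ 2) / S * (1 + q)).
Proof.
have rho2 : 0 <= rho ^+ 2 < 1.
  by rewrite sqr_ge0/= exprn_ilt1 ?ltW.
have tc0 : 0 <= trial_const by rewrite addr_ge0// mulr_ge0// sqr_ge0.
have mtrial l (dU : measure_display) (U : measurableType dU) (u : U -> 'rV[R]_n) :
    measurable_fun setT u -> measurable_fun setT (fun w => trial l (u w)).
  move=> mu'; apply: measurable_proj => //; apply: measurable_subv => //.
  by apply: measurable_scalev => //; exact: mH.
have mterm l (w : Omega) : measurable_fun [set: Omega]
    (fun w' => ((rho ^+ l * enorm (err w' (trial l (x k w)))) ^+ 2)%:E).
  apply/measurable_EFinP/measurable_funX; apply: measurable_funM => //.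
  apply: measurable_enorm; apply: measurable_subv; last exact: measurable_cst.
  by apply: mG; exact: measurable_cst.
apply: (freeze (g := trial_sum)
  (h := fun w => (K * trial_const / (1 - rho ^+ 2) / S * (1 + enorm (x k w - xs) ^+ 2))%:E)).
- apply: ge0_emeasurable_sum => [l p _ _|l _]; first by rewrite lee_fin sqr_ge0.
  apply/measurable_EFinP/measurable_funX; apply: measurable_funM => //.
  by apply: measurable_enorm; apply: (merr (u := fun w => trial l (x k w))); exact: mtrial.
- by move=> w w'; apply: nneseries_ge0 => l _ _; rewrite lee_fin sqr_ge0.
- exact: mrow.
- move=> w; rewrite /trial_sum integral_nneseries//; last first.
    by move=> l w' _; rewrite lee_fin sqr_ge0.
  set c := K / S * (trial_const * (1 + enorm (x k w - xs) ^+ 2)).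
  have c0 : 0 <= c.
    by rewrite mulr_ge0 ?divr_ge0// mulr_ge0// addr_ge0// sqr_ge0.
  apply: (@le_trans _ _ (\sum_(l <oo) ((rho ^+ 2) ^+ l * c)%:E)%E).
    apply: lee_nneseries => [l _ _|l _].
      by apply: integral_ge0 => w' _; rewrite lee_fin sqr_ge0.
    have e0 : (0 <= \int[P]_w' (enorm (err w' (trial l (x k w))) ^+ 2)%:E)%E.
      by apply: integral_ge0 => w' _; rewrite lee_fin sqr_ge0.
    under eq_integral do rewrite exprMn EFinM.
    rewrite ge0_integralZl//=; last 3 first.
    + apply: msq; apply: measurable_subv; last exact: measurable_cst.
      by apply: mG; exact: measurable_cst.
    + by move=> w' _; rewrite lee_fin sqr_ge0.
    + by rewrite lee_fin sqr_ge0.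
    have -> : (rho ^+ 2) ^+ l = (rho ^+ l) ^+ 2 by rewrite -!exprM mulnC.
    rewrite (EFinM _ c) lee_wpmul2l ?lee_fin ?sqr_ge0//.
    apply: le_trans (_ : ((K / S * (1 + enorm (trial l (x k w) - xs) ^+ 2))%:E <= _)%E).
      exact: var_xis.
    by rewrite lee_fin ler_wpM2l ?divr_ge0// trial_dist.
  apply: le_trans (geometric_nneseries_le c0 rho2) _.
  rewrite lee_fin le_eqVlt; apply/orP; left; apply/eqP; rewrite /c.
  move/andP: rho2 => [_ rho21]; field.
  by rewrite !gt_eqF ?subr_gt0// (lt_le_trans ltr01).
- apply: mean_row => //.
  move/andP: rho2 => [_ rho21].
  by rewrite divr_ge0 ?divr_ge0 ?mulr_ge0// subr_ge0 ltW.
Qed.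

Let half_dist w : enorm (half k w - xs) ^+ 2 <=
  4 * (1 + sg) ^+ 2 * (1 + enorm (x k w - xs) ^+ 2) + 2 * enorm (err w (x k w)) ^+ 2.
Proof.
set t := line_search X gamma rho mu (Gxi k w) (x k w).
have [l tl] : exists l, t = rho ^+ l * gamma.
  by rewrite /t line_search_first; eexists.
have tl0 : 0 <= rho ^+ l by rewrite exprn_ge0 ?ltW.
have t0 : 0 <= t by rewrite tl (mulr_ge0 tl0 (ltW gamma_gt0)).
have t1 : t <= 1.
  by rewrite tl (le_trans (ler_piMr tl0 gamma_le1))// exprn_ile1 ?ltW.
have D0 := enorm_ge0 (x k w - xs).
have h : enorm (half k w - xs) <=
    (1 + sg) * (1 + enorm (x k w - xs)) + enorm (err w (x k w)).
  have [Xxs _] := solxs.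
  rewrite /half -/t -{1}(proj_id closedX convexX X0 Xxs).
  apply: le_trans (proj_nonexpansive closedX convexX X0 _ _) _.
  rewrite addrAC; apply: le_trans (ler_enormD _ _) _; rewrite enormN enormZ ger0_norm//.
  rewrite mulrDl mul1r -addrA lerD ?lerDr//.
  apply: (@le_trans _ _ (enorm (Gxi k w (x k w)))); first by rewrite ler_piMl ?enorm_ge0.
  apply: le_trans (ler_enormB_dist _ (H (x k w))) _.
  by rewrite lerD2r growH.
have e0 := enorm_ge0 (half k w - xs).
have h2 : enorm (half k w - xs) ^+ 2 <=
    ((1 + sg) * (1 + enorm (x k w - xs)) + enorm (err w (x k w))) ^+ 2.
  by rewrite (ler_pXn2r _ e0 (le_trans e0 h)).
apply: le_trans h2 _; apply: le_trans (sqrrD_le2 _ _) _; rewrite lerD2r exprMn.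
have h3 := sqrrD_le2 1 (enorm (x k w - xs)); rewrite expr1n in h3.
have h4 := ler_wpM2l (sqr_ge0 (1 + sg)) h3.
move: h4; move: (enorm _ ^+ 2) ((1 + sg) ^+ 2) ((1 + enorm _) ^+ 2) => a b c.
by lra.
Qed.

Let mean_half : mean_le P (fun w => (enorm (half k w - xs) ^+ 2)%:E)
  (half_const * (1 + q)).
Proof.
have c0 : 0 <= 4 * (1 + sg) ^+ 2 by rewrite mulr_ge0// sqr_ge0.
have hb := mean_leD (mean_row (mx k) c0 meanD) (mean_leZ (ler0n R 2) mean_err).
have [_ _ hbI] := hb.
apply: (@mean_le_mono _ _ _ P _ (4 * (1 + sg) ^+ 2 * (1 + q) + 2 * (K / S * (1 + q)))).
  rewrite /half_const [leRHS]mulrDl lerD2l -[leRHS]mulrA ler_pM2l//.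
  rewrite ler_wpM2r ?addr_ge0// ler_pdivrMr ?(lt_le_trans ltr01)//.
  by rewrite ler_peMr.
apply: mean_le_ae hb.
- by apply: msq; apply: measurable_subv => //; exact: measurable_cst.
- by move=> w; rewrite lee_fin sqr_ge0.
- by apply: aeW => w; rewrite -EFinM -EFinD lee_fin; exact: half_dist.
Qed.

Let S3 := g_sigma_algebraType (sample_gen (@fetas k)).

Let merr_eta (u : Fhat k -> 'rV[R]_n) : measurable_fun setT u ->
  measurable_fun [set: Fhat k * S3] (fun p => Geta k p.2 (u p.1) - H (u p.1)).
Proof.
move=> mu'.
have mu1 : measurable_fun [set: Fhat k * S3] (fun p => u p.1).
  exact: (measurableT_comp mu' measurable_fst).
apply: measurable_subv; last exact: mH.
apply: (@jointly_measurable_sample_mean _ _ _ _ _ _ _ _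
  (fun j (p : Fhat k * S3) => @fetas k j p.2)) mu1 => // j.
exact: (measurableT_comp (@sample_gen_measurable _ _ _ _ _ (@fetas k) j) measurable_snd).
Qed.

(** The extrapolation point uses the first sample of the iteration, so it is the
    larger history that is frozen here. *)
Let mean_err_eta :
  mean_le P (fun w => (enorm (Geta k w (half k w) - H (half k w)) ^+ 2)%:E)
    (K / S * (1 + half_const * (1 + q))).
Proof.
apply: (indep_classes_mean_le (g1 := history_hat_gen (x0 : Omega -> 'rV[R]_n) fxis fetas k)
  (g2 := sample_gen (@fetas k))
  (g := fun w w' => (enorm (Geta k w' (half k w) - H (half k w)) ^+ 2)%:E)
  (h := fun w => (K / S * (1 + enorm (half k w - xs) ^+ 2))%:E)).
- exact: history_hat_gen_sub.
- exact: sample_gen_sub.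
- exact: indep_etas_Fhat.
- by apply: msq; apply: merr_eta; exact: mhalfF.
- by move=> w w'; rewrite lee_fin sqr_ge0.
- by apply: mrow; exact: mhalfF.
- by move=> w; exact: var_etas.
- by apply: mean_row => //; rewrite divr_ge0.
Qed.

Let mean_residual_lip a : mean_le P (fun w => (r k w ^+ 2)%:E) a ->
  mean_le P (fun w => (r k w ^+ 2 * Lbar k w ^+ 2)%:E) (m * a).
Proof.
move=> hr.
have mrF : measurable_fun [set: F k] (r k) by exact: (measurable_residual _ _ _ _ lipH).
have mr : measurable_fun [set: Omega] (r k) by exact: (measurable_residual _ _ _ _ lipH).
have mL2 : measurable_fun [set: Omega] (Lbar k) by exact: measurable_lip_mean.
have m0 : 0 <= m by exact: le_trans m_ge1.
apply: (freeze (g := fun w w' => (r k w ^+ 2 * Lbar k w' ^+ 2)%:E)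
  (h := fun w => (m%:E * (r k w ^+ 2)%:E)%E)).
- apply/measurable_EFinP; apply: measurable_funM; apply: measurable_funX.
    exact: (measurableT_comp mrF measurable_fst).
  apply: measurable_funM => //; apply: measurable_sum => j.
  apply: (measurableT_comp measL).
  exact: (measurableT_comp (@sample_gen_measurable _ _ _ _ _ (@fxis k) j) measurable_snd).
- by move=> w w'; rewrite lee_fin mulr_ge0 ?sqr_ge0.
- by apply: emeasurable_funM => //; apply/measurable_EFinP/measurable_funX.
- move=> w; under eq_integral do rewrite EFinM.
  rewrite ge0_integralZl//=; last 3 first.
  + by apply/measurable_EFinP/measurable_funX.
  + by move=> w' _; rewrite lee_fin sqr_ge0.
  + by rewrite lee_fin sqr_ge0.
  rewrite muleC lee_wpmul2r ?lee_fin ?sqr_ge0//.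
  exact: (lip_mean_sq_le measL L_ge1 lipT momL (Sk_gt0 k) (iid_xis k)).
- exact: mean_leZ.
Qed.

Let mean_residual : mean_le P (fun w => (r k w ^+ 2)%:E) (2 * (2 + sg) ^+ 2 * (1 + q)).
Proof.
have c0 : 0 <= 2 * (2 + sg) ^+ 2 by rewrite mulr_ge0// sqr_ge0.
have mr : measurable_fun [set: Omega] (r k) by exact: (measurable_residual _ _ _ _ lipH).
apply: mean_le_ae (mean_row (mx k) c0 meanD).
- by apply/measurable_EFinP/measurable_funX.
- by move=> w; rewrite lee_fin sqr_ge0.
apply: aeW => w; rewrite lee_fin.
have D0 := enorm_ge0 (x k w - xs).
have [Xxs _] := solxs.
have h : r k w <= (2 + sg) * (1 + enorm (x k w - xs)).
  rewrite /r /residual; apply: le_trans (enorm_dist _ xs _) _.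
  rewrite (enormB xs) -{1}(proj_id closedX convexX X0 Xxs).
  apply: le_trans (lerD (proj_nonexpansive closedX convexX X0 _ _) (lexx _)) _.
  rewrite addrAC; apply: le_trans (lerD (ler_enormD _ _) (lexx _)) _.
  rewrite enormN enormZ gtr0_norm//.
  have h1 : gamma * enorm (H (x k w)) <= sg * (1 + enorm (x k w - xs)).
    by apply: le_trans (growH _); rewrite ler_piMl ?enorm_ge0.
  move: h1 D0; move: (gamma * _) (enorm (x k w - xs)) => a D h1 D0.
  by rewrite mulrDl; move: h1; move: (sg * _) => b; lra.
have r0 : 0 <= r k w by exact: enorm_ge0.
apply: (@le_trans _ _ (((2 + sg) * (1 + enorm (x k w - xs))) ^+ 2)).
  by rewrite (ler_pXn2r _ r0 (le_trans r0 h)).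
have h3 := sqrrD_le2 1 (enorm (x k w - xs)); rewrite expr1n in h3.
rewrite exprMn; have h4 := ler_wpM2l (sqr_ge0 (2 + sg)) h3.
move: h4; move: (enorm _ ^+ 2) ((2 + sg) ^+ 2) ((1 + enorm _) ^+ 2) => a b c.
by lra.
Qed.

Let mr : measurable_fun [set: Omega] (r k).
Proof. exact: (measurable_residual _ _ _ _ lipH). Qed.

(** Mean Lyapunov decrease.  Half of the residual term pays for the random factor
    [Lbar k ^+ 2], whose mean is at most [m]. *)
Lemma mean_descent v : mean_le P (fun w => (V k w)%:E) v ->
  exists s, [/\ 0 <= s, (\int[P]_w (r k w ^+ 2)%:E)%E = s%:E &
  mean_le P (fun w => (V k.+1 w)%:E)
    (v + C0 * step_const / Num.sqrt (Sk k)%:R * (1 + q) - kap / (2 * m) * s)].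
Proof.
move=> hV; pose sS := Num.sqrt S.
have r0 : (0 <= \int[P]_w (r k w ^+ 2)%:E)%E.
  by apply: integral_ge0 => w _; rewrite lee_fin sqr_ge0.
pose s := fine (\int[P]_w (r k w ^+ 2)%:E)%E.
have hs : (\int[P]_w (r k w ^+ 2)%:E)%E = s%:E.
  by rewrite fineK// ge0_fin_numE//; have [_ _ rq] := mean_residual;
    apply: le_lt_trans rq _; rewrite ltry.
exists s; split => //; first exact: fine_ge0.
have sS1 : 1 <= sS by rewrite -[leLHS]sqrtr1 ler_wsqrtr.
have sS0 : 0 < sS by exact: lt_le_trans sS1.
have hr : mean_le P (fun w => (r k w ^+ 2)%:E) s.
  by split; [exact/measurable_EFinP/measurable_funX|
    move=> w; rewrite lee_fin sqr_ge0|rewrite hs].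
have c1 : 0 <= kap / (2 * m ^+ 2).
  by apply: divr_ge0; [exact: ltW|apply: mulr_ge0 => //; exact: sqr_ge0].
have c2 : 0 <= 1 + sS by rewrite addr_ge0// ltW.
have c3 : 0 <= sS^-1 by rewrite invr_ge0 ltW.
have hB := mean_leD (mean_leD hV (mean_leZ c1 (mean_residual_lip hr)))
  (mean_leZ C0_ge0 (mean_leD (mean_leD (mean_leD (mean_leD mean_err mean_weighted_err)
    mean_trial_err) (mean_leZ c2 mean_err_eta)) (mean_leZ c3 mean_half))).
set tot := (X in mean_le _ _ X) in hB.
have hL : mean_le P (fun w => (V k.+1 w)%:E + (kap / m)%:E * (r k w ^+ 2)%:E)%E tot.
  apply: mean_le_ae hB.
  - apply: emeasurable_funD; first exact: mV.
    by apply: emeasurable_funM => //; exact/measurable_EFinP/measurable_funX.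
  - move=> w; apply: adde_ge0 => //; rewrite -EFinM lee_fin.
    by apply: mulr_ge0; [apply: divr_ge0; exact: ltW|exact: sqr_ge0].
  apply: filterS (sample_lipschitz_draw_ae measL L_ge1 lipT (iid_xis k)) => w good.
  have L1 := lip_mean_ge1 (Sk_gt0 k) good.
  have lipG u v' := sample_mean_lipschitz u v' good.
  have [l] := seg_step_bound closedX convexX nu_ge0 gamma_gt0 gamma_le1 rho_gt0 rho_lt1
    mu_gt0 mu2_lt tau_gt M_gt0 (Geta k w) (x k w) solxs pseudoH m_gt0 L1
    (sqrtr_ge0 _) sS0 (theta_gt0 k w) lipG lipH.
  rewrite -[residual _ _ _ _]/(r k w) => bound.
  have {}bound : V k.+1 w + kap * (r k w ^+ 2 / m) <=
      V k w + kap * (r k w ^+ 2 * Lbar k w ^+ 2 / (2 * m ^+ 2)) +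
      C0 * (enorm (err w (x k w)) ^+ 2
        + ((Lbar k w + ell) * enorm (err w (x k w))) ^+ 2
        + (rho ^+ l * enorm (err w (trial l (x k w)))) ^+ 2
        + (1 + sS) * enorm (Geta k w (half k w) - H (half k w)) ^+ 2
        + sS^-1 * enorm (half k w - xs) ^+ 2).
    have stE : state k.+1 w =
        seg_step X nu gamma rho mu tau M (Gxi k w) (Geta k w) (x k w, theta k w).
      by rewrite /x /theta -surjective_pairing.
    by move: bound; rewrite -[sample_mean _ _]/(Gxi k w) -stE.
  have tr_ge : (((rho ^+ l * enorm (err w (trial l (x k w)))) ^+ 2)%:E <= trial_sum w w)%E.
    apply: (nneseries_term_le (u := fun l =>
      ((rho ^+ l * enorm (err w (trial l (x k w)))) ^+ 2)%:E)) => i.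
    by rewrite lee_fin sqr_ge0.
  apply: (@le_trans _ _ ((V k w + kap * (r k w ^+ 2 * Lbar k w ^+ 2 / (2 * m ^+ 2)))%:E +
      C0%:E * ((enorm (err w (x k w)) ^+ 2)%:E
        + (((Lbar k w + ell) * enorm (err w (x k w))) ^+ 2)%:E
        + ((rho ^+ l * enorm (err w (trial l (x k w)))) ^+ 2)%:E
        + (1 + sS)%:E * (enorm (Geta k w (half k w) - H (half k w)) ^+ 2)%:E
        + (sS^-1)%:E * (enorm (half k w - xs) ^+ 2)%:E)))%E.
    rewrite -!(EFinM, EFinD) lee_fin.
    by rewrite (_ : kap / m * r k w ^+ 2 = kap * (r k w ^+ 2 / m)) //; ring.
  apply: leeD.
    rewrite -EFinM -EFinD lee_fin lerD2l le_eqVlt; apply/orP; left; apply/eqP.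
    by rewrite mulrA mulrAC.
  apply: lee_wpmul2l; first by rewrite lee_fin.
  by do 3 apply: leeD => //.
have [mL L0 LI] := hL; split => //.
have mrE : measurable_fun setT (fun w => (r k w ^+ 2)%:E).
  exact/measurable_EFinP/measurable_funX.
have km0 : 0 <= kap / m by apply: divr_ge0; exact: ltW.
have : (\int[P]_w (V k.+1 w)%:E + (kap / m * s)%:E <= tot%:E)%E.
  apply: le_trans LI; rewrite ge0_integralD//=; last 2 first.
  - by move=> w _; rewrite mule_ge0// lee_fin sqr_ge0.
  - exact: emeasurable_funM.
  rewrite ge0_integralZl//=; last by move=> w _; rewrite lee_fin sqr_ge0.
  by rewrite hs -EFinM.
rewrite -leeBrDr// -EFinB => /le_trans; apply; rewrite lee_fin /tot.
have mE : kap / (2 * m ^+ 2) * (m * s) = kap / m * s - kap / (2 * m) * s.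
  by field; rewrite gt_eqF.
rewrite mE.
have rates := collect_rates K_ge0 (Kt := K * trial_const / (1 - rho ^+ 2)) _ half_const_ge0 q_ge0 sS1.
have SE : S = sS ^+ 2 by rewrite sqr_sqrtr.
have Kt0 : 0 <= K * trial_const / (1 - rho ^+ 2).
  by apply: divr_ge0; [exact: mulr_ge0|rewrite subr_ge0 ltW].
have := ler_wpM2l C0_ge0 (rates Kt0); rewrite -SE -/sS -/step_const.
rewrite (_ : C0 * (step_const / sS * (1 + q)) = C0 * step_const / sS * (1 + q)); last by rewrite !mulrA.
move: (C0 * step_const / sS * (1 + q)) (kap / m * s) (kap / (2 * m) * s) => a b c.
set e := C0 * (_ + _); move: e => e; lra.
Qed.

End one_step.

Let V_dist k v : mean_le P (fun w => (V k w)%:E) v ->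
  mean_le P (fun w => (enorm (x k w - xs) ^+ 2)%:E) v.
Proof.
apply: mean_le_ae => //.
- by move=> w; rewrite lee_fin sqr_ge0.
- by apply: aeW => w; rewrite lee_fin lerDl theta_potential_ge0.
Qed.

Let V0_finite : (\int[P]_w (V 0 w)%:E < +oo)%E.
Proof.
have := momx0; rewrite unlock => mom.
have mn : measurable_fun [set: Omega] (fun w => enorm (x0 w) ^+ 2).
  by apply: measurable_funX; exact: measurable_enorm.
pose c := 2 * enorm xs ^+ 2 + theta_potential nu tau M 1.
have c0 : 0 <= c.
  by rewrite /c addr_ge0 ?theta_potential_ge0// mulr_ge0 ?sqr_ge0.
have := @finite_mean_lin _ _ _ P 2 1 _ (fun _ => c) mn (measurable_cst _) (ler0n _ 2)
  ler01 (fun w => sqr_ge0 _) (fun _ => c0) mom (finite_mean_cst P c).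
apply: finite_mean_le.
- exact/measurable_EFinP/mV.
- by apply: measurable_funD; apply: measurable_funM.
- by move=> w; rewrite -lee_fin.
- by move=> w; apply: addr_ge0; apply: mulr_ge0 => //; exact: sqr_ge0.
- apply: aeW => w; rewrite mul1r /c addrA lerD2r.
  by have := enorm_sqD (x0 w) (- xs); rewrite enormN.
Qed.

Let sum_bound : cvgn (series (fun k => 1 / Num.sqrt ((Sk k)%:R : R))) ->
  exists B, forall N, \sum_(k < N) (Num.sqrt ((Sk k)%:R : R))^-1 <= B.
Proof.
move=> cv; exists (limn (series (fun k => 1 / Num.sqrt ((Sk k)%:R : R)))) => N.
have nd : nondecreasing_seq (series (fun k => 1 / Num.sqrt ((Sk k)%:R : R))).
  by apply: nondecreasing_series => i _ _; rewrite divr_ge0// sqrtr_ge0.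
have := nondecreasing_cvgn_le nd cv N; rewrite /series/= big_mkord.
by apply: le_trans; apply: ler_sum => i _; rewrite div1r.
Qed.

(** The distance to the solution is part of the Lyapunov function, so the mean
    descent is a linear recursion with summable coefficients. *)
Lemma residual_sum_bound :
  cvgn (series (fun k => 1 / Num.sqrt ((Sk k)%:R : R))) ->
  exists s : nat -> R, exists2 B : R, 0 <= B &
  (forall k, (\int[P]_w (r k w ^+ 2)%:E)%E = (s k)%:E) /\
  forall N, \sum_(k < N) s k <= B.
Proof.
move=> /sum_bound[B hB].
pose a k := fine (\int[P]_w (V k w)%:E)%E.
have hV k : mean_le P (fun w => (V k w)%:E) (a k).
  elim: k => [|k ih]; last first.
    by have [s [_ _]] := mean_descent (V_dist ih) ih; exact: mean_le_fineI.
  split => //; rewrite /a fineK; first exact: lexx.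
  rewrite ge0_fin_numE; first exact: V0_finite.
  by apply: integral_ge0 => w _; exact: V_ge0.
have a0 k : 0 <= a k by apply: fine_ge0; exact: integral_ge0.
have /choice[s hs] := fun k => mean_descent (V_dist (hV k)) (hV k).
pose b k := C0 * step_const / Num.sqrt (Sk k)%:R.
have cst0 : 0 <= C0 * step_const by rewrite mulr_ge0.
have b0 k : 0 <= b k by rewrite divr_ge0// sqrtr_ge0.
pose t := kap / (2 * m).
have t0 : 0 < t by rewrite divr_gt0// mulr_gt0.
have rec k : a k.+1 + t * s k <= (1 + b k) * a k + b k.
  apply: recursion_step; have [_ _ [_ _]] := hs k.
  by rewrite (mean_le_fine (hV k.+1)) lee_fin.
have bB N : \sum_(k < N) b k <= C0 * step_const * B.
  by rewrite -mulr_sumr ler_wpM2l.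
have ts0 k : 0 <= t * s k by have [s0 _ _] := hs k; rewrite mulr_ge0// ltW.
have sums := gronwall_sum a0 ts0 b0 rec bB.
exists s; exists ((a 0 + (a 0 + 1) * expR (C0 * step_const * B) * (C0 * step_const * B)) / t).
  by have := sums 0%N; rewrite big_ord0 => B0; rewrite divr_ge0// ltW.
split=> [k|N]; first by have [] := hs k.
by rewrite ler_pdivlMr// mulrC mulr_sumr; exact: sums.
Qed.

End convergence.

(** * The convergence rate *)

(** If all terms exceeded the bound, so would their mean. *)
Lemma bigmin_ereal_le_mean (R : realType) (s : nat -> R) (B : R) N : 0 <= B ->
  (1 <= N)%N -> \sum_(k < N.+1) s k <= B ->
  (\big[mine/+oo]_(k < N.+1) (s k)%:E <= ((B + 1) / N%:R)%:E)%E.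
Proof.
move=> B0 N1 sB; have N0 : 0 < N%:R :> R by rewrite ltr0n.
have [[k sk]|nk] := pselect (exists k : 'I_N.+1, s k <= (B + 1) / N%:R).
  by apply: (@le_trans _ _ (s k)%:E); [exact: bigmin_le|rewrite lee_fin].
exfalso; move: sB; apply/negP; rewrite -ltNge.
apply: (@lt_le_trans _ _ (\sum_(k < N.+1) (B + 1) / N%:R)).
  rewrite sumr_const card_ord -[X in _ < X]mulr_natl.
  apply: (@lt_le_trans _ _ (N%:R * ((B + 1) / N%:R))).
    by rewrite mulrC divfK ?gt_eqF// ltrDl.
  by rewrite ler_wpM2r ?ler_nat// divr_ge0 ?addr_ge0.
apply: ler_sum => k _; rewrite leNgt; apply/negP => /ltW h.
by apply: nk; exists k.
Qed.

Unset Implicit Arguments.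

Theorem theorem3p3 (R : realType) (n : nat)
  (d d' : measure_display) (Omega : measurableType d) (Xi : measurableType d')
  (P : probability Omega R)
  (X : set 'rV[R]_n) (closedX : closed X)
  (convexX : convex_set (X : set (convex_lmodType 'rV[R]_n)))
  (T : Xi -> 'rV[R]_n -> 'rV[R]_n)
  (measT : measurable_fun [set: Xi * 'rV[R]_n] (fun p => T p.1 p.2))
  (xi : {RV P >-> Xi})
  (solX : SOL X (expected_map P xi T) !=set0)
  (pseudoH : pseudomonotone_on X (expected_map P xi T))
  (L : Xi -> R) (measL : measurable_fun setT L)
  (L_ge1 : {ae P, forall w, 1 <= L (xi w)})
  (lipT : {ae distribution P xi, forall z, forall x y : 'rV[R]_n,
     enorm (T z x - T z y) <= L z * enorm (x - y)})
  (momL : forall p : R, 2 <= p ->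
     ('E_P[fun w => (L (xi w) `^ (2 * p))%R] < +oo)%E)
  (xcheck : 'rV[R]_n) (qbar : R) (qbar_ge2 : 2 <= qbar)
  (momT : ('E_P[fun w => (enorm (T (xi w) xcheck) `^ (2 * qbar))%R] < +oo)%E)
  (nu gamma rho mu tau M : R)
  (nu_ge0 : 0 <= nu) (gamma_gt0 : 0 < gamma) (gamma_le1 : gamma <= 1)
  (rho_gt0 : 0 < rho) (rho_lt1 : rho < 1)
  (mu_gt0 : 0 < mu) (mu_lt : mu < Num.sqrt 3 / 3)
  (tau_gt : 1 / 2 < tau) (M_gt0 : 0 < M)
  (x0 : {RV P >-> 'rV[R]_n}) (x0X : forall w, X (x0 w))
  (momx0 : ('E_P[fun w => (enorm (x0 w) ^+ 2)%R] < +oo)%E)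
  (Sk : nat -> nat) (Sk_gt0 : forall k, (0 < Sk k)%N)
  (xis etas : forall k, 'I_(Sk k) -> {RV P >-> Xi})
  (iid_xis : forall k, iid_sample P xi (fun j => xis k j : Omega -> Xi))
  (iid_etas : forall k, iid_sample P xi (fun j => etas k j : Omega -> Xi))
  (indep_xis_etas : forall k, indep_classes P
     (g_sigma_preimage (fun j => xis k j : Omega -> Xi))
     (g_sigma_preimage (fun j => etas k j : Omega -> Xi)))
  (indep_xis_F : forall k, indep_classes P
     (g_sigma_preimage (fun j => xis k j : Omega -> Xi))
     (sigmaF x0 xis etas k))
  (indep_etas_Fhat : forall k, indep_classes P
     (g_sigma_preimage (fun j => etas k j : Omega -> Xi))
     (sigmaFhat x0 xis etas k))
  (sumS : cvgn (series (fun k => 1 / Num.sqrt ((Sk k)%:R : R)))) :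
  let x := seg_iterate X nu gamma rho mu tau M T x0 xis etas in
  exists2 c : R, 0 < c & forall N : nat, (1 <= N)%N ->
    (\big[mine/+oo]_(k < N.+1)
       'E_P[fun w => (residual X (expected_map P xi T) gamma (x k w) ^+ 2)%R]
     <= (c / N%:R)%:E)%E.
Proof.
move=> x; have [xs solxs] := solX.
have mu2_lt : 3 * mu ^+ 2 < 1.
  have m3 : mu * 3 < Num.sqrt 3 by rewrite -ltr_pdivlMr.
  have m0 : 0 <= mu * 3 by rewrite mulr_ge0// ltW.
  have := m3; rewrite -(@ltr_pXn2r _ 2) ?nnegrE ?sqrtr_ge0// sqr_sqrtr//.
  by rewrite exprMn; lra.
have [s [B B0 [sE sB]]] := residual_sum_bound closedX convexX measT solxs pseudoH measL
  L_ge1 lipT momL qbar_ge2 momT nu_ge0 gamma_gt0 gamma_le1 rho_gt0 rho_lt1 mu_gt0 mu2_lt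
  tau_gt M_gt0 momx0 Sk_gt0 iid_xis iid_etas indep_xis_F indep_etas_Fhat sumS.
exists (B + 1); first by rewrite ltr_wpDl.
move=> N N1; apply: le_trans (bigmin_ereal_le_mean B0 N1 (sB N.+1)).
rewrite le_eqVlt; apply/orP; left; apply/eqP; apply: eq_bigr => k _.
by rewrite unlock -sE.
Qed.
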